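(* Let $\alpha$ be the standard metric of constant sectional curvature $1$ on the unit sphere $\mathrm S^n$, let $f$ be an eigenfunction on $\mathrm S^n$ of the standard Laplacian corresponding to the eigenvalue $n$ (i.e. $\Delta f=-nf$) with $\max|f|<1$, and suppose that $$F(x,y)=\alpha(x,y)-\frac{f_{x^k}(x)y^k}{\sqrt{1-f(x)^2}}$$ is a Randers metric on $\mathrm S^n$. Then $\delta:=\sqrt{|\nabla f|_\alpha^2(x)+f(x)^2}$ is a constant with $\delta<1$, and the flag curvature of $F$ satisfies $$\frac{2-\delta}{2(1+\delta)}\le\mathbf K\le\frac{2+\delta}{2(1-\delta)}.$$ Moreover, the geodesics of $F$ are great circles (as point sets), and the $F$-length of any great circle is equal to $2\pi$.
   Context: $n\ge2$. A Randers metric is $F=\alpha+\beta$, where $\alpha=\sqrt{a_{ij}(x)y^iy^j}$ is (the norm of) a Riemannian metric and $\beta=b_i(x)y^i$ is a 1-form with $\|\beta\|_\alpha(x)=\sqrt{a^{ij}(x)b_i(x)b_j(x)}<1$ for all $x$. $\Delta$ is the Laplace-Beltrami operator of $\alpha$ (trace of the Hessian), $\nabla f$ is the gradient with respect to $\alpha$. Subscripts $x^k$, $y^k$ denote partial derivatives in standard local coordinates; repeated indices are summed. The $F$-length of a curve $\sigma(t)$ is $\int F(\sigma(t),\dot\sigma(t))\,dt$ (a great circle is traversed once). With $g_{ij}(x,y)=\frac12[F^2]_{y^iy^j}$, $(g^{ij})=(g_{ij})^{-1}$ and $G^i=\frac14 g^{il}\{[F^2]_{x^ky^l}y^k-[F^2]_{x^l}\}$,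 geodesics $\gamma$ of $F$ satisfy $\ddot\gamma^i+2G^i(\gamma,\dot\gamma)=0$. Riemann curvature: $K^i_{\ k}=2\frac{\partial G^i}{\partial x^k}-y^j\frac{\partial^2G^i}{\partial x^j\partial y^k}+2G^j\frac{\partial^2G^i}{\partial y^j\partial y^k}-\frac{\partial G^i}{\partial y^j}\frac{\partial G^j}{\partial y^k}$, $\mathbf K_y(u)=K^i_{\ k}u^k\,\partial/\partial x^i$. The flag curvature of a plane $P=\mathrm{span}\{y,u\}\subset T_x\mathrm S^n$ with flagpole $y$ is $\mathbf K(P,y)=\frac{\mathbf g_y(u,\mathbf K_y(u))}{\mathbf g_y(y,y)\mathbf g_y(u,u)-\mathbf g_y(y,u)^2}$ with $\mathbf g_y=g_{ij}(x,y)dx^i\otimes dx^j$; the bounds are for all flags. *)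

(* Defs.v *)
From HB Require Import structures.
From mathcomp Require Import all_boot all_order all_algebra.
From mathcomp Require Import all_classical all_reals all_analysis.

Set Implicit Arguments.
Unset Strict Implicit.
Unset Printing Implicit Defensive.

Import Order.TTheory GRing.Theory Num.Theory.
Import numFieldNormedType.Exports.

Local Open Scope ring_scope.
Local Open Scope classical_set_scope.

Section EuclideanSpace.
Context {R : realType} {n : nat}.
Implicit Types u v : 'rV[R]_n.

(* The library norm `|u| on 'rV[R]_n is the sup norm (same topology), so the
   Euclidean one is introduced separately. *)
Definition edot u v : R := \sum_i u 0 i * v 0 i.
Definition enorm u : R := Num.sqrt (edot u u).

Definition pd {V : normedModType R} (i : 'I_n) (g : 'rV[R]_n -> V) :
  'rV[R]_n -> V := fun x => 'D_(delta_mx 0 i) g x.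

(* C^oo on an open set U: all iterated partial derivatives exist and are
   continuous at every point of U. *)
Definition smooth_on {V : normedModType R} (U : set 'rV[R]_n)
    (g : 'rV[R]_n -> V) : Prop :=
  forall (s : seq 'I_n) (x : 'rV[R]_n), U x ->
    {for x, continuous (foldr pd g s)} /\
    (forall i, derivable (foldr pd g s) x (delta_mx 0 i)).

End EuclideanSpace.

Section Sphere.
Context {R : realType} {n : nat}.

(* S^n as a subset of R^{n+1}.  Functions, forms, metrics on S^n are given by
   functions on R^{n+1}, of which only the values at points of S^n (and at
   tangent vectors, i.e. vectors orthogonal to the base point) are used. *)
Definition sphere : set 'rV[R]_n.+1 := [set p | enorm p = 1].

(* A local coordinate system of S^n, given by its inverse: a smooth injective
   immersion phi of an open set U of R^n into S^n (by the inverse function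
   theorem, a diffeomorphism onto an open subset of S^n). *)
Definition local_coord (U : set 'rV[R]_n) (phi : 'rV[R]_n -> 'rV[R]_n.+1) :
    Prop :=
  [/\ open U, smooth_on U phi, (forall x, U x -> sphere (phi x)),
      set_inj U phi &
      forall x, U x -> row_free (\matrix_(i < n) pd i phi x)].

Definition smooth_fun (f : 'rV[R]_n.+1 -> R) : Prop :=
  forall U phi, local_coord U phi -> smooth_on U (f \o phi).

(* df_p(v) for p in S^n and v tangent to S^n at p: the derivative at s = 0 of
   f along the curve s |-> (p + s v) / |p + s v| of S^n. *)
Definition sdiff (f : 'rV[R]_n.+1 -> R) (p v : 'rV[R]_n.+1) : R :=
  'D_v (fun q => f ((enorm q)^-1 *: q)) p.

(* Components of the standard metric alpha and of a 1-form beta: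
   a_ij = <d_i phi, d_j phi> and b_i = beta(d_i phi). *)
Definition round_metric (phi : 'rV[R]_n -> 'rV[R]_n.+1) (x : 'rV[R]_n) :
  'M[R]_n := \matrix_(i, j) edot (pd i phi x) (pd j phi x).

Definition form_coef (beta : 'rV[R]_n.+1 -> 'rV[R]_n.+1 -> R)
    (phi : 'rV[R]_n -> 'rV[R]_n.+1) (i : 'I_n) (x : 'rV[R]_n) : R :=
  beta (phi x) (pd i phi x).

Definition one_form (beta : 'rV[R]_n.+1 -> 'rV[R]_n.+1 -> R) : Prop :=
  (forall p, sphere p -> forall (c : R) v w, edot p v = 0 -> edot p w = 0 ->
     beta p (c *: v + w) = c * beta p v + beta p w) /\
  (forall U phi, local_coord U phi ->
     forall i, smooth_on U (form_coef beta phi i)).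

(* A function F on TS^n read in the coordinates (x, y) of TS^n induced by
   local coordinates x. *)
Definition in_coord (F : 'rV[R]_n.+1 -> 'rV[R]_n.+1 -> R)
    (phi : 'rV[R]_n -> 'rV[R]_n.+1) (x y : 'rV[R]_n) : R :=
  F (phi x) ('D_y phi x).

End Sphere.

Section Riemannian.
Context {R : realType} {n : nat}.
Variable a : 'rV[R]_n -> 'M[R]_n.
Implicit Types (h : 'rV[R]_n -> R) (x : 'rV[R]_n).

Definition christoffel x (k i j : 'I_n) : R :=
  2^-1 * \sum_l invmx (a x) k l *
    (pd i (fun z => a z l j) x + pd j (fun z => a z l i) x
     - pd l (fun z => a z i j) x).

Definition hessian h x : 'M[R]_n :=
  \matrix_(i, j) (pd i (pd j h) x - \sum_k christoffel x k i j * pd k h x).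

Definition laplacian h x : R :=
  \sum_i \sum_j invmx (a x) i j * hessian h x i j.

Definition gradient h x : 'rV[R]_n :=
  \row_i \sum_j invmx (a x) i j * pd j h x.

Definition vec_norm x (v : 'rV[R]_n) : R :=
  Num.sqrt (\sum_i \sum_j a x i j * v 0 i * v 0 j).

Definition covec_norm x (b : 'I_n -> R) : R :=
  Num.sqrt (\sum_i \sum_j invmx (a x) i j * b i * b j).

End Riemannian.

Section Finsler.
Context {R : realType} {n : nat}.
Variable L : 'rV[R]_n -> 'rV[R]_n -> R.
Implicit Types x y u v : 'rV[R]_n.

Definition fund_tensor x y : 'M[R]_n :=
  \matrix_(i, j) (2^-1 * pd j (pd i (fun y' => L x y' ^+ 2)) y).

Definition fund_form x y u v : R :=
  \sum_i \sum_j fund_tensor x y i j * u 0 i * v 0 j.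

Definition spray (i : 'I_n) x y : R :=
  4^-1 * \sum_l invmx (fund_tensor x y) i l *
    (\sum_k pd l (fun y' => pd k (fun x' => L x' y' ^+ 2) x) y * y 0 k
     - pd l (fun x' => L x' y ^+ 2) x).

Definition riem_coef x y (i k : 'I_n) : R :=
  2 * pd k (fun x' => spray i x' y) x
  - \sum_j y 0 j * pd j (fun x' => pd k (fun y' => spray i x' y') y) x
  + 2 * \sum_j spray j x y * pd j (pd k (fun y' => spray i x y')) y
  - \sum_j pd j (fun y' => spray i x y') y * pd k (fun y' => spray j x y') y.

Definition riem x y u : 'rV[R]_n := \row_i \sum_k riem_coef x y i k * u 0 k.

(* Flag curvature of the plane span{y, u} with flagpole y. *)
Definition flag_curvature x y u : R :=
  fund_form x y u (riem x y u) /
  (fund_form x y y y * fund_form x y u u - fund_form x y y u ^+ 2).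

End Finsler.

Section RandersSphere.
Context {R : realType} {n : nat}.

Definition eigenfunction (lambda : R) (f : 'rV[R]_n.+1 -> R) : Prop :=
  [/\ smooth_fun f, (exists2 p, sphere p & f p != 0) &
      forall U phi, local_coord U phi -> forall x, U x ->
        laplacian (round_metric phi) (f \o phi) x = - lambda * f (phi x)].

Definition randers (beta : 'rV[R]_n.+1 -> 'rV[R]_n.+1 -> R)
    (p v : 'rV[R]_n.+1) : R := enorm v + beta p v.

(* alpha + beta is a Randers metric on S^n, alpha being the standard metric *)
Definition is_randers (beta : 'rV[R]_n.+1 -> 'rV[R]_n.+1 -> R) : Prop :=
  one_form beta /\
  forall U phi, local_coord U phi -> forall x, U x ->
    covec_norm (round_metric phi) x (fun i => form_coef beta phi i x) < 1.

(* gamma : J -> S^n, J a nonempty open interval, is a (nonconstant) geodesic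
   of F.  The last clause is the geodesic equation at t for the coordinate
   expression c of gamma near t, in every local coordinate system around
   gamma(t). *)
Definition geodesic (F : 'rV[R]_n.+1 -> 'rV[R]_n.+1 -> R) (J : set R)
    (gamma : R -> 'rV[R]_n.+1) : Prop :=
  [/\ [/\ open J, is_interval J & J !=set0],
      (forall t, J t -> sphere (gamma t)),
      (forall t, J t -> derivable gamma t 1 /\ derivable (derive1 gamma) t 1),
      (forall t, J t -> derive1 gamma t != 0) &
      forall U phi, local_coord U phi ->
      forall (c : R -> 'rV[R]_n) (t : R), J t ->
        (\forall s \near t,
           [/\ U (c s), phi (c s) = gamma s & derivable c s 1]) ->
        derivable (derive1 c) t 1 ->
        forall i, (derive1 (derive1 c) t) 0 i
                  + 2 * spray (in_coord F phi) i (c t) (derive1 c t) = 0].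

Definition maximal_geodesic (F : 'rV[R]_n.+1 -> 'rV[R]_n.+1 -> R) (J : set R)
    (gamma : R -> 'rV[R]_n.+1) : Prop :=
  geodesic F J gamma /\
  forall J' gamma', geodesic F J' gamma' -> J `<=` J' ->
    (forall t, J t -> gamma' t = gamma t) -> J' = J.

(* p, q orthonormal: the great circle through p with initial velocity q,
   traversed once for t in [0, 2 pi] *)
Definition circle_param (p q : 'rV[R]_n.+1) (t : R) : 'rV[R]_n.+1 :=
  cos t *: p + sin t *: q.

Definition orthonormal2 (p q : 'rV[R]_n.+1) : Prop :=
  [/\ enorm p = 1, enorm q = 1 & edot p q = 0].

Definition great_circle (C : set 'rV[R]_n.+1) : Prop :=
  exists p q, orthonormal2 p q /\ C = range (circle_param p q).

Definition curve_length (F : 'rV[R]_n.+1 -> 'rV[R]_n.+1 -> R)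
    (sigma : R -> 'rV[R]_n.+1) (t0 t1 : R) : R :=
  \int[lebesgue_measure]_(t in `[t0, t1]) F (sigma t) (derive1 sigma t).

End RandersSphere.

(* Main.v *)
Require Import Defs.
From HB Require Import structures.
From mathcomp Require Import all_boot all_order all_algebra.
From mathcomp Require Import all_classical all_reals all_analysis.
From mathcomp Require Import ring lra.
Import Order.TTheory GRing.Theory Num.Theory.
Import numFieldNormedType.Exports.
Local Open Scope ring_scope.
Local Open Scope classical_set_scope.

(** Let u(x) = |x| f(x/|x|).  The eigenvalue equation says that u is harmonic off
    the origin, and for fixed h the second difference u(x + h) + u(x - h) - 2 u(x)
    tends to 0 at infinity, so it vanishes by the maximum principle (logarithmic
    barriers take care of the singular points) and u is a linear form <a, .>.
    Hence delta = |a| and F(p, v) = |v| - <a, v> / sqrt (1 - <a, p>^2), where the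
    1-form is the differential of arccos <a, .>.  So great circles remain geodesics
    and closed curves keep their length.  The curvature follows from the spray, the
    round one plus P y; the curvature of the flag (P, y) depends only on <a, p>
    and on e = <a, y> / (|y| sqrt (1 - <a, p>^2)). *)
Set Implicit Arguments.
Unset Strict Implicit.
Unset Printing Implicit Defensive.

(** * Directional derivatives and smooth functions *)

Section DirectionalDerivatives.
Context {R : realType} {V : normedModType R}.
Implicit Types (x v : V).

(** Degree one is the right homogeneity: with r the distance to the origin, the Laplacian of r f is
    (Delta f + n f) / r. Second differences tend to 0 because u is differentiable off the origin,
    uniformly near the compact unit sphere, and homogeneity turns a step h at x into a step h / |x|
    at x / |x|. The barrier ln |x| is strictly subharmonic from ambient dimension 3 on, which is
    what n >= 2 provides.

    The obstacle in the curvature is the inverse metric inside the spray coefficients, whose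
    derivatives are unwieldy. All coefficients are therefore pushed forward to R^(n+1) by the
    differential of the chart: the inverse metric becomes the projection onto the tangent space, the
    terms that depend on the chart cancel as ambient vectors, and injectivity of the differential
    brings the result back.

    With s^2 = 1 - <a, p>^2 the flag curvature is 1/4 + 3/4 (1 + e) / ((1 - e) s^2), and
    Cauchy-Schwarz for the tangential part of a reads s^2 (1 - e^2) >= 1 - delta^2. Together they
    give the two bounds. *)

Lemma is_derive_rV m (g : V -> 'rV[R]_m) x v (d : 'rV[R]_m) :
  (forall j, is_derive x v (fun z => g z 0 j) (d 0 j)) -> is_derive x v g d.
Proof.
move=> gd.
have dg : derivable g x v.
  by apply/derivable_mxP => i j; rewrite (ord1 i); case: (gd j).
apply: DeriveDef => //; rewrite derive_mx //; apply/rowP => j.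
by rewrite mxE; case: (gd j).
Qed.

Lemma is_derive_coord m (g : V -> 'rV[R]_m) x v (d : 'rV[R]_m) j :
  is_derive x v g d -> is_derive x v (fun z => g z 0 j) (d 0 j).
Proof.
move=> [dg <-]; have /derivable_mxP/(_ 0 j) dgj := dg.
by apply: DeriveDef => //; rewrite derive_mx // mxE.
Qed.

(** The two difference quotients coincide, so one-variable calculus applies along lines: the chain
    rule for a real outer function and the mean value theorem are obtained this way. *)
Lemma is_derive_line (W : normedModType R) (f : V -> W) x v t d :
  is_derive (x + t *: v) v f d <-> is_derive t 1 (fun s => f (x + s *: v)) d.
Proof.
have E : (fun h : R => h^-1 *: (f (h *: v + (x + t *: v)) - f (x + t *: v))) =
  (fun h => h^-1 *: (f (x + (h *: 1 + t) *: v) - f (x + t *: v))).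
  apply/funext => h; congr (_ *: (f _ - _)).
  by rewrite [h *: 1]mulr1 scalerDl addrCA.
split=> -[df dv]; apply: DeriveDef.
- by move: df; rewrite /derivable /= E.
- by move: dv; rewrite /derive /= E.
- by move: df; rewrite /derivable /= E.
- by move: dv; rewrite /derive /= E.
Qed.

Lemma is_derive_compR (h : R -> R) (g : V -> R) x v (a b : R) :
  is_derive (g x) 1 h a -> is_derive x v g b ->
  is_derive x v (fun z => h (g z)) (a * b).
Proof.
move=> ha gb; have x0 : x = x + 0 *: v by rewrite scale0r addr0.
rewrite x0; apply/is_derive_line; rewrite x0 in gb ha.
by apply: is_derive1_comp => //; apply/is_derive_line.
Qed.

Lemma is_derive_add (W : normedModType R) (f g : V -> W) x v a b :
  is_derive x v f a -> is_derive x v g b ->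
  is_derive x v (fun z => f z + g z) (a + b).
Proof. exact: is_deriveD. Qed.

Lemma is_derive_opp (W : normedModType R) (f : V -> W) x v a :
  is_derive x v f a -> is_derive x v (fun z => - f z) (- a).
Proof. exact: is_deriveN. Qed.

Lemma is_derive_sub (W : normedModType R) (f g : V -> W) x v a b :
  is_derive x v f a -> is_derive x v g b ->
  is_derive x v (fun z => f z - g z) (a - b).
Proof. exact: is_deriveB. Qed.

Lemma is_derive_const (W : normedModType R) (w : W) x v :
  is_derive x v (fun=> w) 0.
Proof. exact: is_derive_cst. Qed.

Lemma is_derive_mul (f g : V -> R) x v (a b : R) :
  is_derive x v f a -> is_derive x v g b ->
  is_derive x v (fun z => f z * g z) (a * g x + f x * b).
Proof.
move=> fa gb; apply: is_derive_eq (is_deriveM fa gb) _.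
by rewrite addrC; congr (_ + _); rewrite -[LHS]/(_ * _) mulrC.
Qed.

Lemma is_derive_bigsum (W : normedModType R) (I : Type) (r : seq I)
    (P : pred I) (f : I -> V -> W) x v (d : I -> W) :
  (forall i, P i -> is_derive x v (f i) (d i)) ->
  is_derive x v (fun z => \sum_(i <- r | P i) f i z) (\sum_(i <- r | P i) d i).
Proof.
move=> fd; elim: r => [|i r IHr].
  rewrite big_nil; under eq_fun do rewrite big_nil; exact: is_derive_const.
rewrite big_cons; under eq_fun do rewrite big_cons.
by case: ifPn => // Pi; apply: is_derive_add => //; exact: fd.
Qed.

Lemma is_derive_scale m (f : V -> R) (g : V -> 'rV[R]_m) x v (a : R) b :
  is_derive x v f a -> is_derive x v g b ->
  is_derive x v (fun z => f z *: g z) (a *: g x + f x *: b).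
Proof.
move=> fa gb; apply: is_derive_rV => j; under eq_fun do rewrite mxE.
rewrite !mxE; apply: is_derive_mul => //; exact: is_derive_coord.
Qed.

Lemma is_derive_edot m (g h : V -> 'rV[R]_m) x v a b :
  is_derive x v g a -> is_derive x v h b ->
  is_derive x v (fun z => edot (g z) (h z)) (edot a (h x) + edot (g x) b).
Proof.
move=> ga hb; rewrite /edot -big_split /=; apply: is_derive_bigsum => i _.
by apply: is_derive_mul; exact: is_derive_coord.
Qed.

Lemma is_derive_invr (f : V -> R) x v (a : R) : f x != 0 -> is_derive x v f a ->
  is_derive x v (fun z => (f z)^-1) (- a / f x ^+ 2).
Proof.
move=> fx0 [df <-]; apply: DeriveDef; first exact: derivableV.
by rewrite deriveV // -[LHS]/(_ * _) !mulNr mulrC.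
Qed.

Lemma is_derive_sqrtr (f : V -> R) x v (a : R) : 0 < f x -> is_derive x v f a ->
  is_derive x v (fun z => Num.sqrt (f z)) (a / (2 * Num.sqrt (f x))).
Proof.
move=> fx0 fa.
apply: is_derive_eq (is_derive_compR (is_derive1_sqrt fx0) fa) _.
by rewrite mulrC.
Qed.

Lemma is_derive_near (W : normedModType R) (U : set V) (f g : V -> W) x v d :
  open U -> U x -> (forall z, U z -> f z = g z) ->
  is_derive x v f d -> is_derive x v g d.
Proof.
move=> oU Ux fg; apply: near_eq_is_derive.
by apply: filterS fg _; exact: open_nbhs_nbhs.
Qed.

Lemma is_derive_val (W : normedModType R) (f : V -> W) x v d :
  is_derive x v f d -> 'D_v f x = d.
Proof. by case. Qed.

Lemma derive_near (W : normedModType R) (U : set V) (f g : V -> W) x v :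
  open U -> U x -> (forall z, U z -> f z = g z) -> 'D_v f x = 'D_v g x.
Proof.
move=> oU Ux fg; apply: near_eq_derive.
by apply: filterS fg _; exact: open_nbhs_nbhs.
Qed.

End DirectionalDerivatives.

(** * Functions with continuous partial derivatives: strict differentiability and the chain rule *)

Section ContinuouslyDifferentiable.
Context {R : realType}.

Lemma rV_norm_lt n (u : 'rV[R]_n) (r : R) : 0 < r ->
  (`|u| < r) <-> (forall i, `|u 0 i| < r).
Proof.
move=> r0; rewrite [`|u|]/Num.Def.normr /= mx_normrE; split.
- by move=> /bigmax_ltP[_ ur] i; exact: (ur (0, i)).
- move=> ur; apply/bigmax_ltP; split=> // -[i j] _ /=.
  by rewrite (ord1 i).
Qed.

Lemma rV_norm_coord n (u : 'rV[R]_n) i : `|u 0 i| <= `|u|.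
Proof.
rewrite [leRHS]/Num.Def.normr /= mx_normrE.
exact: (le_bigmax _ (fun ij : 'I_1 * 'I_n => `|u ij.1 ij.2|) (0, i)).
Qed.

(** Convexity of intervals, to be used coordinatewise: balls of the sup norm are boxes. *)
Lemma norm_segment_lt (a b s r : R) : 0 <= s <= 1 -> `|a| < r -> `|b| < r ->
  `|a + s * (b - a)| < r.
Proof.
move=> /andP[s0 s1] ar br; pose m := Num.max `|a| `|b|.
have mr : m < r by rewrite gt_max ar.
have am : `|a| <= m by rewrite le_max lexx.
have bm : `|b| <= m by rewrite le_max lexx orbT.
apply: le_lt_trans mr; move: am bm; rewrite !ler_norml.
by move=> /andP[? ?] /andP[? ?]; apply/andP; split; nra.
Qed.

(** The step [c] is kept apart from the direction [v] so that it may have either sign or vanish: the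
    mean value theorem is applied on [0, 1] to [s |-> g (x + (s * c) *: v)]. *)
Lemma MVT_line (V : normedModType R) (g d : V -> R) x v (c : R) :
  (forall s : R, 0 <= s <= 1 -> is_derive (x + (s * c) *: v) v g (d (x + (s * c) *: v))) ->
  exists2 s, 0 <= s <= 1 & g (x + c *: v) - g x = c * d (x + (s * c) *: v).
Proof.
move=> gd; pose f s := g (x + (s * c) *: v).
have fd (s : R) : 0 <= s <= 1 -> is_derive s (1 : R) f (c * d (x + (s * c) *: v)).
  move=> s01; pose h t := g (x + t *: v).
  have hd : is_derive (s * c) 1 h (d (x + (s * c) *: v)).
    exact: (is_derive_line g x v (s * c) _).1 (gd _ s01).
  have md : is_derive s (1 : R) (fun s : R => s * c) c.
    apply: is_derive_eq (is_derive_mul (is_derive_id s (1 : R)) (is_derive_const c s (1 : R))) _.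
    by rewrite mul1r mulr0 addr0.
  by apply: is_derive_eq (@is_derive_compR _ _ h (fun s : R => s * c) s 1 _ _ hd md) _; rewrite mulrC.
have [] := @MVT _ f (fun s => c * d (x + (s * c) *: v)) 0 1 ltr01.
- by move=> s; rewrite in_itv /= => /andP[/ltW s0 /ltW s1]; apply: fd; rewrite s0.
- apply: derivable_within_continuous => s; rewrite in_itv /= => s01.
  by case: (fd _ s01).
move=> s; rewrite in_itv /= => /andP[/ltW s0 /ltW s1].
rewrite /f mul1r mul0r scale0r addr0 subr0 mulr1 => E.
by exists s; rewrite ?s0.
Qed.

(** The increment from [z] to [y] is split into steps that change one coordinate each; every step is
    a mean value of a partial derivative, close to its value at [x]. Leaving both points free near
    [x] is what allows uniform estimates over a compact set later on. *)
Lemma strict_differentiability n (g : 'rV[R]_n -> R) (D : 'I_n -> 'rV[R]_n -> R) x :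
  (\forall y \near x, forall i, is_derive y (delta_mx 0 i) g (D i y)) ->
  (forall i, {for x, continuous (D i)}) ->
  forall e, 0 < e -> exists2 r, 0 < r & forall y z,
    `|x - y| < r -> `|x - z| < r ->
    `|g y - g z - \sum_i (y 0 i - z 0 i) * D i x| <= e * `|y - z|.
Proof.
(* The denominator is [n.+1] because [n] may be 0. *)
move=> gD Dx e e0; pose e1 := e / n.+1%:R.
have e10 : 0 < e1 by rewrite divr_gt0.
have nD : \forall y \near x, forall i, `|D i x - D i y| < e1.
  have H i : \forall y \near x, `|D i x - D i y| < e1.
    by have /cvgrPdist_lt/(_ _ e10) := Dx i.
  exact: (@filter_forall _ _ (fun i y => `|D i x - D i y| < e1) (nbhs x) _ H).
have /nbhs_ballP[r /= r0 rB] : nbhs x (fun y => (forall i, is_derive y (delta_mx 0 i) g (D i y)) /\ (forall i, `|D i x - D i y| < e1)) by exact: filterI gD nD.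
exists r => // y z xy xz.
(* [w k] takes its first [k] coordinates from [y] and the others from [z]; the path from [w 0 = z]
   to [w n = y] stays in the box around [x]. *)
pose w k : 'rV[R]_n := \row_i (if (i < k)%N then y 0 i else z 0 i).
have wS (k : 'I_n) : w k.+1 = w k + (y 0 k - z 0 k) *: delta_mx 0 k.
  apply/rowP => i; rewrite !mxE ltnS leq_eqVlt eqxx /=.
  have [->|ik] := eqVneq i k; first by rewrite ltnn eqxx mulr1 subrKC.
  by rewrite (_ : (val i == val k) = false) ?mulr0 ?addr0 //; exact: negbTE ik.
have E : g y - g z = \sum_(k < n) (g (w k.+1) - g (w k)).
  rewrite -(big_mkord xpredT (fun k => g (w k.+1) - g (w k))) telescope_sumr //.
  by congr (g _ - g _); apply/rowP => i; rewrite !mxE // ltn_ord.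
rewrite E -sumrB.
have step (k : 'I_n) : `|g (w k.+1) - g (w k) - (y 0 k - z 0 k) * D k x| <=
    e1 * `|y - z|.
  have inB s : 0 <= s <= 1 ->
      ball x r (w k + (s * (y 0 k - z 0 k)) *: delta_mx 0 k).
    move=> s01; rewrite -ball_normE /ball_ /=; apply/rV_norm_lt => // i.
    move/rV_norm_lt: xy => /(_ r0 i); move/rV_norm_lt: xz => /(_ r0 i).
    rewrite !mxE eqxx /=; have [->|ik] := eqVneq i k.
      rewrite ltnn mulr1 => xz1 xy1.
      by have := norm_segment_lt s01 xz1 xy1; congr (`|_| < _); ring.
    by rewrite mulr0 addr0; case: ifP.
  have [s s01] := @MVT_line _ g (D k) (w k) (delta_mx 0 k) (y 0 k - z 0 k)
    (fun s s01 => (rB _ (inB s s01)).1 k).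
  rewrite -wS => ->; rewrite -mulrBr normrM mulrC.
  apply: ler_pM => //.
    by rewrite distrC ltW //; exact: (rB _ (inB s s01)).2.
  by have := rV_norm_coord (y - z) k; rewrite !mxE.
apply: le_trans (ler_norm_sum _ _ _) _.
apply: le_trans (ler_sum _ (fun k _ => step k)) _.
rewrite sumr_const card_ord -[leLHS]mulr_natl mulrA ler_wpM2r //.
by rewrite /e1 mulrA ler_pdivrMr // mulrC ler_wpM2l ?ltW // ltr_nat.
Qed.

(** Continuity of partial derivatives is asked of the outer function only. Strict differentiability
    bounds the remainder by a small multiple of the difference quotient of [c], which stays bounded
    near 0. *)
Lemma is_derive_chain (V : normedModType R) n (g : 'rV[R]_n -> R)
    (D : 'I_n -> 'rV[R]_n -> R) (c : V -> 'rV[R]_n) t v dc :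
  (\forall y \near c t, forall i, is_derive y (delta_mx 0 i) g (D i y)) ->
  (forall i, {for c t, continuous (D i)}) ->
  is_derive t v c dc ->
  is_derive t v (g \o c) (\sum_i dc 0 i * D i (c t)).
Proof.
move=> gD Dx [cd cE].
have cvgq : h^-1 *: (c (h *: v + t) - c t) @[h --> 0^'] --> dc.
  by rewrite -cE; exact: cd.
have cont : c (h *: v + t) @[h --> 0^'] --> c t.
  have /derivable1P/derivable1_diffP/differentiable_continuous := cd.
  by move=> /continuous_withinNx; rewrite scale0r add0r.
suff H : h^-1 *: ((g \o c) (h *: v + t) - (g \o c) t) @[h --> 0^'] -->
    \sum_i dc 0 i * D i (c t).
  by apply: DeriveDef; [apply/cvg_ex; exists (\sum_i dc 0 i * D i (c t))|exact/cvg_lim].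
have lin : \sum_i (h^-1 *: (c (h *: v + t) - c t)) 0 i * D i (c t) @[h --> 0^'] -->
    \sum_i dc 0 i * D i (c t).
  apply: (cvg_big add_continuous) => i _.
  apply: cvgMl.
  exact: (cvg_comp _ _ cvgq (@coord_continuous _ _ _ 0 i dc)).
apply: cvg_sub0 lin.
apply/cvgrPdist_le => e e0.
(* Bound for the difference quotients of [c] near 0; the added 1 makes it positive and absorbs the
   error of the limit. *)
pose M := `|dc| + 1.
have M0 : 0 < M by rewrite ltr_wpDl.
have [r r0 strict] := strict_differentiability gD Dx (divr_gt0 e0 M0).
have /cvgrPdist_lt/(_ _ r0) near1 := cont.
have /cvgrPdist_lt/(_ _ ltr01) near2 := cvgq.
near=> h.
have h0 : h != 0 by near: h; exact: nbhs_dnbhs_neq.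
have b1 : `|c t - c (h *: v + t)| < r by near: h.
have b2 : `|h^-1 *: (c (h *: v + t) - c t)| <= M.
  have : `|dc - h^-1 *: (c (h *: v + t) - c t)| < 1 by near: h.
  move=> /ltW lt1; rewrite -[X in `|X|](subrK dc) addrC.
  by apply: le_trans (ler_normD _ _) _; rewrite lerD2l distrC.
rewrite sub0r normrN /=.
have := strict _ _ b1 (eq_ind_r (fun x => `|x| < r) (eq_ind_r (fun x => x < r) r0 (normr0 _)) (subrr (c t))).
set Dl := g _ - g _; set L := \sum_i _; move=> bd.
rewrite [X in `|X|](_ : _ = h^-1 * (Dl - L)); last first.
  rewrite !fctE /= mulrBr; congr (_ - _); rewrite mulr_sumr.
  by apply: eq_bigr => i _; rewrite !mxE mulrA.
rewrite normrM; have hi0 : 0 <= `|h^-1| by [].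
apply: le_trans (ler_wpM2l hi0 bd) _.
rewrite mulrCA -normrZ.
apply: le_trans (ler_wpM2l (ltW (divr_gt0 e0 M0)) b2) _.
by rewrite divfK // gt_eqF.
Unshelve. all: by end_near. Qed.

End ContinuouslyDifferentiable.

(** * Symmetry of second derivatives and calculus of smooth functions *)

Section Smooth.
Context {R : realType}.

Lemma is_derive_translate (V W : normedModType R) (g : V -> W) a x v d :
  is_derive (x + a) v g d -> is_derive x v (fun z => g (z + a)) d.
Proof.
have E : (fun h : R => h^-1 *: (g (h *: v + (x + a)) - g (x + a))) =
  (fun h => h^-1 *: (g (h *: v + x + a) - g (x + a))).
  by apply/funext => h; rewrite addrA.
move=> [df dv]; apply: DeriveDef.
- by move: df; rewrite /derivable /= E.
- by move: dv; rewrite /derive /= E.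
Qed.

(** The second difference over the parallelogram with sides [c *: v] and [c *: w] is evaluated by
    mean values in both orders. This equates [Dvw] and [Dwv] at two points near [x], and continuity
    at [x] concludes. *)
Lemma schwarz (V : normedModType R) (g Dv Dw Dvw Dwv : V -> R) x v w :
  (\forall y \near x, [/\ is_derive y v g (Dv y), is_derive y w g (Dw y),
     is_derive y w Dv (Dwv y) & is_derive y v Dw (Dvw y)]) ->
  {for x, continuous Dvw} -> {for x, continuous Dwv} ->
  Dvw x = Dwv x.
Proof.
move=> gD cvw cwv; apply/eqP; rewrite -subr_eq0 -normr_le0.
apply/ler_addgt0Pr => e e0; rewrite add0r.
have e2 : 0 < e / 2 by rewrite divr_gt0.
move/cvgrPdist_lt: cvw => /(_ _ e2) nvw; move/cvgrPdist_lt: cwv => /(_ _ e2) nwv.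
have [r /= r0 rB] : nbhs_ball x (fun y => [/\ is_derive y v g (Dv y),
    is_derive y w g (Dw y), is_derive y w Dv (Dwv y) & is_derive y v Dw (Dvw y)] /\
    (`|Dvw x - Dvw y| < e / 2 /\ `|Dwv x - Dwv y| < e / 2)).
  by apply/nbhs_ballP; exact: filterI gD (filterI nvw nwv).
pose M := `|v| + `|w| + 1; have M0 : 0 < M by rewrite ltr_wpDl ?addr_ge0.
(* With this factor the whole parallelogram lies within distance [r] of [x]. *)
pose c := r / M; have c0 : 0 < c by rewrite divr_gt0.
have inB (s t : R) : 0 <= s <= 1 -> 0 <= t <= 1 ->
    ball x r (x + (s * c) *: v + (t * c) *: w).
  move=> /andP[s0 s1] /andP[t0 t1]; rewrite -ball_normE /ball_ /=.
  rewrite -addrA opprD addNKr normrN.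
  apply: le_lt_trans (ler_normD _ _) _. 
  have nc a : 0 <= a -> `|a * c| = a * c.
    by move=> a0; rewrite ger0_norm // mulr_ge0 // ltW.
  rewrite (normrZ _ v) (normrZ _ w) !nc //.
  have vc : s * c * `|v| <= c * `|v|.
    by rewrite ler_wpM2r // ler_piMl // ltW.
  have wc : t * c * `|w| <= c * `|w|.
    by rewrite ler_wpM2r // ler_piMl // ltW.
  apply: le_lt_trans (lerD vc wc) _; rewrite -mulrDr /c mulrAC ltr_pdivrMr //.
  by rewrite ltr_pM2l // ltrDl.
have i0 : 0 <= (0 : R) <= 1 by rewrite lexx ler01.
have i1 : 0 <= (1 : R) <= 1 by rewrite ler01 lexx.
pose z (s t : R) := x + (s * c) *: v + (t * c) *: w.
have zC s t : z s t = x + (t * c) *: w + (s * c) *: v by rewrite /z addrAC.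
have [s1 s101 E1] : exists2 s1, 0 <= s1 <= 1 &
    (g (z 1 1) - g (z 1 0)) - (g (z 0 1) - g (z 0 0)) =
    c * (Dv (z s1 1) - Dv (z s1 0)).
  have [|s1 s101 E1] := @MVT_line _ V
    (fun y => g (y + (1 * c) *: w) - g (y + (0 * c) *: w))
    (fun y => Dv (y + (1 * c) *: w) - Dv (y + (0 * c) *: w)) x v c.
    move=> s s01; apply: is_derive_sub; apply: is_derive_translate.
      by have [[]] := rB _ (inB s 1 s01 i1).
    by have [[]] := rB _ (inB s 0 s01 i0).
  by exists s1 => //; rewrite -E1 /z !mul1r !mul0r !scale0r !addr0.
have [t1 t101 E2] : exists2 t1, 0 <= t1 <= 1 &
    (g (z 1 1) - g (z 0 1)) - (g (z 1 0) - g (z 0 0)) =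
    c * (Dw (z 1 t1) - Dw (z 0 t1)).
  have [|t1 t101 E2] := @MVT_line _ V
    (fun y => g (y + (1 * c) *: v) - g (y + (0 * c) *: v))
    (fun y => Dw (y + (1 * c) *: v) - Dw (y + (0 * c) *: v)) x w c.
    move=> t t01; apply: is_derive_sub; apply: is_derive_translate.
      by rewrite -zC; have [[]] := rB _ (inB 1 t i1 t01).
    by rewrite -zC; have [[]] := rB _ (inB 0 t i0 t01).
  by exists t1 => //; rewrite !zC -E2 !mul1r !mul0r !scale0r !addr0.
have [t2 t201 E3] : exists2 t2, 0 <= t2 <= 1 &
    Dv (z s1 1) - Dv (z s1 0) = c * Dwv (z s1 t2).
  have [|t2 t201 E3] := @MVT_line _ V Dv Dwv (x + (s1 * c) *: v) w c.
    by move=> t t01; have [[]] := rB _ (inB s1 t s101 t01).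
  by exists t2 => //; rewrite -E3 /z mul1r mul0r scale0r addr0.
have [s2 s201 E4] : exists2 s2, 0 <= s2 <= 1 &
    Dw (z 1 t1) - Dw (z 0 t1) = c * Dvw (z s2 t1).
  have [|s2 s201 E4] := @MVT_line _ V Dw Dvw (x + (t1 * c) *: w) v c.
    by move=> s s01; rewrite -zC; have [[]] := rB _ (inB s t1 s01 t101).
  by exists s2 => //; rewrite !zC -E4 mul1r mul0r scale0r addr0.
have E : Dvw (z s2 t1) = Dwv (z s1 t2).
  have cn0 : c != 0 by rewrite gt_eqF.
  apply: (mulfI cn0); apply: (mulfI cn0).
  by move: E1 E2; rewrite E3 E4 => <- <-; ring.
have [_ [b1 _]] := rB _ (inB s2 t1 s201 t101).
have [_ [_ b2]] := rB _ (inB s1 t2 s101 t201).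
rewrite (_ : _ - _ = (Dvw x - Dvw (z s2 t1)) - (Dwv x - Dwv (z s1 t2))); last first.
  by rewrite E; ring.
by apply: le_trans (ler_normB _ _) _; rewrite (splitr e) lerD // ltW.
Qed.


Section SmoothOn.
Variables (n : nat) (U : set 'rV[R]_n).
Hypothesis oU : open U.

Lemma near_open (x : 'rV[R]_n) (P : 'rV[R]_n -> Prop) : U x ->
  (forall y, U y -> P y) -> \forall y \near x, P y.
Proof. by move=> Ux UP; apply: filterS UP _; exact: open_nbhs_nbhs. Qed.

Lemma continuous_near_open (W : topologicalType) (g h : 'rV[R]_n -> W) x : U x ->
  (forall y, U y -> g y = h y) -> {for x, continuous g} -> {for x, continuous h}.
Proof.
move=> Ux gh gc; rewrite /prop_for /continuous_at -(gh x Ux).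
have /near_eq_cvg ghc := near_open Ux gh.
exact: cvg_trans gc.
Qed.

Section Valued.
Context {W : normedModType R}.
Implicit Types (g : 'rV[R]_n -> W) (x : 'rV[R]_n).

Lemma smooth_on_pd g i : smooth_on U g -> smooth_on U (pd i g).
Proof. by move=> gU s x Ux; have := gU (rcons s i) x Ux; rewrite foldr_rcons. Qed.

Lemma smooth_on_is_derive g x i : smooth_on U g -> U x ->
  is_derive x (delta_mx 0 i) g (pd i g x).
Proof. by move=> gU Ux; have [_ /(_ i)] := gU [::] x Ux; exact: derivableP. Qed.

Lemma smooth_on_continuous g x : smooth_on U g -> U x -> {for x, continuous g}.
Proof. by move=> gU Ux; have [] := gU [::] x Ux. Qed.

End Valued.

Lemma pd_coord m (g : 'rV[R]_n -> 'rV[R]_m) s j x : smooth_on U g -> U x ->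
  foldr pd (fun z => g z 0 j) s x = foldr pd g s x 0 j.
Proof.
move=> gU; elim: s x => [//|i s IHs] x Ux /=.
rewrite {1}/pd (derive_near _ oU Ux IHs); apply: is_derive_val.
apply: is_derive_coord; apply: smooth_on_is_derive Ux.
by move=> s' y Uy; rewrite -foldr_cat; exact: gU.
Qed.

Lemma smooth_on_rV m (g : 'rV[R]_n -> 'rV[R]_m) :
  smooth_on U g <-> forall j, smooth_on U (fun z => g z 0 j).
Proof.
split=> gU.
- move=> j s x Ux; have [gc gd] := gU s x Ux.
  have E y : U y -> foldr pd g s y 0 j = foldr pd (fun z => g z 0 j) s y.
    by move=> Uy; rewrite pd_coord.
  split=> [|i].
  + apply: continuous_near_open Ux E _.
    exact: (cvg_comp _ _ gc (@coord_continuous _ _ _ 0 j _)).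
  + have := is_derive_coord j (derivableP (gd i)).
    by move/(is_derive_near oU Ux E) => [].
- have E s y : U y -> forall j, foldr pd g s y 0 j = foldr pd (fun z => g z 0 j) s y.
    elim: s y => [//|i s IHs] y Uy j /=.
    transitivity (pd i (fun z => foldr pd g s z 0 j) y); last first.
      exact: derive_near oU Uy (fun y Uy => IHs y Uy j).
    apply/esym/is_derive_val/is_derive_coord/derivableP/derivable_mxP => a b.
    rewrite (ord1 a); have [_ /(_ i)/derivableP] := gU b s y Uy.
    by move/(is_derive_near oU Uy (fun z Uz => esym (IHs z Uz b))) => [].
  move=> s x Ux; split=> [|i].
  + apply: (@cvgrPdist_lt _ _ _ (nbhs x) _ (foldr pd g s) (foldr pd g s x)).2 => e e0.
    have H j : \forall y \near x, `|(foldr pd g s x - foldr pd g s y) 0 j| < e.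
      have [/cvgrPdist_lt/(_ _ e0) H _] := gU j s x Ux.
      apply: filterS (filterI (near_open Ux (fun y (Uy : U y) => Uy)) H) => y [Uy].
      by rewrite !mxE !E.
    have := @filter_forall _ _ (fun j y => `|(foldr pd g s x - foldr pd g s y) 0 j| < e)
      (nbhs x) (nbhs_filter x) H.
    exact: (filterS (F := nbhs x) (fun y yH => (rV_norm_lt _ e0).2 yH)).
  + apply/derivable_mxP => a b; rewrite (ord1 a).
    have [_ /(_ i)/derivableP] := gU b s x Ux.
    by move/(is_derive_near oU Ux (fun z Uz => esym (E s z Uz b))) => [].
Qed.

Lemma smooth_on_pd_coord m (g : 'rV[R]_n -> 'rV[R]_m) i j x : smooth_on U g -> U x ->
  pd i (fun z => g z 0 j) x = pd i g x 0 j.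
Proof. by move=> gU; exact: (@pd_coord _ _ [:: i]). Qed.

Lemma is_derive_smooth (V : normedModType R) (g : 'rV[R]_n -> R)
    (c : V -> 'rV[R]_n) t v dc :
  smooth_on U g -> U (c t) -> is_derive t v c dc ->
  is_derive t v (fun z => g (c z)) (\sum_i dc 0 i * pd i g (c t)).
Proof.
move=> gU Uc cd; apply: (is_derive_chain (D := fun i => pd i g)) cd => [|i].
  by apply: (near_open Uc) => y Uy i; exact: smooth_on_is_derive.
exact: (smooth_on_continuous (@smooth_on_pd _ g i gU) Uc).
Qed.

Lemma is_derive_smooth_rV (V : normedModType R) m (g : 'rV[R]_n -> 'rV[R]_m)
    (c : V -> 'rV[R]_n) t v dc :
  smooth_on U g -> U (c t) -> is_derive t v c dc ->
  is_derive t v (fun z => g (c z)) (\sum_i dc 0 i *: pd i g (c t)).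
Proof.
move=> gU Uc cd; apply: is_derive_rV => j.
have gj : smooth_on U (fun z => g z 0 j) by exact: ((@smooth_on_rV m g).1 gU j).
apply: is_derive_eq (is_derive_smooth gj Uc cd) _.
rewrite summxE; apply: eq_bigr => i _.
by rewrite mxE smooth_on_pd_coord.
Qed.

Lemma smooth_on_derive m (g : 'rV[R]_n -> 'rV[R]_m) x y : smooth_on U g -> U x ->
  'D_y g x = \sum_i y 0 i *: pd i g x.
Proof.
move=> gU Ux; apply: is_derive_val.
by apply: (is_derive_smooth_rV (c := fun z => z)) => //; exact: is_derive_id.
Qed.

Lemma smooth_on_pdC (g : 'rV[R]_n -> R) i j x : smooth_on U g -> U x ->
  pd i (pd j g) x = pd j (pd i g) x.
Proof.
move=> gU Ux; have gS k := @smooth_on_pd _ g k gU.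
apply: (@schwarz _ g (pd i g) (pd j g) (pd i (pd j g)) (pd j (pd i g)) x
  (delta_mx 0 i) (delta_mx 0 j)).
- apply: (near_open Ux) => y Uy.
  split; [exact: smooth_on_is_derive gU Uy|exact: smooth_on_is_derive gU Uy|
          exact: smooth_on_is_derive (gS i) Uy|exact: smooth_on_is_derive (gS j) Uy].
- exact: (smooth_on_continuous (@smooth_on_pd _ _ i (gS j)) Ux).
- exact: (smooth_on_continuous (@smooth_on_pd _ _ j (gS i)) Ux).
Qed.

Lemma smooth_on_pdC_rV m (g : 'rV[R]_n -> 'rV[R]_m) i j x : smooth_on U g -> U x ->
  pd i (pd j g) x = pd j (pd i g) x.
Proof.
move=> gU Ux; apply/rowP => k.
have E a b : pd a (pd b g) x 0 k = pd a (pd b (fun z => g z 0 k)) x.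
  exact: esym (@pd_coord m g [:: a; b] k x gU Ux).
apply: etrans (E i j) _; apply: etrans _ (esym (E j i)).
exact: smooth_on_pdC ((@smooth_on_rV m g).1 gU k) Ux.
Qed.

(** Constants are not built in: where they are needed, they have to be among the generators. *)
Inductive gen_alg (G : ('rV[R]_n -> R) -> Prop) : ('rV[R]_n -> R) -> Prop :=
| gen_alg_gen g of G g : gen_alg G g
| gen_alg_add g h of gen_alg G g & gen_alg G h : gen_alg G (fun x => g x + h x)
| gen_alg_mul g h of gen_alg G g & gen_alg G h : gen_alg G (fun x => g x * h x).

(** As [smooth_on] speaks of all iterated partial derivatives, an invariant is needed: the algebra
    is stable under derivatives as soon as those of its generators lie in it, and all its members
    are continuous. *)
Lemma gen_alg_smooth (G : ('rV[R]_n -> R) -> Prop) :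
  (forall g x, G g -> U x -> {for x, continuous g}) ->
  (forall g i, G g -> exists2 g', gen_alg G g' &
     forall x, U x -> is_derive x (delta_mx 0 i) g (g' x)) ->
  forall g, gen_alg G g -> smooth_on U g.
Proof.
move=> Gc Gd g.
have Ac h x : gen_alg G h -> U x -> {for x, continuous h}.
  move=> Ah Ux; elim: Ah => [a|a b _ ac _ bc|a b _ ac _ bc]; first by move/Gc; apply.
    exact: (continuousD ac bc).
  exact: (continuousM ac bc).
have Ad h i : gen_alg G h -> exists2 h', gen_alg G h' &
    forall x, U x -> is_derive x (delta_mx 0 i) h (h' x).
  elim=> [a Ga|a b Aa [a' Aa' ad] Ab [b' Ab' bd]|
          a b Aa [a' Aa' ad] Ab [b' Ab' bd]].
    exact: Gd.
    exists (fun x => a' x + b' x) => [|x Ux]; first exact: gen_alg_add.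
    by apply: is_derive_add; [exact: ad|exact: bd].
  exists (fun x => a' x * b x + a x * b' x) => [|x Ux].
    by apply: gen_alg_add; exact: gen_alg_mul.
  by apply: is_derive_mul; [exact: ad|exact: bd].
move=> Ag s.
have [h Ah hE] : exists2 h, gen_alg G h & forall x, U x -> h x = foldr pd g s x.
  elim: s => [|i s [h Ah hE]]; first by exists g.
  have [h' Ah' h'd] := Ad h i Ah; exists h' => // x Ux /=.
  by rewrite /pd -(derive_near _ oU Ux hE) (is_derive_val (h'd x Ux)).
move=> x Ux; split=> [|i].
- exact: continuous_near_open Ux hE (Ac h x Ah Ux).
- have [h' _ /(_ x Ux)] := Ad h i Ah.
  by move=> /(is_derive_near oU Ux hE) [].
Qed.

Lemma smooth_on_mul (g h : 'rV[R]_n -> R) :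
  smooth_on U g -> smooth_on U h -> smooth_on U (fun x => g x * h x).
Proof.
move=> gU hU; apply: (@gen_alg_smooth (smooth_on U)).
- by move=> a x aU Ux; exact: smooth_on_continuous.
- move=> a i aU; exists (pd i a); first exact/gen_alg_gen/smooth_on_pd.
  by move=> x Ux; exact: smooth_on_is_derive.
- by apply: gen_alg_mul; exact: gen_alg_gen.
Qed.

End SmoothOn.
End Smooth.

(** * Euclidean geometry and gnomonic charts *)

Section EuclideanDot.
Context {R : realType} {n : nat}.
Implicit Types (u v w : 'rV[R]_n) (a b : R).

Lemma edot_mulmx u v : edot u v = (u *m v^T) 0 0.
Proof. by rewrite mxE; apply: eq_bigr => i _; rewrite mxE. Qed.

Lemma edotC u v : edot u v = edot v u.
Proof. by apply: eq_bigr => i _; rewrite mulrC. Qed.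

Lemma edotDl u v w : edot (u + v) w = edot u w + edot v w.
Proof. by rewrite !edot_mulmx mulmxDl mxE. Qed.

Lemma edotDr u v w : edot w (u + v) = edot w u + edot w v.
Proof. by rewrite edotC edotDl ![edot w _]edotC. Qed.

Lemma edotZl a u v : edot (a *: u) v = a * edot u v.
Proof. by rewrite !edot_mulmx -scalemxAl mxE. Qed.

Lemma edotZr a u v : edot u (a *: v) = a * edot u v.
Proof. by rewrite edotC edotZl edotC. Qed.

Lemma edotNl u v : edot (- u) v = - edot u v.
Proof. by rewrite -scaleN1r edotZl mulN1r. Qed.

Lemma edotNr u v : edot u (- v) = - edot u v.
Proof. by rewrite edotC edotNl edotC. Qed.

Lemma edotBl u v w : edot (u - v) w = edot u w - edot v w.
Proof. by rewrite edotDl edotNl. Qed.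

Lemma edotBr u v w : edot w (u - v) = edot w u - edot w v.
Proof. by rewrite edotDr edotNr. Qed.

Lemma edot0l u : edot 0 u = 0.
Proof. by rewrite -(scale0r u) edotZl mul0r. Qed.

Lemma edot0r u : edot u 0 = 0.
Proof. by rewrite edotC edot0l. Qed.

Lemma edot_suml (I : Type) (r : seq I) (P : pred I) (F : I -> 'rV[R]_n) v :
  edot (\sum_(i <- r | P i) F i) v = \sum_(i <- r | P i) edot (F i) v.
Proof.
elim/big_rec2: _ => [|i x y _ <-]; first exact: edot0l.
by rewrite edotDl.
Qed.

Lemma edot_sumr (I : Type) (r : seq I) (P : pred I) (F : I -> 'rV[R]_n) v :
  edot v (\sum_(i <- r | P i) F i) = \sum_(i <- r | P i) edot v (F i).
Proof. by rewrite edotC edot_suml; apply: eq_bigr => i _; rewrite edotC. Qed.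

Lemma edot_ge0 u : 0 <= edot u u.
Proof. by apply: sumr_ge0 => i _; rewrite -expr2 sqr_ge0. Qed.

Lemma edot_eq0 u : (edot u u == 0) = (u == 0).
Proof.
apply/eqP/eqP => [u0|->]; last exact: edot0l.
apply/rowP => i; rewrite mxE; apply/eqP.
have /psumr_eq0P/(_ u0 i isT) : forall i : 'I_n, true -> 0 <= u 0 i * u 0 i.
  by move=> j _; rewrite -expr2 sqr_ge0.
by move/eqP; rewrite mulf_eq0 orbb.
Qed.

Lemma edot_gt0 u : (0 < edot u u) = (u != 0).
Proof. by rewrite lt_def edot_ge0 andbT edot_eq0. Qed.

Lemma enorm_ge0 u : 0 <= enorm u.
Proof. exact: sqrtr_ge0. Qed.

Lemma enorm_sqr u : enorm u ^+ 2 = edot u u.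
Proof. by rewrite sqr_sqrtr // edot_ge0. Qed.

Lemma enorm_eq0 u : (enorm u == 0) = (u == 0).
Proof. by rewrite -sqrf_eq0 enorm_sqr edot_eq0. Qed.

Lemma enorm_gt0 u : (0 < enorm u) = (u != 0).
Proof. by rewrite lt_def enorm_ge0 andbT enorm_eq0. Qed.

Lemma enormZ a u : enorm (a *: u) = `|a| * enorm u.
Proof. by rewrite /enorm edotZl edotZr mulrA -expr2 sqrtrM ?sqr_ge0 // sqrtr_sqr. Qed.

Lemma enorm1P u : enorm u = 1 <-> edot u u = 1.
Proof.
by rewrite -enorm_sqr; split=> [->|/eqP]; rewrite ?expr1n // sqrp_eq1 ?enorm_ge0 // => /eqP.
Qed.

Lemma edot_gram_ge0 u v : edot u v ^+ 2 <= edot u u * edot v v.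
Proof.
have [->|v0] := eqVneq v 0; first by rewrite !edot0r mulr0 expr0n.
have vv : 0 < edot v v by rewrite edot_gt0.
(* This vector is |v|^2 times the component of [u] orthogonal to [v]; the scaling avoids a
   division. *)
have := edot_ge0 (edot v v *: u - edot u v *: v).
rewrite !(edotBl, edotBr, edotZl, edotZr) (edotC v u) => h.
rewrite -subr_ge0 -(pmulr_rge0 _ vv); move: h; congr (_ <= _); ring.
Qed.

Lemma edot_gram_eq0 u v : v != 0 -> edot u v ^+ 2 = edot u u * edot v v ->
  u = (edot u v / edot v v) *: v.
Proof.
move=> v0 uv; have vv : edot v v != 0 by rewrite edot_eq0.
apply/eqP; rewrite -subr_eq0 -edot_eq0; apply/eqP.
rewrite !(edotBl, edotBr, edotZl, edotZr) (edotC v u).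
rewrite (_ : _ - _ = (edot u u * edot v v - edot u v ^+ 2) / edot v v); last by field.
by rewrite uv subrr mul0r.
Qed.

Lemma enorm_sup u i : `|u 0 i| <= enorm u.
Proof.
rewrite -(@ler_pXn2r _ 2) ?nnegrE ?enorm_ge0 // enorm_sqr real_normK ?num_real //.
rewrite /edot (bigD1 i) //= -expr2 lerDl sumr_ge0 // => j _.
by rewrite -expr2 sqr_ge0.
Qed.

Lemma row_mul_sum m (c : 'rV[R]_m) (A : 'M[R]_(m, n)) :
  c *m A = \sum_i c 0 i *: row i A.
Proof.
apply/rowP => j; rewrite !mxE summxE; apply: eq_bigr => i _.
by rewrite !mxE.
Qed.

End EuclideanDot.

(** * Completeness of a tangent frame together with the normal vector *)

Section TangentFrame.
Context {R : realType} {n : nat}.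
Variables (p : 'rV[R]_n.+1) (J : 'M[R]_(n, n.+1)).
Hypotheses (p1 : edot p p = 1) (Jp : forall i, edot (row i J) p = 0)
  (Jfree : row_free J).

Lemma frame_mul_tr : J *m p^T = 0.
Proof.
apply/colP => i; rewrite [RHS]mxE -[RHS](Jp i) mxE.
by apply: eq_bigr => k _; rewrite !mxE.
Qed.

Lemma gram_unit : J *m J^T \in unitmx.
Proof.
rewrite -row_free_unit; apply: inj_row_free => v v0.
have : (v *m J) = 0.
  apply/eqP; rewrite -edot_eq0 edot_mulmx trmx_mul mulmxA -(mulmxA v) v0.
  by rewrite mul0mx mxE.
by rewrite -(mul0mx _ J) => /(row_free_inj Jfree).
Qed.

(** The summands are the orthogonal projections onto the tangent space and onto the line of [p].
    Their sum fixes [p] and the rows of [J], which form a basis. *)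
Lemma frame_complete_mx : J^T *m invmx (J *m J^T) *m J + p^T *m p = 1%:M.
Proof.
pose Q : 'M[R]_(1 + n, n.+1) := col_mx p J.
have pp : p *m p^T = 1%:M.
  by apply/matrixP => i j; rewrite !ord1 -edot_mulmx p1 mxE.
have pJ : p *m J^T = 0 by rewrite -[p]trmxK -trmx_mul frame_mul_tr trmx0.
have Qu : (Q : 'M[R]_n.+1) \in unitmx.
  rewrite -row_free_unit; apply: inj_row_free => v.
  rewrite -(@hsubmxK _ 1 1 n v) => v0.
  have {}v0 : lsubmx (v : 'rV_(1 + n)) *m p + rsubmx (v : 'rV_(1 + n)) *m J = 0.
    by rewrite -mul_row_col.
  have l0 : lsubmx (v : 'rV_(1 + n)) = 0.
    have := congr1 (fun A : 'rV[R]_n.+1 => A *m p^T) v0.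
    by rewrite mulmxDl -!mulmxA pp frame_mul_tr mulmx0 addr0 mulmx1 mul0mx.
  have r0 : rsubmx (v : 'rV_(1 + n)) = 0.
    by move: v0; rewrite l0 mul0mx add0r -(mul0mx _ J) => /(row_free_inj Jfree).
  by rewrite l0 r0 row_mx0.
set M := _ + _.
have MQ : M *m Q^T = Q^T.
  rewrite tr_col_mx mul_mx_row /M !mulmxDl; congr row_mx.
    by rewrite -!mulmxA frame_mul_tr pp !mulmx0 add0r mulmx1.
  by rewrite -!mulmxA pJ !mulmx0 addr0 mulVmx ?gram_unit // mulmx1.
have Qt : (Q^T : 'M[R]_n.+1) \in unitmx by rewrite unitmx_tr.
by rewrite -[M]mulmx1 -(mulmxV Qt) mulmxA MQ.
Qed.

(** Parseval's identity for a frame that need not be orthonormal: the inverse Gram matrix supplies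
    the weights. *)
Lemma frame_complete u v : edot u v = edot u p * edot v p +
  \sum_i \sum_j invmx (J *m J^T) i j * edot u (row i J) * edot v (row j J).
Proof.
rewrite {1}edot_mulmx -[X in X *m v^T]mulmx1 -frame_complete_mx mulmxDr mulmxDl mxE addrC.
congr (_ + _).
  rewrite mulmxA -mulmxA mxE big_ord1 -edot_mulmx (edotC v p); congr (_ * _).
  by rewrite edot_mulmx.
rewrite !mulmxA -mulmxA -(mulmxA (u *m J^T)).
have uJ i : (u *m J^T) 0 i = edot u (row i J).
  by rewrite edot_mulmx tr_row mxE [RHS]mxE; apply: eq_bigr => k _; rewrite !mxE.
have vJ i : (J *m v^T) i 0 = edot v (row i J).
  by rewrite edotC mxE; apply: eq_bigr => k _; rewrite !mxE.
rewrite mxE; under eq_bigr do rewrite uJ mxE big_distrr /=.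
apply: eq_bigr => i _; apply: eq_bigr => j _; rewrite vJ; ring.
Qed.

End TangentFrame.

Lemma cvg_edot (R : realType) n (T : Type) (F : set_system T) (FF : Filter F)
    (f g : T -> 'rV[R]_n) a b :
  f x @[x --> F] --> a -> g x @[x --> F] --> b ->
  edot (f x) (g x) @[x --> F] --> edot a b.
Proof.
move=> fa gb; rewrite /edot; apply: (cvg_big add_continuous) => i _.
by apply: cvgM; [exact: (cvg_comp _ _ fa (@coord_continuous _ _ _ 0 i a))|
                 exact: (cvg_comp _ _ gb (@coord_continuous _ _ _ 0 i b))].
Qed.

(** * Orthonormal frames of tangent spaces *)

Section OrthonormalFrame.
Context {R : realType} {n : nat}.

Lemma edot_delta m (u : 'rV[R]_m) i : edot u (delta_mx 0 i) = u 0 i.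
Proof.
rewrite /edot (bigD1 i) //= mxE !eqxx mulr1 big1 ?addr0 // => j ji.
by rewrite mxE (negbTE ji) andbF mulr0.
Qed.

(* The rows are the images of the last n basis vectors under the reflection
   exchanging p and the first basis vector. *)
Lemma orthonormal_frame (p : 'rV[R]_n.+1) : edot p p = 1 ->
  exists2 E : 'M[R]_(n, n.+1), E *m E^T = 1%:M & forall i, edot (row i E) p = 0.
Proof.
move=> p1; pose e0 : 'rV[R]_n.+1 := delta_mx 0 0.
pose r i : 'rV[R]_n.+1 :=
  delta_mx 0 (lift 0 i) - (p 0 (lift 0 i) / (1 - p 0 0)) *: (p - e0).
have de i j : edot (delta_mx 0 i) (delta_mx 0 j : 'rV[R]_n.+1) = (i == j)%:R.
  by rewrite edot_delta mxE eqxx /= eq_sym.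
have e00 : edot e0 e0 = 1 by rewrite de.
have pe : edot p e0 = p 0 0 by rewrite edot_delta.
(* If [p] is the first basis vector, the quotient in [r i] is 0 / 0, that is 0; this fact settles
   that case. *)
have pp0 : p 0 0 = 1 -> forall i, p 0 (lift 0 i) = 0.
  move=> p01 i; have : p - e0 = 0.
    apply/eqP; rewrite -edot_eq0 edotBl !edotBr p1 e00 (edotC e0) pe p01.
    by rewrite subrr.
  by move/eqP; rewrite subr_eq0 => /eqP ->; rewrite mxE.
pose E : 'M[R]_(n, n.+1) := \matrix_(i, j) r i 0 j.
have rE i : row i E = r i by apply/rowP => j; rewrite !mxE.
exists E => [|i]; last first.
  rewrite rE /r edotBl edotZl edotBl p1 !(edotC _ p) !edot_delta.
  have [p01|p01] := eqVneq (p 0 0) 1; first by rewrite pp0 // !mul0r subr0.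
  by field; rewrite subr_eq0 eq_sym.
apply/matrixP => i j.
have -> : (E *m E^T) i j = edot (row i E) (row j E).
  by rewrite mxE; apply: eq_bigr => k _; rewrite !mxE.
rewrite !rE /r mxE; set a := p 0 0; set b := p 0 (lift 0 i); set c := p 0 (lift 0 j).
have pr k : edot p (delta_mx 0 (lift 0 k)) = p 0 (lift 0 k) by rewrite edot_delta.
have rp k : edot (delta_mx 0 (lift 0 k)) p = p 0 (lift 0 k) by rewrite edotC.
have er k : edot e0 (delta_mx 0 (lift 0 k)) = 0 by rewrite de.
have re k : edot (delta_mx 0 (lift 0 k)) e0 = 0 by rewrite de.
have ep : edot e0 p = p 0 0 by rewrite edotC.
rewrite !(edotBl, edotBr, edotZl, edotZr) p1 e00 pe ep !pr !rp !er !re !de.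
rewrite (inj_eq lift_inj) -/a -/b -/c.
have [p01|p01] := eqVneq a 1; first by rewrite /b /c !pp0 // !mul0r; ring.
by field; rewrite subr_eq0 eq_sym.
Qed.

End OrthonormalFrame.

(** * Gnomonic charts and the Laplacian at their centre *)

Section GnomonicChart.
Context {R : realType} {n : nat}.
Variables (p : 'rV[R]_n.+1) (E : 'M[R]_(n, n.+1)).
Hypotheses (p1 : edot p p = 1) (EE : E *m E^T = 1%:M)
  (Ep : forall i, edot (row i E) p = 0).
Implicit Types y z : 'rV[R]_n.

(** [gnomonic] inverts the central projection of the open hemisphere around [p] onto its tangent
    plane; the weight is the cosine of the distance to [p]. *)
Definition gnomonic_weight y : R := (Num.sqrt (1 + edot y y))^-1.

Definition gnomonic y : 'rV[R]_n.+1 := gnomonic_weight y *: (p + y *m E).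

Lemma frame_row_free : row_free E.
Proof. by apply/row_freeP; exists E^T. Qed.

Lemma frame_edot_row i j : edot (row i E) (row j E) = (i == j)%:R.
Proof.
have -> : edot (row i E) (row j E) = (E *m E^T) i j.
  by rewrite [RHS]mxE; apply: eq_bigr => k _; rewrite !mxE.
by rewrite EE mxE.
Qed.

Lemma frame_edot y z : edot (y *m E) (z *m E) = edot y z.
Proof. by rewrite edot_mulmx trmx_mul mulmxA -(mulmxA y) EE mulmx1 -edot_mulmx. Qed.

Lemma frame_edot_p y : edot (y *m E) p = 0.
Proof.
by rewrite row_mul_sum edot_suml big1 // => i _; rewrite edotZl Ep mulr0.
Qed.

Lemma frame_edot_coord y i : edot (y *m E) (row i E) = y 0 i.
Proof.
rewrite (_ : row i E = (delta_mx 0 i : 'rV_n) *m E) ?rowE //.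
by rewrite frame_edot edot_delta.
Qed.

Lemma frame_complete1 u v : edot u v = edot u p * edot v p +
  \sum_i edot u (row i E) * edot v (row i E).
Proof.
rewrite (frame_complete p1 Ep frame_row_free) EE; congr (_ + _).
apply: eq_bigr => i _; rewrite (bigD1 i) //= big1 ?addr0.
  by rewrite (_ : invmx 1%:M = 1%:M) ?invmx1 // mxE eqxx mul1r.
by move=> j ji; rewrite invmx1 mxE eq_sym (negbTE ji) !mul0r.
Qed.

Lemma frame_decomp u : u = edot u p *: p + (\row_i edot u (row i E)) *m E.
Proof.
apply/eqP; rewrite -subr_eq0 -edot_eq0; apply/eqP.
set d := u - _; have dp : edot d p = 0.
  by rewrite /d edotBl edotDl edotZl p1 frame_edot_p; ring.
have de i : edot d (row i E) = 0.
  by rewrite /d edotBl edotDl edotZl (edotC p) Ep frame_edot_coord mxE; ring.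
by rewrite frame_complete1 dp mul0r add0r big1 // => i _; rewrite de mul0r.
Qed.

Lemma gnomonic_weight_arg_gt0 y : 0 < 1 + edot y y.
Proof. by rewrite ltr_wpDr // edot_ge0. Qed.

Lemma gnomonic_weight_gt0 y : 0 < gnomonic_weight y.
Proof. by rewrite invr_gt0 sqrtr_gt0 gnomonic_weight_arg_gt0. Qed.

Lemma gnomonic_weight_sqr y : gnomonic_weight y ^+ 2 * (1 + edot y y) = 1.
Proof.
rewrite exprVn sqr_sqrtr ?mulVf //; have := gnomonic_weight_arg_gt0 y; first exact: lt0r_neq0.
exact: ltW.
Qed.

Lemma gnomonic_weight0 : gnomonic_weight 0 = 1.
Proof. by rewrite /gnomonic_weight edot0l addr0 sqrtr1 invr1. Qed.

Lemma is_derive_gnomonic_weight y v :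
  is_derive y v gnomonic_weight (- edot y v * gnomonic_weight y ^+ 3).
Proof.
have y0 := gnomonic_weight_arg_gt0 y.
have s0 : Num.sqrt (1 + edot y y) != 0 by rewrite gt_eqF // sqrtr_gt0.
have dd := is_derive_add (is_derive_const (1 : R) y v)
  (is_derive_edot (is_derive_id y v) (is_derive_id y v)).
have ds := @is_derive_sqrtr _ _ (fun z => 1 + edot z z) y v _ y0 dd.
apply: is_derive_eq (@is_derive_invr _ _ (fun z => Num.sqrt (1 + edot z z)) y v _ s0 ds) _.
rewrite /gnomonic_weight (edotC v y).
by field.
Qed.

Lemma edot_gnomonic_p y : edot (gnomonic y) p = gnomonic_weight y.
Proof. by rewrite edotZl edotDl p1 frame_edot_p addr0 mulr1. Qed.

Lemma edot_gnomonic_row y i : edot (gnomonic y) (row i E) = gnomonic_weight y * y 0 i.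
Proof. by rewrite edotZl edotDl edotC Ep add0r frame_edot_coord. Qed.

Lemma gnomonic0 : gnomonic 0 = p.
Proof. by rewrite /gnomonic gnomonic_weight0 mul0mx addr0 scale1r. Qed.

Lemma sphere_gnomonic y : edot (gnomonic y) (gnomonic y) = 1.
Proof.
rewrite edotZl edotZr edotDl !edotDr p1 (edotC p) !frame_edot_p frame_edot.
by rewrite add0r addr0 -[RHS](gnomonic_weight_sqr y); ring.
Qed.

Lemma is_derive_frame y v : is_derive y v (fun z => p + z *m E) (v *m E).
Proof.
apply: is_derive_rV => j; under eq_fun do rewrite !mxE.
have ds : is_derive y v (fun z => \sum_k z 0 k * E k j) (\sum_k v 0 k * E k j).
  apply: is_derive_bigsum => k _.
  apply: is_derive_eq (is_derive_mul (is_derive_coord k (is_derive_id y v))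
    (is_derive_const (E k j) y v)) _.
  by rewrite mulr0 addr0.
rewrite mxE; exact: is_derive_eq (is_derive_add (is_derive_const (p 0 j) y v) ds) (add0r _).
Qed.

Lemma is_derive_gnomonic y v : is_derive y v gnomonic
  (gnomonic_weight y *: (v *m E) - (edot y v * gnomonic_weight y ^+ 2) *: gnomonic y).
Proof.
apply: is_derive_eq (is_derive_scale (is_derive_gnomonic_weight y v) (is_derive_frame y v)) _.
rewrite addrC; congr (_ + _); rewrite /gnomonic scalerA -scaleNr; congr (_ *: _).
ring.
Qed.

Lemma pd_gnomonic i y : pd i gnomonic y =
  gnomonic_weight y *: row i E - (y 0 i * gnomonic_weight y ^+ 2) *: gnomonic y.
Proof.
apply: is_derive_val; apply: is_derive_eq (is_derive_gnomonic y (delta_mx 0 i)) _.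
by rewrite -rowE edot_delta.
Qed.

Lemma continuous_gnomonic_weight : continuous gnomonic_weight.
Proof.
move=> x; rewrite /gnomonic_weight.
have ce := cvg_edot (nbhs_filter x) (@cvg_id _ (nbhs x)) (@cvg_id _ (nbhs x)).
have c1 := cvgD (cvg_cst (1 : R) (FF := nbhs_filter x)) ce.
have cs : Num.sqrt (1 + edot y y) @[y --> x] --> Num.sqrt (1 + edot x x).
  exact: (cvg_comp _ _ (c1 (nbhs_filter x)) (@sqrt_continuous R (1 + edot x x))).
have s0 : Num.sqrt (1 + edot x x) != 0.
  by rewrite gt_eqF // sqrtr_gt0 gnomonic_weight_arg_gt0.
exact: (@cvgV R _ (nbhs x) (nbhs_filter x) (fun y => Num.sqrt (1 + edot y y)) _ s0 cs).
Qed.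

(** The derivative of the weight is a polynomial in the weight and the coordinates, so constants,
    coordinates and the weight generate an algebra closed under derivatives. *)
Lemma smooth_gnomonic : smooth_on [set: 'rV[R]_n] gnomonic.
Proof.
apply/(@smooth_on_rV _ _ _ openT) => j.
pose G (g : 'rV[R]_n -> R) := [\/ exists c, g = (fun=> c),
  exists i, g = (fun y => y 0 i) | g = gnomonic_weight].
have Gcst c : gen_alg G (fun=> c) by apply: gen_alg_gen; apply: Or31; exists c.
have Gco i : gen_alg G (fun y => y 0 i) by apply: gen_alg_gen; apply: Or32; exists i.
have Gw : gen_alg G gnomonic_weight by apply: gen_alg_gen; apply: Or33.
apply: (@gen_alg_smooth _ _ _ openT G).
- move=> g x [[c ->]|[i ->]|->] _; first exact: cst_continuous.
    exact: coord_continuous.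
  exact: continuous_gnomonic_weight.
- move=> g i [[c ->]|[k ->]|->].
  + by exists (fun=> 0) => // x _; exact: is_derive_const.
  + exists (fun=> (delta_mx 0 i : 'rV[R]_n) 0 k) => // x _.
    exact: is_derive_coord (is_derive_id x _).
  + exists (fun y => (-1) * y 0 i * (gnomonic_weight y * (gnomonic_weight y * gnomonic_weight y))).
      by do 3 apply: gen_alg_mul => //; apply: gen_alg_mul.
    move=> x _; apply: is_derive_eq (is_derive_gnomonic_weight x _) _.
    by rewrite edot_delta; ring.
- have -> : (fun y => gnomonic y 0 j) =
    (fun y => gnomonic_weight y * (p 0 j + \sum_i y 0 i * E i j)).
    by apply/funext => y; rewrite !mxE.
  apply: gen_alg_mul => //; apply: gen_alg_add => //.
  elim: (index_enum _) => [|i s IHs].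
    by under eq_fun do rewrite big_nil.
  under eq_fun do rewrite big_cons.
  by apply: gen_alg_add => //; apply: gen_alg_mul.
Qed.

(** The component along [p] recovers the weight, and then the frame components recover the
    coordinates; hence injectivity. *)
Lemma local_coord_gnomonic : local_coord [set: 'rV[R]_n] gnomonic.
Proof.
split; first exact: openT.
- exact: smooth_gnomonic.
- by move=> x _; apply/enorm1P; exact: sphere_gnomonic.
- move=> x y _ _ xy; apply/rowP => i.
  have wxy : gnomonic_weight x = gnomonic_weight y by rewrite -!edot_gnomonic_p xy.
  have := edot_gnomonic_row x i; rewrite xy edot_gnomonic_row wxy => /mulfI -> //.
  by rewrite gt_eqF // gnomonic_weight_gt0.
- move=> x _; apply: inj_row_free => v v0.
  have {}v0 : gnomonic_weight x *: (v *m E) =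
      (edot x v * gnomonic_weight x ^+ 2) *: gnomonic x.
    apply/eqP; rewrite -subr_eq0; apply/eqP.
    apply: etrans (esym (is_derive_val (is_derive_gnomonic x v))) _.
    rewrite (smooth_on_derive openT _ smooth_gnomonic) // -[RHS]v0 row_mul_sum.
    by apply: eq_bigr => i _; rewrite rowK.
  have w0 := gnomonic_weight_gt0 x.
  (* Pairing with [p] kills the tangential left side and leaves the coefficient times a positive
     weight. *)
  have c0 : edot x v * gnomonic_weight x ^+ 2 = 0.
    have := congr1 (edot^~ p) v0; rewrite (edotZl (gnomonic_weight x)) (edotZl (edot x v * _)).
    rewrite frame_edot_p edot_gnomonic_p mulr0.
    by move/esym/eqP; rewrite mulf_eq0 (gt_eqF w0) orbF => /eqP.
  move: v0; rewrite c0 scale0r => /eqP; rewrite scaler_eq0 (gt_eqF w0) /= => /eqP vE.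
  by rewrite -[v]mulmx1 -EE mulmxA vE mul0mx.
Qed.

(** At the centre the second derivatives are purely normal: they reproduce the second fundamental
    form of the unit sphere. *)
Lemma pd_pd_gnomonic0 i j : pd i (pd j gnomonic) 0 = - (i == j)%:R *: p.
Proof.
have -> : pd j gnomonic = (fun y => gnomonic_weight y *: row j E -
    (y 0 j * gnomonic_weight y ^+ 2) *: gnomonic y).
  by apply/funext => y; rewrite pd_gnomonic.
have dw := is_derive_gnomonic_weight 0 (delta_mx 0 i).
have dw2 : is_derive (0 : 'rV[R]_n) (delta_mx 0 i) (fun y => gnomonic_weight y ^+ 2) 0.
  apply: is_derive_eq (is_derive_mul dw dw) _; rewrite edot0l; ring.
have d2 := is_derive_mul (is_derive_coord j (is_derive_id (0 : 'rV[R]_n) (delta_mx 0 i))) dw2.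
apply: is_derive_val.
apply: is_derive_eq (is_derive_sub
  (is_derive_scale dw (is_derive_const (row j E) (0 : 'rV[R]_n) (delta_mx 0 i)))
  (is_derive_scale d2 (is_derive_gnomonic 0 (delta_mx 0 i)))) _.
rewrite !edot0l !mxE gnomonic0 gnomonic_weight0 expr1n eqxx /= (eq_sym j).
by rewrite oppr0 !(mul0r, scale0r, scaler0, addr0, expr1n, mulr1, sub0r) -scaleNr.
Qed.

Lemma round_metric_gnomonic0 : round_metric gnomonic 0 = 1%:M.
Proof.
apply/matrixP => i j; rewrite !mxE !pd_gnomonic mxE gnomonic_weight0.
by rewrite !mxE !mul0r !scale0r !subr0 !scale1r frame_edot_row.
Qed.

(** First derivatives of the metric at 0 pair normal second derivatives of the chart with tangent
    vectors. *)
Lemma christoffel_gnomonic0 k i j : christoffel (round_metric gnomonic) 0 k i j = 0.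
Proof.
have dg a b c : pd a (fun z => round_metric gnomonic z b c) 0 = 0.
  have -> : (fun z => round_metric gnomonic z b c) =
      (fun z => edot (pd b gnomonic z) (pd c gnomonic z)).
    by apply/funext => z; rewrite mxE.
  have sg b' : is_derive (0 : 'rV[R]_n) (delta_mx 0 a) (pd b' gnomonic) (- (a == b')%:R *: p).
    exact: is_derive_eq (smooth_on_is_derive a
      (smooth_on_pd b' smooth_gnomonic) (I : [set: 'rV[R]_n] 0)) (pd_pd_gnomonic0 a b').
  have pg b' : pd b' gnomonic 0 = row b' E.
    by rewrite pd_gnomonic gnomonic_weight0 mxE mul0r scale0r subr0 scale1r.
  apply: is_derive_val; apply: is_derive_eq (is_derive_edot (sg b) (sg c)) _.
  by rewrite !pg edotZl edotZr (edotC p) !Ep !mulr0 addr0.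
rewrite /christoffel big1 ?mulr0 // => l _.
by rewrite !dg addr0 subr0 mulr0.
Qed.

(** Every point of the sphere is the centre of such a chart, so the eigenvalue equation is only ever
    read there, where the Laplacian has no first-order terms. *)
Lemma laplacian_gnomonic0 (h : 'rV[R]_n -> R) :
  laplacian (round_metric gnomonic) h 0 = \sum_i pd i (pd i h) 0.
Proof.
rewrite /laplacian round_metric_gnomonic0 invmx1.
apply: eq_bigr => i _; rewrite (bigD1 i) //= big1 ?addr0.
  rewrite !mxE eqxx mul1r big1 ?subr0 // => k _.
  by rewrite christoffel_gnomonic0 mul0r.
by move=> j ji; rewrite mxE eq_sym (negbTE ji) mul0r.
Qed.


End GnomonicChart.

(** * Harmonic functions and first eigenfunctions *)

Section MaximumPrinciple.
Context {R : realType}.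

(** Fermat's rule gives [g1 0 = 0]. Were [d] positive, [g1] would be positive just to the right of 0
    and [g] would exceed [g 0] there. *)
Lemma second_derivative_max (g g1 : R -> R) (d : R) :
  (\forall s \near (0 : R), is_derive s (1 : R) g (g1 s)) ->
  is_derive (0 : R) (1 : R) g1 d ->
  (\forall s \near (0 : R), g s <= g 0) -> d <= 0.
Proof.
move=> gd [g1d g1E] gmax.
have [r /= r0 rB] : nbhs_ball (0 : R) (fun s => is_derive s (1 : R) g (g1 s) /\ g s <= g 0).
  by apply/nbhs_ballP; exact: filterI gd gmax.
have inB s : `|s| < r -> is_derive s (1 : R) g (g1 s) /\ g s <= g 0.
  by move=> sr; apply: rB; rewrite -ball_normE /ball_ /= sub0r normrN.
have g10 : g1 0 = 0.
  have g0 : is_derive (0 : R) (1 : R) g 0.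
    apply: (@derive1_at_max _ g (- r) r).
    - by move: r0; lra.
    - by move=> t; rewrite in_itv /= -ltr_norml => /inB[[]].
    - by rewrite in_itv /= oppr_lt0 r0.
    - by move=> t; rewrite in_itv /= -ltr_norml => /inB[].
  have [|gd0 _] := inB 0; first by rewrite normr0.
  exact: etrans (esym (is_derive_val gd0)) (is_derive_val g0).
rewrite leNgt; apply/negP => d0.
have g1c : h^-1 *: (g1 (h *: 1 + 0) - g1 0) @[h --> 0^'] --> d.
  by rewrite -g1E; exact: g1d.
have /nbhs_ballP[r' /= r'0 r'B] : nbhs (0 : R)
    (fun h => h != 0 -> 0 < h^-1 *: (g1 (h *: 1 + 0) - g1 0)).
  exact: (cvgr_gt _ g1c _ d0).
pose s := Num.min r r' / 2.
have m0 : 0 < Num.min r r' by rewrite lt_min r0.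
have s0 : 0 < s by rewrite divr_gt0.
have sm : s < Num.min r r' by rewrite /s ltr_pdivrMr // ltr_pMr // ltr1n.
have [sr sr'] : s < r /\ s < r' by move: sm; rewrite lt_min => /andP.
have [||c] := @MVT _ g g1 0 s s0.
- move=> x; rewrite in_itv /= => /andP[x0 xs].
  by have [] := inB x; rewrite ?gtr0_norm // (lt_trans xs).
- apply: derivable_within_continuous => x; rewrite in_itv /= => /andP[x0 xs].
  by have [|[]] := inB x; rewrite ?ger0_norm // (le_lt_trans xs).
rewrite in_itv /= => /andP[c0 cs] E.
have g1c0 : 0 < g1 c.
  have := r'B c; rewrite -ball_normE /ball_ /= sub0r normrN gtr0_norm //.
  move=> /(_ (lt_trans cs sr')); rewrite gt_eqF // => /(_ isT).
  by rewrite addr0 g10 subr0 [c *: 1]mulr1 -[_ *: _]/(_ * _) pmulr_rgt0 ?invr_gt0.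
have [|_] := inB s; first by rewrite gtr0_norm.
rewrite -subr_le0 E subr0 leNgt mulr_gt0 //.
Qed.

Section EuclideanLaplacian.
Context {m : nat}.
Implicit Types (u w : 'rV[R]_m -> R) (x : 'rV[R]_m).

(** Second derivatives are asked for at [x] alone, and without continuity: this is all that the
    maximum principle uses, and it makes sums, multiples and translates immediate. *)
Definition has_laplacian u x (L : R) :=
  exists (D : 'I_m -> 'rV[R]_m -> R) (D2 : 'I_m -> R),
  [/\ \forall z \near x, forall i, is_derive z (delta_mx 0 i) u (D i z),
      forall i, is_derive x (delta_mx 0 i) (D i) (D2 i) & \sum_i D2 i = L].

Lemma has_laplacian_add u w x a b :
  has_laplacian u x a -> has_laplacian w x b ->
  has_laplacian (fun z => u z + w z) x (a + b).
Proof.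
move=> [D [D2 [uD DD2 <-]]] [D' [D2' [wD DD2' <-]]].
exists (fun i z => D i z + D' i z), (fun i => D2 i + D2' i); split.
- apply: filterS (filterI uD wD) => z [uz wz] i; exact: is_derive_add.
- by move=> i; exact: is_derive_add.
- by rewrite big_split.
Qed.

Lemma has_laplacian_scale u x a c :
  has_laplacian u x a -> has_laplacian (fun z => c * u z) x (c * a).
Proof.
move=> [D [D2 [uD DD2 <-]]].
exists (fun i z => c * D i z), (fun i => c * D2 i); split.
- apply: filterS uD => z uz i.
  apply: is_derive_eq (is_derive_mul (is_derive_const c _ _) (uz i)) _.
  by rewrite mul0r add0r.
- move=> i; apply: is_derive_eq (is_derive_mul (is_derive_const c _ _) (DD2 i)) _.
  by rewrite mul0r add0r.
- by rewrite mulr_sumr.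
Qed.

Lemma has_laplacian_translate u h x a :
  has_laplacian u (x + h) a -> has_laplacian (fun z => u (z + h)) x a.
Proof.
move=> [D [D2 [uD DD2 <-]]].
exists (fun i z => D i (z + h)), D2; split => //.
- have /nbhs_ballP[r /= r0 rB] := uD.
  apply/nbhs_ballP; exists r => // z; rewrite -ball_normE /ball_ /= => xz i.
  apply: is_derive_translate; apply: rB; rewrite -ball_normE /ball_ /=.
  by rewrite opprD addrACA subrr addr0.
- by move=> i; exact: is_derive_translate.
Qed.

(** The numerator is positive from dimension 3 on: this is the strict subharmonicity on which the
    barrier rests. *)
Lemma has_laplacian_ln_dist s x : x != s ->
  has_laplacian (fun z => ln (edot (z - s) (z - s))) x
    ((2 * m%:R - 4) / edot (x - s) (x - s)).
Proof.
move=> xs; pose q z := edot (z - s) (z - s).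
have qx : 0 < q x by rewrite edot_gt0 subr_eq0.
have qd z i : is_derive z (delta_mx 0 i) q (2 * (z - s) 0 i).
  have dd := is_derive_sub (is_derive_id z (delta_mx 0 i))
    (is_derive_const s z (delta_mx 0 i)).
  apply: is_derive_eq (is_derive_edot dd dd) _.
  by rewrite subr0 edotC !edot_delta; ring.
have qc : q z @[z --> x] --> q x.
  have cs := cvgB (@cvg_id _ (nbhs x)) (cvg_cst s (FF := nbhs_filter x)).
  have {}cs : z - s @[z --> x] --> x - s by exact: (cs (nbhs_filter x)).
  exact: (cvg_edot (nbhs_filter x) cs cs).
have qp : \forall z \near x, 0 < q z by exact: (cvgr_gt _ qc _ qx).
exists (fun i z => 2 * (z - s) 0 i / q z),
  (fun i => 2 / q x - 4 * ((x - s) 0 i * (x - s) 0 i) / q x ^+ 2); split.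
- apply: filterS qp => z qz i.
  apply: is_derive_eq (is_derive_compR (is_derive1_ln qz) (qd z i)) _.
  by rewrite mulrC.
- move=> i; have q0 : q x != 0 by rewrite gt_eqF.
  have dc := is_derive_coord i (is_derive_sub (is_derive_id x (delta_mx 0 i))
    (is_derive_const s x (delta_mx 0 i))).
  have d2 := is_derive_mul (is_derive_const (2 : R) x (delta_mx 0 i)) dc.
  apply: is_derive_eq (is_derive_mul d2 (is_derive_invr q0 (qd x i))) _.
  by rewrite !mxE !eqxx /=; field.
- rewrite big_split /= sumr_const card_ord sumrN -mulr_suml -mulr_sumr.
  have q0 : q x != 0 by rewrite gt_eqF.
  by rewrite -[\sum_i _]/(q x) -[_ *+ m]mulr_natl -/(q x); field.
Qed.

(** Every term of the Laplacian is a second derivative along a coordinate line through a local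
    maximum. *)
Lemma has_laplacian_max u x L : has_laplacian u x L ->
  (\forall z \near x, u z <= u x) -> L <= 0.
Proof.
move=> [D [D2 [uD DD2 <-]]] umax; apply: sumr_le0 => i _.
have line (P : 'rV[R]_m -> Prop) : (\forall z \near x, P z) ->
    \forall s \near (0 : R), P (x + s *: delta_mx 0 i).
  move=> nP; have c : {for (0 : R), continuous (fun s : R => x + s *: (delta_mx 0 i : 'rV[R]_m))}.
    apply: differentiable_continuous; apply/derivable1_diffP.
    by have [] := (is_derive_line id x (delta_mx 0 i) 0 _).1 (is_derive_id _ _).
  by apply: c; rewrite scale0r addr0.
apply: (@second_derivative_max (fun s => u (x + s *: delta_mx 0 i))
  (fun s => D i (x + s *: delta_mx 0 i))).
- by apply: filterS (line _ uD) => s /(_ i) us; exact: (is_derive_line u x (delta_mx 0 i) s _).1 us.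
- apply: (is_derive_line (D i) x (delta_mx 0 i) 0 (D2 i)).1.
  by rewrite scale0r addr0.
- by apply: filterS (line _ umax) => s; rewrite scale0r addr0.
Qed.

End EuclideanLaplacian.

End MaximumPrinciple.

(** * Vanishing of second differences and Jensen's equation *)

Section JensenEquation.
Context {R : realType}.

Lemma norm_le_enorm n (x : 'rV[R]_n) : `|x| <= enorm x.
Proof.
rewrite [leLHS]/Num.Def.normr /= mx_normrE; apply/bigmax_leP; split.
  exact: enorm_ge0.
by move=> [i j] _ /=; rewrite (ord1 i); exact: enorm_sup.
Qed.

Lemma continuous_edot (T : topologicalType) n (f g : T -> 'rV[R]_n) :
  continuous f -> continuous g -> continuous (fun x => edot (f x) (g x)).
Proof. by move=> fc gc x; apply: (cvg_edot (nbhs_filter x)); [exact: fc|exact: gc]. Qed.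

Lemma continuous_addf (T : topologicalType) (f g : T -> R) :
  continuous f -> continuous g -> continuous (fun x => f x + g x).
Proof. by move=> fc gc x; apply: cvgD; [exact: fc|exact: gc]. Qed.

Lemma continuous_mulf (T : topologicalType) (f g : T -> R) :
  continuous f -> continuous g -> continuous (fun x => f x * g x).
Proof. by move=> fc gc x; apply: cvgM; [exact: fc|exact: gc]. Qed.

Lemma continuous_cstf (T : topologicalType) (c : R) : continuous (fun _ : T => c).
Proof. by move=> x; exact: cvg_cst. Qed.

Lemma continuous_compf (T U V : topologicalType) (f : T -> U) (g : U -> V) :
  continuous f -> continuous g -> continuous (fun x => g (f x)).
Proof. by move=> fc gc x; exact: (cvg_comp _ _ (fc x) (gc (f x))). Qed.

Lemma continuous_enorm n : continuous (@enorm R n).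
Proof.
move=> x; rewrite /enorm.
have c : edot y y @[y --> x] --> edot x x by exact: (cvg_edot (nbhs_filter x) (@cvg_id _ (nbhs x)) (@cvg_id _ (nbhs x))).
exact: (cvg_comp _ _ c (@sqrt_continuous R (edot x x))).
Qed.

Lemma continuous_add_cst n (h : 'rV[R]_n) : continuous (fun x : 'rV[R]_n => x + h).
Proof.
move=> x; have := cvgD (@cvg_id _ (nbhs x)) (cvg_cst h (FF := nbhs_filter x)).
by move=> /(_ (nbhs_filter x)).
Qed.

Lemma compact_enorm_ball n (r : R) : compact [set x : 'rV[R]_n | enorm x <= r].
Proof.
apply: bounded_closed_compact.
- exists r; split; first exact: num_real.
  by move=> M rM x /= xr; apply: le_trans (norm_le_enorm x) _; rewrite (le_trans xr) // ltW.
- apply: (@closed_comp _ _ (@enorm R n) [set y : R | y <= r]); last exact: closed_le.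
  by move=> x _; exact: continuous_enorm.
Qed.

Section SecondDifference.
Variables (m : nat) (u : 'rV[R]_m -> R).
Hypotheses (m3 : (3 <= m)%N) (uc : continuous u)
  (ul : forall x : 'rV[R]_m, x != 0 -> has_laplacian u x 0).
Variable h : 'rV[R]_m.
Hypothesis decay : forall e, 0 < e -> exists r, forall x, r <= enorm x ->
  u (x + h) + u (x - h) - 2 * u x <= e.

(* The second difference of u is harmonic off the points 0, h and -h and tends
   to 0 at infinity; adding a multiple of the strictly subharmonic function
   ln |x| + ln |x - h| + ln |x + h| rules out an interior maximum. *)
Lemma second_difference_le (x0 : 'rV[R]_m) : x0 != 0 -> x0 != h -> x0 != - h ->
  u (x0 + h) + u (x0 - h) - 2 * u x0 <= 0.
Proof.
move=> x00 x0h x0Nh; rewrite leNgt; apply/negP.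
pose v (z : 'rV[R]_m) := u (z + h) + u (z - h) - 2 * u z; rewrite -/(v x0) => v0.
pose q (s z : 'rV[R]_m) := edot (z - s) (z - s).
(* The exponential of the barrier. Being 0 at the three singular points, it replaces the logarithms
   by a function that is continuous everywhere. *)
pose Q z := q 0 z * (q h z * q (- h) z).
have q_gt0 (s z : 'rV[R]_m) : (0 < q s z) = (z != s) by rewrite edot_gt0 subr_eq0.
have qc (s : 'rV[R]_m) : continuous (q s).
  by apply: continuous_edot; exact: continuous_add_cst.
have Qc : continuous Q.
  exact: continuous_mulf (qc 0) (continuous_mulf (qc h) (qc (- h))).
have vc : continuous v.
  have -> : v = (fun z => u (z + h) + u (z + (- h)) + (- 2) * u z).
    by apply/funext => z; rewrite /v mulNr.
  have sc k := continuous_compf (continuous_add_cst (h := k)) uc.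
  apply: (@continuous_addf 'rV[R]_m (fun z => u (z + h) + u (z + (- h))) (fun z => (- 2) * u z)).
    exact: (continuous_addf (sc h) (sc (- h))).
  refine (@continuous_mulf _ (fun=> -2) u (@continuous_cstf _ (-2)) uc).
have Q0 z : 0 <= Q z by rewrite /Q !mulr_ge0 // edot_ge0.
have v02 : 0 < v x0 / 2 by rewrite divr_gt0.
have [r0 r0P] := decay v02.
pose r := Num.max r0 (enorm x0); pose K := [set x : 'rV[R]_m | enorm x <= r].
have Kx0 : K x0 by rewrite /K /= le_max lexx orbT.
have K0 : K !=set0 by exists x0.
have Kc : compact K by exact: compact_enorm_ball.
have [c _ cmax] := EVT_max_rV K0 Kc (continuous_subspaceT Qc).
have Qx0 : 0 < Q x0 by rewrite /Q !mulr_gt0 // q_gt0.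
have Qc0 : 0 < Q c by apply: lt_le_trans Qx0 _; apply: cmax; rewrite inE.
(* Chosen so that [A * (v x0 / 2)] exceeds [ln (Q c) - ln (Q x0)] by 1, which contradicts the final
   comparison of [G x0] with [G z]. *)
pose A := 2 * (ln (Q c) - ln (Q x0) + 1) / v x0.
have A0 : 0 < A.
  rewrite divr_gt0 // mulr_gt0 // ltr_wpDl // subr_ge0 ler_ln ?posrE //.
  by apply: cmax; rewrite inE.
(* The exponential of [A * v] plus the barrier. It attains a maximum on the ball, and not at a
   singular point, since it vanishes there but is positive at [x0]. *)
pose G z := expR (A * v z) * Q z.
have Gc : continuous G.
  apply: (@continuous_mulf 'rV[R]_m (fun z => expR (A * v z))) Qc.
  apply: (@continuous_compf 'rV[R]_m R R (fun z => A * v z)); last exact: continuous_expR.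
  refine (@continuous_mulf _ (fun=> A) v (@continuous_cstf _ A) vc).
have [z Kz zmax] := EVT_max_rV K0 Kc (continuous_subspaceT Gc).
have {}Kz : enorm z <= r by move: Kz; rewrite inE.
have Gx0 : 0 < G x0 by rewrite /G mulr_gt0 // expR_gt0.
have Gz : G x0 <= G z by apply: zmax; rewrite inE.
have Qz : 0 < Q z.
  by have := lt_le_trans Gx0 Gz; rewrite /G pmulr_rgt0 // expR_gt0.
have [qz0 qzh qzNh] : [/\ 0 < q 0 z, 0 < q h z & 0 < q (- h) z].
  by split; rewrite lt_def edot_ge0 andbT; apply: contraTneq Qz => E;
     rewrite /Q E ?mul0r ?mulr0 ?mul0r ?mulr0 ltxx.
pose l y := A * v y + (ln (q 0 y) + (ln (q h y) + ln (q (- h) y))).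
have Gl (y : 'rV[R]_m) : 0 < q 0 y -> 0 < q h y -> 0 < q (- h) y -> G y = expR (l y).
  by move=> a b d; rewrite /l !expRD !lnK ?posrE.
(* On the boundary of the ball this is the decay of [v]. In the interior the maximum principle would
   apply to [l], whose Laplacian at [z] is positive. *)
have vz : v z <= v x0 / 2.
  have [zr|zr] := leP r (enorm z).
    by apply: r0P; apply: le_trans zr; rewrite le_max lexx.
  exfalso.
  have m4 : 0 < (2 * m%:R - 4 : R).
    have : (3%:R : R) <= m%:R by rewrite ler_nat.
    lra.
  have hasl : has_laplacian l z (A * (0 + 0 + (-2) * 0) +
     ((2 * m%:R - 4) / q 0 z + ((2 * m%:R - 4) / q h z + (2 * m%:R - 4) / q (- h) z))).
    have zs s : 0 < q s z -> z != s by rewrite q_gt0.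
    apply: has_laplacian_add.
      apply: has_laplacian_scale.
      have -> : v = (fun y => u (y + h) + u (y + (- h)) + (-2) * u y).
        by apply/funext => y; rewrite /v mulNr.
      apply: has_laplacian_add; first apply: has_laplacian_add.
      - apply: has_laplacian_translate; apply: ul.
        by rewrite -[z + h]/(z + h) addr_eq0; exact: zs.
      - by apply: has_laplacian_translate; apply: ul; rewrite subr_eq0; exact: zs.
      - by apply: has_laplacian_scale; apply: ul; exact: zs.
    apply: has_laplacian_add; first by apply: has_laplacian_ln_dist; exact: zs.
    by apply: has_laplacian_add; apply: has_laplacian_ln_dist; exact: zs.
  have lmax : \forall y \near z, l y <= l z.
    have qn s : 0 < q s z -> \forall y \near z, 0 < q s y.
      by move=> qs; exact: (cvgr_gt _ (qc s z) _ qs).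
    have rn : \forall y \near z, enorm y < r.
      exact: (cvgr_lt _ (continuous_enorm (x := z)) _ zr).
    apply: filterS (filterI rn (filterI (qn _ qz0) (filterI (qn _ qzh) (qn _ qzNh)))).
    move=> y [yr [y0 [yh yNh]]]; rewrite -ler_expR -!Gl //.
    by apply: zmax; rewrite inE /K /= ltW.
  have := has_laplacian_max hasl lmax.
  rewrite leNgt => /negP; apply; rewrite !(addr0, mulr0) add0r.
  by apply: addr_gt0; [|apply: addr_gt0]; apply: divr_gt0.
have lGz : ln (G z) <= A * (v x0 / 2) + ln (Q c).
  rewrite /G lnM ?posrE ?expR_gt0 // expRK; apply: lerD.
    by rewrite ler_pM2l.
  by rewrite ler_ln ?posrE //; apply: cmax; rewrite inE.
have : ln (G x0) <= ln (G z).
  by rewrite ler_ln ?posrE // (lt_le_trans Gx0).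
rewrite {1}/G lnM ?posrE ?expR_gt0 // expRK => /le_trans/(_ lGz).
have -> : A * v x0 = 2 * (ln (Q c) - ln (Q x0) + 1) by rewrite /A divfK // gt_eqF.
have -> : A * (v x0 / 2) = ln (Q c) - ln (Q x0) + 1.
  by rewrite /A; field; rewrite gt_eqF.
have := cmax x0; rewrite inE => /(_ Kx0); rewrite -ler_ln ?posrE //.
lra.
Qed.

End SecondDifference.

(** Applied to [u] and to its opposite, the inequality for second differences gives Jensen's
    equation off three points. Centred at a midpoint it becomes additivity; the excluded cases are
    recovered from homogeneity, and a positively homogeneous additive function is linear. *)
Lemma harmonic_cone_linear m (u : 'rV[R]_m -> R) : (3 <= m)%N ->
  continuous u -> (forall x : 'rV[R]_m, x != 0 -> has_laplacian u x 0) ->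
  (forall c (x : 'rV[R]_m), 0 < c -> u (c *: x) = c * u x) ->
  (forall (h : 'rV[R]_m) e, 0 < e -> exists r, forall x : 'rV[R]_m, r <= enorm x ->
     `|u (x + h) + u (x - h) - 2 * u x| <= e) ->
  forall x, u x = edot (\row_i u (delta_mx 0 i)) x.
Proof.
move=> m3 uc ul uh decay.
have jensen (x h : 'rV[R]_m) : x != 0 -> x != h -> x != - h -> u (x + h) + u (x - h) = 2 * u x.
  move=> x0 xh xNh; apply/eqP; rewrite -subr_eq0 eq_le; apply/andP; split.
    apply: second_difference_le => // e e0; have [r rP] := decay h e e0.
    by exists r => y /rP; rewrite ler_norml => /andP[].
  have ulN (y : 'rV[R]_m) : y != 0 -> has_laplacian (fun z => (-1) * u z) y 0.
    by move=> y0; rewrite -(mulr0 (-1)); apply: has_laplacian_scale; exact: ul.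
  have ucN : continuous (fun z => (-1) * u z).
    refine (@continuous_mulf _ (fun=> -1) u (@continuous_cstf _ (-1)) uc).
  have sd : (-1) * u (x + h) + (-1) * u (x - h) - 2 * ((-1) * u x) <= 0.
    apply: (@second_difference_le _ _ m3 ucN ulN h _ x x0 xh xNh).
    move=> e e0; have [r rP] := decay h e e0; exists r => y /rP.
    by rewrite ler_norml => /andP[+ _]; lra.
  by move: sd; lra.
have u0 : u 0 = 0.
  have := uh 2 0 (ltr0n _ 2); rewrite scaler0; lra.
have add_gen (a b : 'rV[R]_m) : a != 0 -> b != 0 -> a + b != 0 -> u (a + b) = u a + u b.
  move=> a0 b0 ab0.
  have E1 : 2^-1 *: (a + b) + 2^-1 *: (a - b) = a.
    by apply/rowP => i; rewrite !mxE; field.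
  have E2 : 2^-1 *: (a + b) - 2^-1 *: (a - b) = b.
    by apply/rowP => i; rewrite !mxE; field.
  have := jensen (2^-1 *: (a + b)) (2^-1 *: (a - b)).
  rewrite E1 E2 uh ?invr_gt0 // => -> //.
  - by rewrite mulVKf.
  - by rewrite scaler_eq0 invr_eq0 negb_or ab0 andbT pnatr_eq0.
  - by rewrite -subr_eq0 E2.
  - by rewrite -addr_eq0 E1.
have uN (a : 'rV[R]_m) : u (- a) = - u a.
  have [->|a0] := eqVneq a 0; first by rewrite oppr0 u0 oppr0.
  have a20 : 2 *: a != 0 by rewrite scaler_eq0 pnatr_eq0.
  (* The sum of [a] and [- a] is excluded from [add_gen], being 0; the sum of [2 *: a] and [- a] is
     not. *)
  have E : 2 *: a + (- a) = a by rewrite scaler_nat mulr2n addrK.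
  have := add_gen (2 *: a) (- a); rewrite oppr_eq0 E a0 a20 uh // => /(_ isT isT isT).
  lra.
have uD (a b : 'rV[R]_m) : u (a + b) = u a + u b.
  have [->|a0] := eqVneq a 0; first by rewrite !add0r u0 add0r.
  have [->|b0] := eqVneq b 0; first by rewrite !addr0 u0 addr0.
  have [ab0|] := eqVneq (a + b) 0; last exact: add_gen.
  by rewrite ab0 u0; move/eqP: ab0; rewrite addr_eq0 => /eqP ->; rewrite uN addNr.
have uZ c (a : 'rV[R]_m) : u (c *: a) = c * u a.
  have [c0|c0|->] := ltgtP c 0; [|exact: uh|by rewrite scale0r u0 mul0r].
  rewrite -[c]opprK scaleNr uN uh ?oppr_gt0 //; ring.
move=> x; rewrite {1}[x]row_sum_delta edotC /edot.
by elim/big_ind2: _ => [//|a b c d <- <-|i _]; [exact: uD|rewrite uZ mxE].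
Qed.

End JensenEquation.

(** * Closure properties of smooth functions *)

Section SmoothClosure.
Context {R : realType} {n : nat}.
Variable U : set 'rV[R]_n.
Hypothesis oU : open U.

Lemma smooth_on_cst (c : R) : smooth_on U (fun _ : 'rV[R]_n => c).
Proof.
apply: (@gen_alg_smooth _ _ _ oU (fun g => exists c, g = (fun=> c))).
- by move=> g x [d ->] _; exact: cst_continuous.
- move=> g i [d ->]; exists (fun=> 0); first by apply: gen_alg_gen; exists 0.
  by move=> x _; exact: is_derive_const.
- by apply: gen_alg_gen; exists c.
Qed.

Lemma smooth_on_add (g h : 'rV[R]_n -> R) :
  smooth_on U g -> smooth_on U h -> smooth_on U (fun x => g x + h x).
Proof.
move=> gU hU; apply: (@gen_alg_smooth _ _ _ oU (smooth_on U)).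
- by move=> a x aU Ux; exact: smooth_on_continuous aU Ux.
- move=> a i aU; exists (pd i a); first exact: gen_alg_gen (smooth_on_pd i aU).
  by move=> x Ux; exact: smooth_on_is_derive aU Ux.
- by apply: gen_alg_add; exact: gen_alg_gen.
Qed.

Lemma smooth_on_sum (I : Type) (s : seq I) (g : I -> 'rV[R]_n -> R) :
  (forall i, smooth_on U (g i)) -> smooth_on U (fun x => \sum_(i <- s) g i x).
Proof.
move=> gU; elim: s => [|i s IHs].
  by under eq_fun do rewrite big_nil; exact: smooth_on_cst.
under eq_fun do rewrite big_cons.
exact: (@smooth_on_add (g i) (fun x => \sum_(j <- s) g j x) (gU i) IHs).
Qed.

Lemma smooth_on_coordinate i : smooth_on U (fun x : 'rV[R]_n => x 0 i).
Proof.
apply: (@gen_alg_smooth _ _ _ oU (fun g => (exists c, g = (fun=> c)) \/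
  g = (fun x : 'rV[R]_n => x 0 i))).
- by move=> g x [[d ->]|->] _; [exact: cst_continuous|exact: coord_continuous].
- move=> g j [[d ->]|->].
    exists (fun=> 0); first by apply: gen_alg_gen; left; exists 0.
    by move=> x _; exact: is_derive_const.
  exists (fun=> (delta_mx 0 j : 'rV[R]_n) 0 i).
    by apply: gen_alg_gen; left; exists ((delta_mx 0 j : 'rV[R]_n) 0 i).
  by move=> x _; exact: is_derive_coord (is_derive_id x _).
- by apply: gen_alg_gen; right.
Qed.

End SmoothClosure.

Lemma cvg_rV (R : realType) n (T : Type) (F : set_system T) (FF : Filter F)
    (f : T -> 'rV[R]_n) (l : 'rV[R]_n) :
  (forall j, f x 0 j @[x --> F] --> l 0 j) -> f x @[x --> F] --> l.
Proof.
move=> fl; apply/cvgrPdist_lt => e e0.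
have H j : \forall x \near F, `|(l - f x) 0 j| < e.
  have /cvgrPdist_lt/(_ _ e0) := fl j.
  by apply: filterS => x; rewrite !mxE.
have := @filter_forall _ _ (fun j x => `|(l - f x) 0 j| < e) F FF H.
exact: filterS (fun y yH => (rV_norm_lt _ e0).2 yH).
Qed.

(** Invariance of the trace under a matrix with orthonormal columns, which may have more rows than
    columns. It carries the ambient Laplacian to the coordinates of a chart. *)
Lemma sum_orthonormal_columns (R : comRingType) m n (a : 'I_m -> 'I_n -> R)
    (h : 'I_n -> 'I_n -> R) :
  (forall j k, \sum_i a i j * a i k = (j == k)%:R) ->
  \sum_i \sum_j \sum_k a i j * a i k * h k j = \sum_j h j j.
Proof.
move=> ao; rewrite exchange_big /=; apply: eq_bigr => j _.
rewrite exchange_big /= (bigD1 j) //= -mulr_suml ao eqxx mul1r.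
rewrite big1 ?addr0 // => k kj.
by rewrite -mulr_suml ao eq_sym (negbTE kj) mul0r.
Qed.

(** * The homogeneous extension of an eigenfunction and its harmonicity *)

Section ConicalExtension.
Context {R : realType} {n : nat}.
Variable f : 'rV[R]_n.+1 -> R.
Hypotheses (fS : smooth_fun f)
  (fE : forall U phi, local_coord U phi -> forall x : 'rV[R]_n, U x ->
     laplacian (round_metric phi) (f \o phi) x = - n%:R * f (phi x))
  (f1 : forall p, sphere p -> `|f p| < 1).

Definition cone_ext (x : 'rV[R]_n.+1) : R := enorm x * f ((enorm x)^-1 *: x).

Lemma cone_ext_homog c (x : 'rV[R]_n.+1) : 0 < c -> cone_ext (c *: x) = c * cone_ext x.
Proof.
move=> c0; rewrite /cone_ext enormZ gtr0_norm // invfM scalerA -mulrA.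
by rewrite mulrAC (mulVf (lt0r_neq0 c0)) mul1r.
Qed.

Lemma cone_ext_bound x : `|cone_ext x| <= enorm x.
Proof.
rewrite /cone_ext; have [->|x0] := eqVneq x 0.
  by rewrite /enorm edot0l sqrtr0 mul0r normr0.
rewrite normrM ger0_norm ?enorm_ge0 // ler_piMr ?enorm_ge0 // ltW // f1 //.
by rewrite /sphere /= enormZ ger0_norm ?invr_ge0 ?enorm_ge0 // mulVf // enorm_eq0.
Qed.

Lemma cone_ext_sphere p : sphere p -> cone_ext p = f p.
Proof. by rewrite /cone_ext => ->; rewrite invr1 scale1r mul1r. Qed.

Section Frame.
Variables (p : 'rV[R]_n.+1) (E : 'M[R]_(n, n.+1)).
Hypotheses (p1 : edot p p = 1) (EE : E *m E^T = 1%:M)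
  (Ep : forall i, edot (row i E) p = 0).
Implicit Types y : 'rV[R]_n.

Let w := @gnomonic_weight R n.
(** [A y] is the norm of [p + y *m E], the inverse of the weight, written as a product so as to be
    visibly smooth. Thus [ut] is the restriction of the extension to the affine tangent plane at
    [p]. *)
Let A y := (1 + edot y y) * w y.
Let g y := f (gnomonic p E y).
Let ut y := A y * g y.

Let smooth_w : smooth_on setT w.
Proof.
have -> : w = (fun y => \sum_j gnomonic p E y 0 j * p 0 j).
  by apply/funext => y; rewrite /w -(edot_gnomonic_p p1 Ep y).
apply: (smooth_on_sum openT) => j.
have gj := (@smooth_on_rV R n setT openT _ (gnomonic p E)).1 (smooth_gnomonic p E) j.
exact: (smooth_on_mul openT gj (smooth_on_cst openT (p 0 j))).
Qed.

Let smooth_A : smooth_on setT A.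
Proof.
have sq : smooth_on setT (fun y : 'rV[R]_n => edot y y).
  apply: (smooth_on_sum openT) => j.
  exact: (smooth_on_mul openT (smooth_on_coordinate openT j) (smooth_on_coordinate openT j)).
exact: (smooth_on_mul openT (smooth_on_add openT (smooth_on_cst openT 1) sq) smooth_w).
Qed.

Let smooth_g : smooth_on setT g.
Proof. exact: (fS (local_coord_gnomonic p1 EE Ep)). Qed.

Let smooth_ut : smooth_on setT ut.
Proof. exact: (smooth_on_mul openT smooth_A smooth_g). Qed.

Let is_derive_A y j : is_derive y (delta_mx 0 j) A (y 0 j * w y).
Proof.
have dq := is_derive_add (is_derive_const (1 : R) y (delta_mx 0 j))
  (is_derive_edot (is_derive_id y (delta_mx 0 j)) (is_derive_id y (delta_mx 0 j))).
apply: is_derive_eq (is_derive_mul dq (is_derive_gnomonic_weight y (delta_mx 0 j))) _.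
rewrite (edotC (delta_mx 0 j)) edot_delta -/(w y).
have := gnomonic_weight_sqr y; rewrite -/(w y) => wy.
transitivity (y 0 j * w y * (2 - w y ^+ 2 * (1 + edot y y))); first by ring.
by rewrite wy; ring.
Qed.

Let pd_ut y j : pd j ut y = y 0 j * w y * g y + A y * pd j g y.
Proof.
apply: is_derive_val; apply: is_derive_mul; first exact: is_derive_A.
exact: smooth_on_is_derive smooth_g I.
Qed.

(** Each second derivative of [A] at 0 is 1, so [A] contributes [n%:R * f p] to the trace, and the
    eigenvalue [n] cancels exactly this. *)
Let trace_ut0 : \sum_j pd j (pd j ut) 0 = 0.
Proof.
have H j : pd j (pd j ut) 0 = f p + pd j (pd j g) 0.
  have -> : pd j ut = (fun y => y 0 j * w y * g y + A y * pd j g y).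
    by apply/funext => y; exact: pd_ut.
  have dc := is_derive_coord j (is_derive_id (0 : 'rV[R]_n) (delta_mx 0 j)).
  have dw := is_derive_gnomonic_weight (0 : 'rV[R]_n) (delta_mx 0 j).
  have dg := smooth_on_is_derive j smooth_g (I : setT (0 : 'rV[R]_n)).
  have dg2 := smooth_on_is_derive j (smooth_on_pd j smooth_g) (I : setT (0 : 'rV[R]_n)).
  apply: is_derive_val; apply: is_derive_eq (is_derive_add
    (is_derive_mul (is_derive_mul dc dw) dg) (is_derive_mul (is_derive_A 0 j) dg2)) _.
  rewrite /A /g /w gnomonic_weight0 !edot0l gnomonic0 !mxE !eqxx /=. ring.
rewrite (eq_bigr _ (fun j _ => H j)) big_split /= sumr_const card_ord.
have := fE (local_coord_gnomonic p1 EE Ep) (I : setT (0 : 'rV[R]_n)).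
rewrite laplacian_gnomonic0 // gnomonic0 -[\sum_i _]/(\sum_i pd i (pd i g) 0) => ->.
by rewrite -mulr_natl; ring.
Qed.

Let proj (z : 'rV[R]_n.+1) : 'rV[R]_n := \row_j (edot z (row j E) / edot z p).

(** Division by [edot z p] moves [z] along its ray to the affine tangent plane, where the extension
    is [ut]. *)
Lemma cone_ext_gnomonic z : 0 < edot z p ->
  cone_ext z = edot z p * ((1 + edot (proj z) (proj z)) *
    gnomonic_weight (proj z) * f (gnomonic p E (proj z))).
Proof.
move=> zp; have zE : z = edot z p *: (p + proj z *m E).
  rewrite {1}(frame_decomp p1 EE Ep z) scalerDr; congr (_ + _).
  rewrite scalemxAl; congr (_ *m _); apply/rowP => j; rewrite !mxE.
  by rewrite mulrCA divff ?mulr1 // gt_eqF.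
rewrite {1}zE cone_ext_homog //; congr (_ * _).
have w0 := gnomonic_weight_gt0 (proj z).
have -> : p + proj z *m E = (gnomonic_weight (proj z))^-1 *: gnomonic p E (proj z).
  by rewrite /gnomonic scalerA mulVf ?scale1r // gt_eqF.
have wi0 : 0 < (gnomonic_weight (proj z))^-1 by rewrite invr_gt0.
have sg : sphere (gnomonic p E (proj z)) by apply/enorm1P; exact: sphere_gnomonic.
rewrite (cone_ext_homog _ wi0) (cone_ext_sphere sg).
congr (_ * _); apply: (mulfI (lt0r_neq0 w0)); rewrite mulfV ?gt_eqF //.
by rewrite -[LHS](gnomonic_weight_sqr (proj z)); ring.
Qed.

Let is_derive_proj z v : edot z p != 0 -> is_derive z v proj
  (\row_j ((edot v (row j E) - proj z 0 j * edot v p) / edot z p)).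
Proof.
move=> zp; apply: is_derive_rV => j.
have -> : (fun z => proj z 0 j) = (fun z => edot z (row j E) * (edot z p)^-1).
  by apply/funext => y; rewrite mxE.
have de q : is_derive z v (fun z => edot z q) (edot v q).
  apply: is_derive_eq (is_derive_edot (is_derive_id z v) (is_derive_const q z v)) _.
  by rewrite edot0r addr0.
apply: is_derive_eq (is_derive_mul (de (row j E)) (@is_derive_invr _ _ (fun z => edot z p) z v _ zp (de p))) _.
by rewrite !mxE; field.
Qed.

Let D v z := edot v p * ut (proj z) +
  \sum_j (edot v (row j E) - proj z 0 j * edot v p) * pd j ut (proj z).

Let openH : open [set z : 'rV[R]_n.+1 | 0 < edot z p].
Proof.
apply: (@open_comp _ _ (fun z => edot z p) [set y : R | 0 < y]); last exact: open_gt.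
move=> z _; apply: (cvg_edot (nbhs_filter z)); first exact: cvg_id.
exact: (cvg_cst _ (FF := nbhs_filter z)).
Qed.

Let is_derive_cone z v : 0 < edot z p -> is_derive z v cone_ext (D v z).
Proof.
move=> zp; have zp0 : edot z p != 0 by rewrite gt_eqF.
apply: (is_derive_near openH zp (f := fun z => edot z p * ut (proj z))).
  by move=> y yp; rewrite cone_ext_gnomonic.
have de : is_derive z v (fun z => edot z p) (edot v p).
  apply: is_derive_eq (is_derive_edot (is_derive_id z v) (is_derive_const p z v)) _.
  by rewrite edot0r addr0.
have du := is_derive_smooth openT smooth_ut (I : setT (proj z)) (is_derive_proj v zp0).
apply: is_derive_eq (is_derive_mul de du) _.
congr (_ + _); rewrite mulr_sumr; apply: eq_bigr => j _.
by rewrite !mxE; field.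
Qed.

(** At the centre the first-order terms cancel, one coming from the factor [edot z p] and the other
    from the coefficients in [D]. Only the Hessian of [ut] in tangential directions is left, since a
    function of degree one is linear along rays. *)
Let is_derive_D x v : 0 < edot x p -> proj x = 0 -> is_derive x v (D v)
  ((edot x p)^-1 * \sum_j \sum_k edot v (row j E) * edot v (row k E) * pd k (pd j ut) 0).
Proof.
move=> xp x0; have xp0 : edot x p != 0 by rewrite gt_eqF.
have dp := is_derive_proj v xp0.
have du := is_derive_smooth openT smooth_ut (I : setT (proj x)) dp.
have du2 j := is_derive_smooth openT (smooth_on_pd j smooth_ut) (I : setT (proj x)) dp.
have dl j := is_derive_sub (is_derive_const (edot v (row j E)) x v)
  (is_derive_mul (is_derive_coord j dp) (is_derive_const (edot v p) x v)).
have ds := @is_derive_bigsum R _ _ _ (index_enum _) predT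
  (fun j z => (edot v (row j E) - proj z 0 j * edot v p) * pd j ut (proj z)) x v _
  (fun j _ => is_derive_mul (dl j) (du2 j)).
apply: is_derive_eq (is_derive_add
  (is_derive_mul (is_derive_const (edot v p) x v) du) ds) _.
rewrite x0 mul0r add0r !mulr_sumr -big_split /=; apply: eq_bigr => j _.
rewrite !mxE mul0r subr0 mulr0 addr0.
rewrite [X in _ + (_ + X)](_ : _ = (edot x p)^-1 * \sum_k
   edot v (row j E) * edot v (row k E) * pd k (pd j ut) 0); last first.
  rewrite [LHS]mulr_sumr [RHS]mulr_sumr; apply: eq_bigr => k _.
  by rewrite !mxE mul0r subr0; field.
by rewrite addrA -[RHS]add0r; congr (_ + _); field.
Qed.

Let cvg_D (T : Type) (F : set_system T) (FF : Filter F) (z : T -> 'rV[R]_n.+1) x v :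
  z t @[t --> F] --> x -> 0 < edot x p ->
  D v (z t) @[t --> F] --> D v x /\ edot (z t) p * ut (proj (z t)) @[t --> F] --> edot x p * ut (proj x).
Proof.
move=> zx xp; have xp0 : edot x p != 0 by rewrite gt_eqF.
have ce q : edot (z t) q @[t --> F] --> edot x q := cvg_edot FF zx (cvg_cst q (FF := FF)).
have cj j : proj (z t) 0 j @[t --> F] --> proj x 0 j.
  rewrite mxE; under eq_fun do rewrite mxE.
  have ci : (edot (z t) p)^-1 @[t --> F] --> (edot x p)^-1.
    exact: (@cvgV R T F FF (fun t => edot (z t) p) _ xp0 (ce p)).
  exact: (cvgM (ce _) ci).
have cp : proj (z t) @[t --> F] --> proj x by exact: cvg_rV.
have cu : ut (proj (z t)) @[t --> F] --> ut (proj x).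
  exact: (cvg_comp _ _ cp (smooth_on_continuous smooth_ut (I : setT (proj x)))).
split; last exact: cvgM (ce p) cu.
apply: cvgD; first exact: cvgM (cvg_cst _) cu.
apply: (cvg_big add_continuous) => j _; apply: cvgM.
  apply: cvgB; first exact: cvg_cst.
  exact: cvgM (cj j) (cvg_cst _).
exact: (cvg_comp _ _ cp (smooth_on_continuous (smooth_on_pd j smooth_ut) (I : setT (proj x)))).
Qed.

(** Summed over an orthonormal basis of the ambient space, the second derivatives give the trace of
    the Hessian of [ut], which is 0. Continuity of the first derivatives is recorded for the sake of
    strict differentiability. *)
Lemma cone_ext_C2 x : 0 < edot x p -> x = edot x p *: p ->
  exists (De : 'I_n.+1 -> 'rV[R]_n.+1 -> R) (D2 : 'I_n.+1 -> R),
  [/\ \forall z \near x, forall i, is_derive z (delta_mx 0 i) cone_ext (De i z),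
      forall i, is_derive x (delta_mx 0 i) (De i) (D2 i), \sum_i D2 i = 0,
      forall i, {for x, continuous (De i)} & {for x, continuous cone_ext}].
Proof.
move=> xp xE; have x0 : proj x = 0.
  by apply/rowP => j; rewrite !mxE xE edotZl (edotC p) Ep mulr0 mul0r.
pose d i : 'rV[R]_n.+1 := delta_mx 0 i.
exists (fun i => D (d i)), (fun i => (edot x p)^-1 *
  \sum_j \sum_k edot (d i) (row j E) * edot (d i) (row k E) * pd k (pd j ut) 0).
split.
- by apply: (near_open openH xp) => z zp i; exact: is_derive_cone.
- by move=> i; exact: is_derive_D.
- rewrite -mulr_sumr (@sum_orthonormal_columns _ _ _ (fun i j => edot (d i) (row j E))
    (fun k j => pd k (pd j ut) 0)); first by rewrite trace_ut0 mulr0.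
  move=> j k; rewrite -(frame_edot_row EE); apply: eq_bigr => i _.
  by rewrite !(edotC (d i)) !edot_delta.
- move=> i; exact: (cvg_D (nbhs_filter x) (d i) (@cvg_id _ (nbhs x)) xp).1.
- have := (cvg_D (nbhs_filter x) 0 (@cvg_id _ (nbhs x)) xp).2.
  apply: (continuous_near_open openH xp) => z zp /=.
  by rewrite cone_ext_gnomonic.
Qed.

End Frame.

End ConicalExtension.

(** * Eigenfunctions are linear forms *)

Section EigenfunctionLinear.
Context {R : realType} {n : nat}.
Variable f : 'rV[R]_n.+1 -> R.
Hypotheses (fS : smooth_fun f)
  (fE : forall U phi, local_coord U phi -> forall x : 'rV[R]_n, U x ->
     laplacian (round_metric phi) (f \o phi) x = - n%:R * f (phi x))
  (f1 : forall p, sphere p -> `|f p| < 1).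

Let u := cone_ext f.

Lemma cone_ext_C2_punctured x : x != 0 ->
  exists (De : 'I_n.+1 -> 'rV[R]_n.+1 -> R) (D2 : 'I_n.+1 -> R),
  [/\ \forall z \near x, forall i, is_derive z (delta_mx 0 i) u (De i z),
      forall i, is_derive x (delta_mx 0 i) (De i) (D2 i), \sum_i D2 i = 0,
      forall i, {for x, continuous (De i)} & {for x, continuous u}].
Proof.
move=> x0; have ex0 : 0 < enorm x by rewrite enorm_gt0.
pose p := (enorm x)^-1 *: x.
have p1 : edot p p = 1.
  by apply/enorm1P; rewrite enormZ ger0_norm ?invr_ge0 ?ltW // mulVf // gt_eqF.
have [E EE Ep] := orthonormal_frame p1.
have xp : edot x p = enorm x.
  by rewrite edotZr -enorm_sqr expr2 mulKf // gt_eqF.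
apply: (cone_ext_C2 fS fE p1 EE Ep); rewrite xp //.
by rewrite scalerA mulfV ?scale1r // gt_eqF.
Qed.

Lemma cone_ext_continuous : continuous u.
Proof.
move=> x; have [->|/cone_ext_C2_punctured[_ [_ [_ _ _ _]]] //] := eqVneq x 0.
have u0 : u 0 = 0 by rewrite /u /cone_ext /enorm edot0l sqrtr0 mul0r.
apply: (@cvgrPdist_lt _ _ _ (nbhs (0 : 'rV[R]_n.+1)) _ u (u 0)).2 => e e0.
have := @continuous_enorm R n.+1 0.
move=> /(@cvgrPdist_lt _ _ _ (nbhs (0 : 'rV[R]_n.+1)) _ _ _).1 /(_ e e0).
apply: filterS => z; rewrite u0 !sub0r !normrN {1}/enorm edot0l sqrtr0 sub0r normrN.
rewrite (ger0_norm (enorm_ge0 z)).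
exact: le_lt_trans (cone_ext_bound f1 z).
Qed.

Let K := [set x : 'rV[R]_n.+1 | enorm x <= 1] `&` [set x | 1 <= enorm x].

Let compact_K : compact K.
Proof.
apply: compact_closedI; first exact: compact_enorm_ball.
apply: (@closed_comp _ _ (@enorm R n.+1) [set y : R | 1 <= y]); last exact: closed_ge.
by move=> x _; exact: continuous_enorm.
Qed.

(** Around each point of the sphere strict differentiability holds with constants valid nearby. The
    linear parts of the two increments in the second difference cancel, and compactness yields a
    single [d]. *)
Lemma cone_ext_uniform e : 0 < e -> exists2 d, 0 < d & forall x k,
  enorm x = 1 -> `|k| < d -> `|u (x + k) + u (x - k) - 2 * u x| <= e * `|k|.
Proof.
move=> e0; have e2 : 0 < e / 2 by rewrite divr_gt0.
pose P (d : R) (x : 'rV[R]_n.+1) := forall k : 'rV[R]_n.+1, `|k| < d ->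
  `|u (x + k) + u (x - k) - 2 * u x| <= e * `|k|.
have loc x : K x -> \forall x' \near x & d \near (0 : R)^'+, P d x'.
  move=> [/= _ x1]; have x0 : x != 0.
    by rewrite -enorm_gt0 (lt_le_trans ltr01).
  have [De [D2 [uD _ _ Dc _]]] := cone_ext_C2_punctured x0.
  have [r r0 strict] := strict_differentiability uD Dc e2.
  have r2 : 0 < r / 2 by rewrite divr_gt0.
  exists ([set x' : 'rV[R]_n.+1 | `|x - x'| < r / 2], [set d : R | d < r / 2]).
    split => /=.
      by apply/nbhs_ballP; exists (r / 2) => //= y; rewrite -ball_normE.
    exact: nbhs_right_lt.
  move=> [x' d] /= [xx' dr] k kd.
  have kr : `|k| < r / 2 by exact: lt_trans dr.
  have bd s : `|s| < r / 2 -> `|x - (x' + s)| < r.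
    move=> sr; rewrite opprD addrA; apply: le_lt_trans (ler_normB _ _) _.
    by rewrite (splitr r) ltrD.
  have xr : `|x - x'| < r by rewrite -[x']addr0 bd // normr0.
  have B1 := strict (x' + k) x' (bd _ kr) xr.
  have krN : `|- k| < r / 2 by rewrite normrN.
  have B2 := strict x' (x' - k) xr (bd _ krN).
  have S1 : \sum_i ((x' + k) 0 i - x' 0 i) * De i x = \sum_i k 0 i * De i x.
    by apply: eq_bigr => i _; rewrite !mxE; ring.
  have S2 : \sum_i (x' 0 i - (x' - k) 0 i) * De i x = \sum_i k 0 i * De i x.
    by apply: eq_bigr => i _; rewrite !mxE; ring.
  move: B1 B2; rewrite S1 S2 opprB addrCA subrr addr0 [x' + k - x']addrAC subrr add0r.
  set S := \sum_i _ => B1 B2.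
  rewrite (_ : _ - 2 * u x' = (u (x' + k) - u x' - S) - (u x' - u (x' - k) - S)); last by ring.
  apply: le_trans (ler_normB _ _) _.
  by apply: le_trans (lerD B1 B2) _; rewrite -mulrDl -splitr.
have := (compact_near_coveringP K).1 compact_K _ _ P _ loc.
move=> near0; have [d [d0 dP]] : exists d, 0 < d /\ K `<=` P d.
  by near (0 : R)^'+ => d; exists d; split; near: d; [exact: nbhs_right_gt|exact: near0].
exists d => // x k x1 kd; apply: dP => //.
by split; rewrite /= x1.
Unshelve. all: by end_near. Qed.

(** By homogeneity the second difference at [x] with step [h] is |x| times the one at x / |x| with
    step h / |x|, hence at most a small multiple of |h|. *)
Lemma cone_ext_decay h e : 0 < e -> exists r, forall x, r <= enorm x ->
  `|u (x + h) + u (x - h) - 2 * u x| <= e.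
Proof.
move=> e0; pose M := `|h| + 1; have M0 : 0 < M by rewrite ltr_wpDl.
have [d d0 dP] := cone_ext_uniform (divr_gt0 e0 M0).
exists (M / d) => x xr; have rp : 0 < enorm x by apply: lt_le_trans xr; rewrite divr_gt0.
set r := enorm x in xr rp.
have hM : `|h| < M by rewrite ltrDl.
have kd : `|r^-1 *: h| < d.
  rewrite normrZ gtr0_norm ?invr_gt0 // mulrC ltr_pdivrMr //.
  by apply: lt_le_trans hM _; rewrite mulrC -ler_pdivrMr.
have x1 : enorm (r^-1 *: x) = 1.
  by rewrite enormZ gtr0_norm ?invr_gt0 // mulVf // gt_eqF.
have rK y : y = r *: (r^-1 *: y) :> 'rV[R]_n.+1.
  by rewrite scalerA mulfV ?scale1r // gt_eqF.
have ur (y : 'rV[R]_n.+1) : u y = r * u (r^-1 *: y).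
  by rewrite -[u (_ *: _)]/(cone_ext f _) cone_ext_homog ?invr_gt0 // mulVKf // gt_eqF.
rewrite (ur (x + h)) (ur (x - h)) (ur x) scalerDr scalerBr.
rewrite (_ : _ - _ = r * (u (r^-1 *: x + r^-1 *: h) + u (r^-1 *: x - r^-1 *: h) -
  2 * u (r^-1 *: x))); last by ring.
rewrite normrM gtr0_norm //.
apply: le_trans (ler_wpM2l (ltW rp) (dP _ _ x1 kd)) _.
rewrite normrZ gtr0_norm ?invr_gt0 //.
have -> : r * (e / M * (r^-1 * `|h|)) = e / M * `|h| by field; rewrite !gt_eqF.
by apply: le_trans (ler_wpM2l _ (ltW hM)) _; rewrite ?divfK ?gt_eqF // ltW // divr_gt0.
Qed.

(** The bound on [n] makes the ambient dimension [n.+1] at least 3, as the barrier argument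
    demands. *)
Lemma eigenfunction_linear : (2 <= n)%N ->
  exists a : 'rV[R]_n.+1, forall p, sphere p -> f p = edot a p.
Proof.
move=> n2; exists (\row_i u (delta_mx 0 i)) => p sp.
rewrite -(cone_ext_sphere f sp); apply: harmonic_cone_linear => //.
- exact: cone_ext_continuous.
- move=> x x0; have [De [D2 [uD DD2 D20 _ _]]] := cone_ext_C2_punctured x0.
  by exists De, D2.
- by move=> c x c0; exact: cone_ext_homog.
- by move=> h e; exact: cone_ext_decay.
Qed.

End EigenfunctionLinear.

(** * The Randers metric in a chart *)

(* An opaque copy of pd: unification would otherwise unfold two distinct partial
   derivatives into limits before concluding that they differ. *)
Fact pd_sealed (R : realType) n (V : normedModType R) :
  {D : 'I_n -> ('rV[R]_n -> V) -> 'rV[R]_n -> V | D = pd}.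
Proof. by exists pd. Qed.

Definition dpd {R : realType} {n} {V : normedModType R} :=
  proj1_sig (@pd_sealed R n V).

Lemma dpdE (R : realType) n (V : normedModType R) : @dpd R n V = pd.
Proof. exact: (proj2_sig (@pd_sealed R n V)). Qed.

(** * Derivatives of a chart of the sphere as ambient vectors *)

Section ChartCalculus.
Context {R : realType} {n : nat}.
Variable phi : 'rV[R]_n -> 'rV[R]_n.+1.
Implicit Types x y : 'rV[R]_n.

Definition vel x y := \sum_j y 0 j *: dpd j phi x.

Definition dvel k x y := \sum_j y 0 j *: dpd k (dpd j phi) x.

Definition ddvel l k x y := \sum_j y 0 j *: dpd l (dpd k (dpd j phi)) x.

(* vel x y, acc x y and jerk k x y are the values at y of D phi, of the
   quadratic form D^2 phi and of its derivative along the k-th coordinate. *)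
Definition acc x y := \sum_k y 0 k *: dvel k x y.

Definition jerk k x y := \sum_m y 0 m *: ddvel k m x y.

Variable U : set 'rV[R]_n.
Hypothesis phiU : local_coord U phi.

Lemma local_coord_open : open U. Proof. by case: phiU. Qed.
Lemma local_coord_smooth : smooth_on U phi. Proof. by case: phiU. Qed.
Let oU := local_coord_open.
Let sphi := local_coord_smooth.

Lemma local_coord_sphere x : U x -> edot (phi x) (phi x) = 1.
Proof. by case: phiU => _ _ /(_ x) h _ _ /h /enorm1P. Qed.

Lemma is_derive_pd j k x : U x ->
  is_derive x (delta_mx 0 k) (dpd j phi) (dpd k (dpd j phi) x).
Proof. by rewrite !dpdE => Ux; exact: smooth_on_is_derive k (smooth_on_pd j sphi) Ux. Qed.

Lemma is_derive_pd2 i j k x : U x ->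
  is_derive x (delta_mx 0 k) (dpd i (dpd j phi)) (dpd k (dpd i (dpd j phi)) x).
Proof.
by rewrite !dpdE => Ux; exact: smooth_on_is_derive k (smooth_on_pd i (smooth_on_pd j sphi)) Ux.
Qed.

Lemma is_derive_phi k x : U x -> is_derive x (delta_mx 0 k) phi (dpd k phi x).
Proof. by rewrite dpdE => Ux; exact: smooth_on_is_derive k sphi Ux. Qed.

Lemma pd_phiC i j x : U x -> dpd i (dpd j phi) x = dpd j (dpd i phi) x.
Proof. by rewrite !dpdE => Ux; exact: (smooth_on_pdC_rV oU i j sphi Ux). Qed.

Lemma edot_pd_phi j x : U x -> edot (dpd j phi x) (phi x) = 0.
Proof.
move=> Ux; have d := is_derive_edot (is_derive_phi j Ux) (is_derive_phi j Ux).
have := is_derive_near oU Ux (fun z Uz => local_coord_sphere Uz) d.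
move/is_derive_val; rewrite (is_derive_val (is_derive_const (1 : R) x _)).
rewrite (edotC (phi x)); lra.
Qed.

(** The second fundamental form of the unit sphere, found by differentiating the orthogonality of
    [phi] and its derivatives. *)
Lemma edot_pd2_phi k j x : U x ->
  edot (dpd k (dpd j phi) x) (phi x) = - edot (dpd j phi x) (dpd k phi x).
Proof.
move=> Ux; have d := is_derive_edot (is_derive_pd j k Ux) (is_derive_phi k Ux).
have := is_derive_near oU Ux (fun z Uz => edot_pd_phi j Uz) d.
move/is_derive_val; rewrite (is_derive_val (is_derive_const (0 : R) x _)); lra.
Qed.

Lemma edot_vel_phi x y : U x -> edot (vel x y) (phi x) = 0.
Proof.
move=> Ux; rewrite edot_suml big1 // => j _.
by rewrite edotZl edot_pd_phi ?mulr0.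
Qed.

Lemma edot_acc_phi x y : U x -> edot (acc x y) (phi x) = - edot (vel x y) (vel x y).
Proof.
move=> Ux; rewrite [X in - edot _ X]/vel edot_sumr edot_suml -sumrN.
apply: eq_bigr => k _; rewrite edotZl edotZr -mulrN; congr (_ * _).
rewrite /dvel /vel !edot_suml -sumrN; apply: eq_bigr => j _.
by rewrite !edotZl edot_pd2_phi // mulrN.
Qed.

Lemma is_derive_vel_x k x y : U x ->
  is_derive x (delta_mx 0 k) (fun z => vel z y) (dvel k x y).
Proof.
move=> Ux; apply: is_derive_bigsum => j _.
apply: is_derive_eq (is_derive_scale (is_derive_const (y 0 j) x (delta_mx 0 k))
  (is_derive_pd j k Ux)) _.
by rewrite scale0r add0r.
Qed.

Lemma is_derive_dvel_x l k x y : U x ->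
  is_derive x (delta_mx 0 l) (fun z => dvel k z y) (ddvel l k x y).
Proof.
move=> Ux; apply: is_derive_bigsum => j _.
apply: is_derive_eq (is_derive_scale (is_derive_const (y 0 j) x (delta_mx 0 l))
  (is_derive_pd2 k j l Ux)) _.
by rewrite scale0r add0r.
Qed.

Lemma is_derive_acc_x k x y : U x ->
  is_derive x (delta_mx 0 k) (fun z => acc z y) (jerk k x y).
Proof.
move=> Ux; apply: is_derive_bigsum => j _.
apply: is_derive_eq (is_derive_scale (is_derive_const (y 0 j) x (delta_mx 0 k))
  (is_derive_dvel_x k j y Ux)) _.
by rewrite scale0r add0r.
Qed.

Lemma is_derive_linear_sum m (c : 'I_n -> 'rV[R]_m) y l :
  is_derive y (delta_mx 0 l) (fun z : 'rV[R]_n => \sum_j z 0 j *: c j) (c l).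
Proof.
have d := @is_derive_bigsum R _ _ _ (index_enum _) predT
  (fun j (z : 'rV[R]_n) => z 0 j *: c j) y (delta_mx 0 l) _
  (fun j _ => is_derive_scale (is_derive_coord j (is_derive_id y (delta_mx 0 l)))
    (is_derive_const (c j) y (delta_mx 0 l))).
apply: is_derive_eq d _.
rewrite (bigD1 l) //= big1 ?addr0 => [|j jl].
  by rewrite scaler0 addr0 mxE !eqxx scale1r.
by rewrite scaler0 addr0 mxE (negbTE jl) andbF scale0r.
Qed.

Lemma is_derive_vel_y l x y : is_derive y (delta_mx 0 l) (vel x) (dpd l phi x).
Proof. exact: (is_derive_linear_sum (fun j => dpd j phi x)). Qed.

Lemma is_derive_dvel_y l k x y :
  is_derive y (delta_mx 0 l) (dvel k x) (dpd k (dpd l phi) x).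
Proof. exact: (is_derive_linear_sum (fun j => dpd k (dpd j phi) x)). Qed.

Lemma sum_pd2 l x y : U x -> \sum_k y 0 k *: dpd k (dpd l phi) x = dvel l x y.
Proof. by move=> Ux; apply: eq_bigr => k _; rewrite pd_phiC. Qed.

Lemma sum_ddvel k x y : U x -> \sum_j y 0 j *: ddvel j k x y = jerk k x y.
Proof.
move=> Ux; have E j : ddvel j k x y = ddvel k j x y.
  rewrite /ddvel; apply: eq_bigr => m _.
  by rewrite !dpdE (smooth_on_pdC_rV oU j k (smooth_on_pd m sphi) Ux).
by rewrite /jerk; apply: eq_bigr => j _; rewrite E.
Qed.

Lemma is_derive_acc_y l x y : U x ->
  is_derive y (delta_mx 0 l) (acc x) (2 *: dvel l x y).
Proof.
move=> Ux; have d := @is_derive_bigsum R _ _ _ (index_enum _) predT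
  (fun k y => y 0 k *: dvel k x y) y (delta_mx 0 l) _
  (fun k _ => is_derive_scale (is_derive_coord k (is_derive_id y (delta_mx 0 l)))
    (is_derive_dvel_y l k x y)).
apply: is_derive_eq d _; rewrite big_split /= sum_pd2 // (bigD1 l) //= big1 ?addr0.
  by rewrite mxE !eqxx scale1r scaler_nat mulr2n.
by move=> j jl; rewrite mxE (negbTE jl) andbF scale0r.
Qed.

Definition jac x : 'M[R]_(n, n.+1) := \matrix_(i < n) dpd i phi x.

Lemma row_jac i x : row i (jac x) = dpd i phi x. Proof. exact: rowK. Qed.

Lemma jac_free x : U x -> row_free (jac x).
Proof. by case: phiU => _ _ _ _ /(_ x); rewrite /jac dpdE. Qed.

Lemma vel_jac x y : vel x y = y *m jac x.
Proof. by rewrite row_mul_sum; apply: eq_bigr => i _; rewrite row_jac. Qed.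

Lemma vel_inj x y z : U x -> vel x y = vel x z -> y = z.
Proof. by move=> Ux; rewrite !vel_jac => /(row_free_inj (jac_free Ux)). Qed.

Lemma vel0 x : vel x 0 = 0.
Proof. by rewrite vel_jac mul0mx. Qed.

Lemma vel_eq0 x y : U x -> (vel x y == 0) = (y == 0).
Proof.
move=> Ux; apply/eqP/eqP => [|->]; last exact: vel0.
by rewrite -(vel0 x) => /(vel_inj Ux).
Qed.

Lemma velD x y z : vel x (y + z) = vel x y + vel x z.
Proof. by rewrite !vel_jac mulmxDl. Qed.

Lemma velZ x c y : vel x (c *: y) = c *: vel x y.
Proof. by rewrite !vel_jac -scalemxAl. Qed.

Lemma round_metric_jac x : round_metric phi x = jac x *m (jac x)^T.
Proof.
apply/matrixP => i j; rewrite !mxE -dpdE -!row_jac.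
by apply: eq_bigr => k _; rewrite !mxE.
Qed.

Lemma round_metric_unit x : U x -> round_metric phi x \in unitmx.
Proof. by move=> Ux; rewrite round_metric_jac; exact: gram_unit (jac_free Ux). Qed.

Lemma chart_complete x (u v : 'rV[R]_n.+1) : U x ->
  edot u v = edot u (phi x) * edot v (phi x) +
  \sum_i \sum_j invmx (round_metric phi x) i j * edot u (dpd i phi x) * edot v (dpd j phi x).
Proof.
move=> Ux; have Jp i : edot (row i (jac x)) (phi x) = 0 by rewrite row_jac edot_pd_phi.
rewrite (frame_complete (local_coord_sphere Ux) Jp (jac_free Ux)) -round_metric_jac.
by congr (_ + _); apply: eq_bigr => i _; apply: eq_bigr => j _; rewrite !row_jac.
Qed.

Lemma edot_ext m (u v : 'rV[R]_m) : (forall w, edot w u = edot w v) -> u = v.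
Proof. by move=> uv; apply/rowP => i; rewrite -!edot_delta !(edotC _ (delta_mx _ _)) uv. Qed.

(** Raising an index with the inverse metric and pushing forward amounts to orthogonal projection
    onto the tangent space. This is what removes the inverse metric from the spray and the
    curvature. *)
Lemma tangent_decomp x (v : 'rV[R]_n.+1) : U x ->
  \sum_i (\sum_l invmx (round_metric phi x) i l * edot v (dpd l phi x)) *: dpd i phi x =
  v - edot v (phi x) *: phi x.
Proof.
move=> Ux; apply: edot_ext => w; rewrite edotBr edotZr (chart_complete w v Ux).
rewrite (mulrC (edot v _) (edot w _)) addrAC subrr add0r edot_sumr.
apply: eq_bigr => i _; rewrite edotZr mulr_suml; apply: eq_bigr => l _.
exact: mulrAC.
Qed.

End ChartCalculus.

(** * The Randers function of a linear form and its derivatives *)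

Section RandersLagrangian.
Context {R : realType} {n : nat}.
Variable a : 'rV[R]_n.+1.
Hypothesis a1 : edot a a < 1.
Implicit Types p v : 'rV[R]_n.+1.

(* sin (arccos <a, p>) *)
Definition cosine_sin p : R := Num.sqrt (1 - edot a p ^+ 2).

Lemma edot_sphere_lt1 p : edot p p = 1 -> edot a p ^+ 2 < 1.
Proof.
by move=> p1; apply: le_lt_trans (edot_gram_ge0 a p) _; rewrite p1 mulr1.
Qed.

Lemma cosine_sin_gt0 p : edot p p = 1 -> 0 < cosine_sin p.
Proof. by move=> p1; rewrite sqrtr_gt0 subr_gt0 edot_sphere_lt1. Qed.

Lemma cosine_sin_sqr p : edot p p = 1 -> cosine_sin p ^+ 2 = 1 - edot a p ^+ 2.
Proof. by move=> p1; rewrite sqr_sqrtr // subr_ge0 ltW // edot_sphere_lt1. Qed.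

(** Cauchy-Schwarz for the tangential part of [a]. It bounds the 1-form here and the flag curvature
    later. *)
Lemma bessel p v : edot p p = 1 -> edot v p = 0 ->
  edot a v ^+ 2 <= (edot a a - edot a p ^+ 2) * edot v v.
Proof.
move=> p1 vp; have := edot_gram_ge0 (a - edot a p *: p) v.
rewrite !(edotBl, edotBr, edotZl, edotZr) (edotC p v) vp (edotC p a) p1 => h.
apply: le_trans (le_trans _ h) _; rewrite le_eqVlt; apply/orP; left; apply/eqP; ring.
Qed.

(** By [bessel] the squared norm of the 1-form is at most the quotient of [edot a a - c ^+ 2] by
    [1 - c ^+ 2], with [c = edot a p], and [edot a a] is less than 1. *)
Lemma randers_form_lt p v : edot p p = 1 -> edot v p = 0 -> v != 0 ->
  `|edot a v / cosine_sin p| < enorm v.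
Proof.
move=> p1 vp v0; have s0 := cosine_sin_gt0 p1.
rewrite normrM normfV (gtr0_norm s0) ltr_pdivrMr //.
rewrite -(@ltr_pXn2r _ 2) ?nnegrE ?mulr_ge0 ?enorm_ge0 ?(ltW s0) //.
rewrite real_normK ?num_real // exprMn enorm_sqr cosine_sin_sqr //.
apply: le_lt_trans (bessel p1 vp) _; rewrite mulrC ltr_pM2l ?edot_gt0 //.
by rewrite ltrD2r.
Qed.

Lemma is_derive_cosine_sin (V : normedModType R) (g : V -> 'rV[R]_n.+1) (x v : V) d :
  edot (g x) (g x) = 1 -> is_derive x v g d ->
  is_derive x v (fun z => cosine_sin (g z))
    (- (edot a (g x) * edot a d / cosine_sin (g x))).
Proof.
move=> g1 gd; have s0 : 0 < 1 - edot a (g x) ^+ 2 by rewrite subr_gt0 edot_sphere_lt1.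
have df := is_derive_edot (is_derive_const a x v) gd.
apply: is_derive_eq (@is_derive_sqrtr R V (fun z => 1 - edot a (g z) * edot a (g z)) x v _ s0
  (is_derive_sub (is_derive_const (1 : R) x v) (is_derive_mul df df))) _.
have : cosine_sin (g x) != 0 by rewrite gt_eqF // cosine_sin_gt0.
rewrite edot0l add0r -expr2 -/(cosine_sin (g x)).
by move: (cosine_sin _) (edot a _) (edot a _) => s f h s1; field.
Qed.

Lemma is_derive_cosine_sin_inv (V : normedModType R) (g : V -> 'rV[R]_n.+1) (x v : V) d :
  edot (g x) (g x) = 1 -> is_derive x v g d ->
  is_derive x v (fun z => (cosine_sin (g z))^-1)
    (edot a (g x) * edot a d / cosine_sin (g x) ^+ 3).
Proof.
move=> g1 gd; have s0 : cosine_sin (g x) != 0 by rewrite gt_eqF // cosine_sin_gt0.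
apply: is_derive_eq (@is_derive_invr R V (fun z => cosine_sin (g z)) x v _ s0
  (is_derive_cosine_sin g1 gd)) _.
by move: s0; move: (cosine_sin _) (edot a _) (edot a _) => s f h s1; field.
Qed.

Variables (phi : 'rV[R]_n -> 'rV[R]_n.+1) (U : set 'rV[R]_n).
Hypothesis phiU : local_coord U phi.
Implicit Types x y : 'rV[R]_n.

Local Notation vel := (vel phi).
Local Notation dvel := (dvel phi).
Local Notation cf x := (edot a (phi x)).
Local Notation sn x := (cosine_sin (phi x)).
Local Notation nv x y := (enorm (vel x y)).

Definition randers_lag x y := nv x y - edot a (vel x y) / sn x.

Local Notation lag := randers_lag.

(* The derivatives of randers_lag are <lag_y, d phi> along y and
   <lag_y, d vel> + <lag_x, d phi> along x; lag_yy l and lag_xy l are the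
   derivatives of lag_y and lag_x along the l-th component of y. *)
Definition lag_y x y := (nv x y)^-1 *: vel x y - (sn x)^-1 *: a.
Definition lag_x x y := - (edot a (vel x y) * cf x / sn x ^+ 3) *: a.
Definition lag_yy l x y := (nv x y)^-1 *: dpd l phi x -
  (edot (vel x y) (dpd l phi x) / nv x y ^+ 3) *: vel x y.
Definition lag_xy l x := - (edot a (dpd l phi x) * cf x / sn x ^+ 3) *: a.

Lemma sn_gt0 x : U x -> 0 < sn x.
Proof. by move=> Ux; exact: cosine_sin_gt0 (local_coord_sphere phiU Ux). Qed.

Lemma sn_sqr x : U x -> sn x ^+ 2 = 1 - cf x ^+ 2.
Proof. by move=> Ux; exact: cosine_sin_sqr (local_coord_sphere phiU Ux). Qed.

Lemma nv_gt0 x y : U x -> y != 0 -> 0 < nv x y.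
Proof. by move=> Ux y0; rewrite enorm_gt0 (vel_eq0 phiU). Qed.

Lemma lag_gt0 x y : U x -> y != 0 -> 0 < lag x y.
Proof.
move=> Ux y0; rewrite subr_gt0; apply: le_lt_trans (ler_norm _) _.
apply: randers_form_lt; rewrite ?(vel_eq0 phiU) ?(edot_vel_phi phiU) //.
exact: local_coord_sphere phiU x Ux.
Qed.

Lemma is_derive_enorm (V : normedModType R) m (g : V -> 'rV[R]_m) (x v : V) d : g x != 0 ->
  is_derive x v g d ->
  is_derive x v (fun z => enorm (g z)) (edot (g x) d / enorm (g x)).
Proof.
move=> gx gd; have g0 : 0 < edot (g x) (g x) by rewrite edot_gt0.
have e0 : enorm (g x) != 0 by rewrite enorm_eq0.
apply: is_derive_eq (@is_derive_sqrtr R V (fun z => edot (g z) (g z)) x v _ g0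
  (is_derive_edot gd gd)) _.
by rewrite (edotC d) -/(enorm (g x)); field.
Qed.

Lemma is_derive_nv_x k x y : U x -> y != 0 -> is_derive x (delta_mx 0 k)
  (fun z => nv z y) (edot (vel x y) (dvel k x y) / nv x y).
Proof.
move=> Ux y0; apply: (is_derive_enorm (g := fun z => vel z y)).
  by rewrite (vel_eq0 phiU).
refine (is_derive_vel_x phiU k y Ux).
Qed.

Lemma is_derive_nv_y l x y : U x -> y != 0 -> is_derive y (delta_mx 0 l)
  (fun z => nv x z) (edot (vel x y) (dpd l phi x) / nv x y).
Proof.
move=> Ux y0; apply: (is_derive_enorm (g := vel x)).
  by rewrite (vel_eq0 phiU).
exact: is_derive_vel_y.
Qed.

Lemma is_derive_cf k x : U x ->
  is_derive x (delta_mx 0 k) (fun z => cf z) (edot a (dpd k phi x)).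
Proof.
move=> Ux; apply: is_derive_eq (is_derive_edot (is_derive_const a x _)
  (is_derive_phi phiU k Ux)) _.
by rewrite edot0l add0r.
Qed.

Lemma is_derive_sn k x : U x -> is_derive x (delta_mx 0 k) (fun z => sn z)
  (- (cf x * edot a (dpd k phi x) / sn x)).
Proof.
move=> Ux; exact: is_derive_cosine_sin (local_coord_sphere phiU Ux) (is_derive_phi phiU k Ux).
Qed.

Lemma is_derive_sn_inv k x : U x -> is_derive x (delta_mx 0 k) (fun z => (sn z)^-1)
  (cf x * edot a (dpd k phi x) / sn x ^+ 3).
Proof.
move=> Ux; exact: is_derive_cosine_sin_inv (local_coord_sphere phiU Ux) (is_derive_phi phiU k Ux).
Qed.

Lemma is_derive_edota_y l x y :
  is_derive y (delta_mx 0 l) (fun z => edot a (vel x z)) (edot a (dpd l phi x)).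
Proof.
apply: is_derive_eq (is_derive_edot (is_derive_const a y _) (is_derive_vel_y phi l x y)) _.
by rewrite edot0l add0r.
Qed.

Lemma is_derive_edota_x k x y : U x ->
  is_derive x (delta_mx 0 k) (fun z => edot a (vel z y)) (edot a (dvel k x y)).
Proof.
move=> Ux; apply: is_derive_eq (is_derive_edot (is_derive_const a x _)
  (is_derive_vel_x phiU k y Ux)) _.
by rewrite edot0l add0r.
Qed.

Lemma is_derive_lag_x k x y : U x -> y != 0 ->
  is_derive x (delta_mx 0 k) (fun z => lag z y)
    (edot (lag_y x y) (dvel k x y) + edot (lag_x x y) (dpd k phi x)).
Proof.
move=> Ux y0; apply: is_derive_eq (is_derive_sub (is_derive_nv_x k Ux y0)
  (is_derive_mul (is_derive_edota_x k y Ux) (is_derive_sn_inv k Ux))) _.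
rewrite /lag_y /lag_x edotBl !edotZl.
set s := sn x; set c := edot a _; set c' := edot a _; set c3 := edot a _; set c4 := edot a _.
rewrite -!exprVn; ring.
Qed.

Lemma is_derive_lag_y l x y : U x -> y != 0 ->
  is_derive y (delta_mx 0 l) (lag x) (edot (lag_y x y) (dpd l phi x)).
Proof.
move=> Ux y0; apply: is_derive_eq (is_derive_sub (is_derive_nv_y l Ux y0)
  (is_derive_mul (is_derive_edota_y l x y) (is_derive_const (sn x)^-1 y _))) _.
rewrite /lag_y edotBl !edotZl mulr0 addr0.
by rewrite [X in X - _ = _]mulrC [X in _ - X = _]mulrC.
Qed.

Lemma is_derive_nv_inv_y l x y : U x -> y != 0 ->
  is_derive y (delta_mx 0 l) (fun z => (nv x z)^-1)
    (- (edot (vel x y) (dpd l phi x) / nv x y ^+ 3)).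
Proof.
move=> Ux y0; have r0 : nv x y != 0 by rewrite gt_eqF // nv_gt0.
apply: is_derive_eq (@is_derive_invr R _ (fun z => nv x z) y _ _ r0 (is_derive_nv_y l Ux y0)) _.
by set r := nv x y in r0 *; set c := edot _ _; field.
Qed.

Lemma is_derive_lag_yy l x y : U x -> y != 0 ->
  is_derive y (delta_mx 0 l) (lag_y x) (lag_yy l x y).
Proof.
move=> Ux y0; apply: is_derive_eq (is_derive_sub
  (is_derive_scale (is_derive_nv_inv_y l Ux y0) (is_derive_vel_y phi l x y))
  (is_derive_const ((sn x)^-1 *: a) y _)) _.
by rewrite subr0 scaleNr addrC.
Qed.

Lemma is_derive_lag_xy l x y : is_derive y (delta_mx 0 l) (lag_x x) (lag_xy l x).
Proof.
have d := is_derive_mul (is_derive_edota_y l x y) (is_derive_const (- (cf x / sn x ^+ 3)) y (delta_mx 0 l)).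
have := is_derive_scale d (is_derive_const a y (delta_mx 0 l)).
have -> : (fun z => (edot a (vel x z) * - (cf x / sn x ^+ 3)) *: a) = lag_x x.
  by apply/funext => z; rewrite /lag_x mulrN mulrA.
move=> h; apply: is_derive_eq h _.
by rewrite scaler0 addr0 mulr0 addr0 /lag_xy mulrN mulrA.
Qed.

End RandersLagrangian.

(** * Fundamental tensor and spray *)

Section RandersSpray.
Context {R : realType} {n : nat}.
Variable a : 'rV[R]_n.+1.
Hypothesis a1 : edot a a < 1.
Variables (phi : 'rV[R]_n -> 'rV[R]_n.+1) (U : set 'rV[R]_n).
Hypothesis phiU : local_coord U phi.
Variable Lf : 'rV[R]_n -> 'rV[R]_n -> R.
Hypothesis LfE : forall x y, U x -> Lf x y = randers_lag a phi x y.
Implicit Types x y : 'rV[R]_n.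

Local Notation vel := (vel phi).
Local Notation dvel := (dvel phi).
Local Notation acc := (acc phi).
Local Notation cf x := (edot a (phi x)).
Local Notation sn x := (cosine_sin a (phi x)).
Local Notation nv x y := (enorm (vel x y)).
Local Notation oU := (local_coord_open phiU).
Local Notation lag := (randers_lag a phi).
Local Notation lag_x := (lag_x a phi).
Local Notation lag_y := (lag_y a phi).
Local Notation lag_xy := (lag_xy a phi).

Lemma open_neq0 m : open [set y : 'rV[R]_m | y != 0].
Proof.
have -> : [set y : 'rV[R]_m | y != 0] = [set y | 0 < edot y y].
  by apply/seteqP; split => y /=; rewrite edot_gt0.
apply: (@open_comp _ _ (fun z : 'rV[R]_m => edot z z) [set t : R | 0 < t]); last exact: open_gt.
by move=> z _; apply: (cvg_edot (nbhs_filter z)); exact: cvg_id.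
Qed.

(** The Hessian of the Euclidean norm at [vel x y]. It is also the Hessian of the Randers function
    in the fibre, whose 1-form part is linear. *)
Definition norm_hess x y (u w : 'rV[R]_n.+1) :=
  edot u w / nv x y - edot (vel x y) u * edot (vel x y) w / nv x y ^+ 3.

Lemma edot_lag_yy l x y w : edot (lag_yy phi l x y) w = norm_hess x y (dpd l phi x) w.
Proof.
rewrite /lag_yy edotBl !edotZl /norm_hess mulrC; congr (_ - _).
by rewrite mulrAC.
Qed.

Lemma norm_hessC x y u w : norm_hess x y u w = norm_hess x y w u.
Proof. by rewrite /norm_hess (edotC u w) (mulrC (edot (vel x y) u)). Qed.

Lemma fund_tensor_lag x y i j : U x -> y != 0 ->
  fund_tensor Lf x y i j = edot (lag_y x y) (dpd i phi x) * edot (lag_y x y) (dpd j phi x) +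
    lag x y * norm_hess x y (dpd i phi x) (dpd j phi x).
Proof.
move=> Ux y0; rewrite mxE.
(* The norm is differentiable off 0 only; this set being open, the formula can be differentiated
   once more. *)
have D1 z : z != 0 -> pd i (fun y' => Lf x y' ^+ 2) z =
    2 * (lag x z * edot (lag_y x z) (dpd i phi x)).
  move=> z0; have d := is_derive_lag_y a phiU i Ux z0.
  have -> : (fun y' => Lf x y' ^+ 2) = (fun y' => lag x y' * lag x y').
    by apply/funext => z'; rewrite LfE.
  by apply: is_derive_val; apply: is_derive_eq (is_derive_mul d d) _; ring.
have d := is_derive_mul (is_derive_lag_y a phiU j Ux y0)
  (is_derive_edot (is_derive_lag_yy a phiU j Ux y0)
     (is_derive_const (dpd i phi x) y (delta_mx 0 j))).
have d2 := is_derive_mul (is_derive_const (2 : R) y (delta_mx 0 j)) d.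
have E : pd j (pd i (fun y' => Lf x y' ^+ 2)) y = _ := etrans
  (@derive_near R _ _ [set z | z != 0] _ _ y (delta_mx 0 j) (@open_neq0 n) y0 D1)
  (is_derive_val d2).
rewrite E.
rewrite mul0r add0r edot0r addr0 mulrA mulVf ?pnatr_eq0 // mul1r edot_lag_yy.
rewrite (norm_hessC _ _ (dpd j phi x)).
by rewrite (mulrC (edot (lag_y x y) (dpd j phi x)) (edot (lag_y x y) (dpd i phi x))).
Qed.

Lemma norm_hess_suml x y (c : 'I_n -> R) (v : 'I_n -> 'rV[R]_n.+1) w :
  norm_hess x y (\sum_i c i *: v i) w = \sum_i c i * norm_hess x y (v i) w.
Proof.
rewrite /norm_hess edot_suml edot_sumr !mulr_suml -sumrN -big_split /=.
by apply: eq_bigr => i _; rewrite edotZl edotZr; ring.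
Qed.

Lemma fund_form_lag x y u w : U x -> y != 0 ->
  fund_form Lf x y u w = edot (lag_y x y) (vel x u) * edot (lag_y x y) (vel x w) +
    lag x y * norm_hess x y (vel x u) (vel x w).
Proof.
move=> Ux y0; rewrite [in RHS]/vel norm_hess_suml edot_sumr mulr_suml mulr_sumr.
rewrite -big_split /=; apply: eq_bigr => i _.
rewrite norm_hessC norm_hess_suml edot_sumr !mulr_sumr -big_split /=.
apply: eq_bigr => j _; rewrite fund_tensor_lag // !edotZr norm_hessC; ring.
Qed.

Lemma edot_lag_y_vel x y : U x -> y != 0 -> edot (lag_y x y) (vel x y) = lag x y.
Proof.
move=> Ux y0; rewrite /lag_y edotBl !edotZl -enorm_sqr.
have r0 : nv x y != 0 by rewrite gt_eqF // (nv_gt0 phiU).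
rewrite /randers_lag; congr (_ - _); last exact: mulrC.
by rewrite expr2 mulKf.
Qed.

Lemma norm_hess_ge0 x y u : U x -> y != 0 -> 0 <= norm_hess x y u u.
Proof.
move=> Ux y0; have r0 := nv_gt0 phiU Ux y0.
have -> : norm_hess x y u u = (edot u u * edot (vel x y) (vel x y) - edot u (vel x y) ^+ 2) / nv x y ^+ 3.
  rewrite -(enorm_sqr (vel x y)) /norm_hess (edotC (vel x y) u); move: r0.
  set r := nv x y; set c := edot u u; set d := edot u _ => r0.
  by field; rewrite gt_eqF.
by rewrite divr_ge0 ?exprn_ge0 ?(ltW r0) // subr_ge0 edot_gram_ge0.
Qed.

Lemma norm_hess_eq0 x y u : U x -> y != 0 -> norm_hess x y u u = 0 ->
  exists c, u = c *: vel x y.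
Proof.
move=> Ux y0; have r0 := nv_gt0 phiU Ux y0 => h0.
exists (edot u (vel x y) / edot (vel x y) (vel x y)); apply: edot_gram_eq0.
  by rewrite (vel_eq0 phiU).
have : norm_hess x y u u * nv x y ^+ 3 = 0 by rewrite h0 mul0r.
rewrite -(enorm_sqr (vel x y)) /norm_hess (edotC (vel x y) u); move: r0.
set r := nv x y; set c := edot u u; set d := edot u _ => r0.
rewrite (_ : _ * _ = c * r ^+ 2 - d ^+ 2); last by field; rewrite gt_eqF.
by move/eqP; rewrite subr_eq0 => /eqP ->.
Qed.

(** If both terms vanish, the equality case of Cauchy-Schwarz makes [u] a multiple of [y]; there the
    first term is the square of that multiple of [lag x y], so the multiple is 0. *)
Lemma fund_form_gt0 x y u : U x -> y != 0 -> u != 0 -> 0 < fund_form Lf x y u u.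
Proof.
move=> Ux y0 u0; rewrite fund_form_lag // -expr2.
have L0 := lag_gt0 a1 phiU Ux y0.
have h0 := norm_hess_ge0 (vel x u) Ux y0.
rewrite lt_def addr_ge0 ?sqr_ge0 ?mulr_ge0 ?(ltW L0) // andbT.
rewrite paddr_eq0 ?sqr_ge0 ?mulr_ge0 ?(ltW L0) //.
apply/negP => /andP[]; rewrite sqrf_eq0 mulf_eq0 (gt_eqF L0) /= => e0 /eqP.
move=> /(norm_hess_eq0 Ux y0) [c uc]; move: e0.
rewrite uc edotZr edot_lag_y_vel // mulf_eq0 (gt_eqF L0) orbF => /eqP c0.
by move: uc; rewrite c0 scale0r => /eqP; rewrite (vel_eq0 phiU) // (negbTE u0).
Qed.

Lemma fund_tensor_unit x y : U x -> y != 0 -> fund_tensor Lf x y \in unitmx.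
Proof.
move=> Ux y0; rewrite -row_free_unit; apply: inj_row_free => v v0; apply/eqP.
apply: contraTT isT => vn0; have := fund_form_gt0 Ux y0 vn0.
rewrite lt_def => /andP[/negP + _]; move=> H; case: H; apply/eqP.
have E j : \sum_i v 0 i * fund_tensor Lf x y i j = 0.
  by have := congr1 (fun A : 'rV[R]_n => A 0 j) v0; rewrite !mxE.
rewrite /fund_form exchange_big /= big1 // => j _.
transitivity ((\sum_i v 0 i * fund_tensor Lf x y i j) * v 0 j).
  by rewrite mulr_suml; apply: eq_bigr => i _; rewrite (mulrC (v 0 i)).
by rewrite E mul0r.
Qed.

(** For a closed 1-form b the projective factor is r / (2 F), where r is the covariant derivative of
    b evaluated twice on the velocity v. Here r is the product of [cf / sn], of F and of |v| + <a,
    v> / [sn], so F cancels. *)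
Definition proj_factor x y :=
  cf x / (2 * sn x) * nv x y + cf x / (2 * sn x ^+ 2) * edot a (vel x y).

(** Twice the spray coefficient; the sum over [l] is the share of the round metric. *)
Definition spray2 i x y :=
  \sum_l invmx (round_metric phi x) i l * edot (acc x y) (dpd l phi x) +
  2 * proj_factor x y * y 0 i.

(** The push-forward of [spray2]: its first two terms form the tangential part of [acc]. *)
Definition spray_vec x y := acc x y + edot (vel x y) (vel x y) *: phi x +
  (2 * proj_factor x y) *: vel x y.

Lemma sum_spray2 x y : U x -> \sum_i spray2 i x y *: dpd i phi x = spray_vec x y.
Proof.
move=> Ux; under eq_bigr do rewrite /spray2 scalerDl -scalerA.
rewrite big_split /= (tangent_decomp phiU _ Ux) -scaler_sumr (edot_acc_phi phiU _ Ux).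
by rewrite scaleNr opprK.
Qed.

Lemma edot_sum_pd m (u : 'rV[R]_m) y (c : 'I_n -> 'rV[R]_m) :
  \sum_k edot u (c k) * y 0 k = edot u (\sum_k y 0 k *: c k).
Proof. by rewrite edot_sumr; apply: eq_bigr => k _; rewrite edotZr mulrC. Qed.

(** Up to the factor 2 the right side is the fundamental tensor applied to the vector of [spray2].
    Comparing the coefficients of [edot (lag_y x y) (dpd l phi x)] and of [lag x y] leaves the two
    identities [E1] and [E2]. *)
Lemma spray_rhs l x y : U x -> y != 0 ->
  \sum_k pd l (fun y' => pd k (fun x' => Lf x' y' ^+ 2) x) y * y 0 k -
    pd l (fun x' => Lf x' y ^+ 2) x =
  2 * (edot (lag_y x y) (dpd l phi x) * edot (lag_y x y) (spray_vec x y) +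
       lag x y * norm_hess x y (dpd l phi x) (spray_vec x y)).
Proof.
move=> Ux y0; have r0 := nv_gt0 phiU Ux y0; have s0 := sn_gt0 a1 phiU Ux.
have D1 k z : z != 0 -> pd k (fun x' => Lf x' z ^+ 2) x =
    2 * (lag x z * (edot (lag_y x z) (dvel k x z) + edot (lag_x x z) (dpd k phi x))).
  move=> z0; have d := is_derive_lag_x a1 phiU k Ux z0.
  apply: is_derive_val; apply: (is_derive_near oU Ux (f := fun x' => lag x' z * lag x' z)).
    by move=> w Uw; rewrite LfE.
  by apply: is_derive_eq (is_derive_mul d d) _; ring.
have D2 k : pd l (fun y' => pd k (fun x' => Lf x' y' ^+ 2) x) y =
    2 * (edot (lag_y x y) (dpd l phi x) *
         (edot (lag_y x y) (dvel k x y) + edot (lag_x x y) (dpd k phi x)) +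
       lag x y * (edot (lag_yy phi l x y) (dvel k x y) + edot (lag_y x y) (dpd k (dpd l phi) x) +
         edot (lag_xy l x) (dpd k phi x))).
  have dL := is_derive_lag_y a phiU l Ux y0.
  have d1 := is_derive_edot (is_derive_lag_yy a phiU l Ux y0) (is_derive_dvel_y phi l k x y).
  have d2 := is_derive_edot (is_derive_lag_xy a phi l x y)
    (is_derive_const (dpd k phi x) y (delta_mx 0 l)).
  have d := is_derive_mul (is_derive_const (2 : R) y (delta_mx 0 l))
    (is_derive_mul dL (is_derive_add d1 d2)).
  apply: etrans (@derive_near R _ _ [set z | z != 0] _ _ y (delta_mx 0 l) (@open_neq0 n) y0 (D1 k)) _.
  by apply: is_derive_val; apply: is_derive_eq d _; rewrite mul0r add0r edot0r addr0.
rewrite (eq_bigr _ (fun k _ => congr1 (fun t => t * y 0 k) (D2 k))) (D1 l y y0).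
have -> : \sum_k 2 * (edot (lag_y x y) (dpd l phi x) *
         (edot (lag_y x y) (dvel k x y) + edot (lag_x x y) (dpd k phi x)) +
       lag x y * (edot (lag_yy phi l x y) (dvel k x y) + edot (lag_y x y) (dpd k (dpd l phi) x) +
         edot (lag_xy l x) (dpd k phi x))) * y 0 k =
    2 * (edot (lag_y x y) (dpd l phi x) *
         (edot (lag_y x y) (acc x y) + edot (lag_x x y) (vel x y)) +
       lag x y * (edot (lag_yy phi l x y) (acc x y) + edot (lag_y x y) (dvel l x y) +
         edot (lag_xy l x) (vel x y))).
  rewrite -(sum_pd2 phiU l y Ux) -!edot_sum_pd -!big_split /= !mulr_sumr -big_split /= mulr_sumr.
  by apply: eq_bigr => k _; rewrite !mulrDl !mulrDr !mulrDl !mulrA.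
rewrite (edot_lag_yy l x y (acc x y)).
set W := spray_vec x y.
have Vp := edot_vel_phi phiU y Ux; have lp := edot_pd_phi phiU l Ux.
have r2 : edot (vel x y) (vel x y) = nv x y ^+ 2 by rewrite enorm_sqr.
(* This identity forces the value of [proj_factor], because [lag_y x y] pairs with the velocity to
   the nonzero number [lag x y]. *)
have E1 : edot (lag_y x y) (acc x y) + edot (lag_x x y) (vel x y) = edot (lag_y x y) W.
  rewrite /W /spray_vec !edotDr !edotZr -addrA; congr (_ + _).
  rewrite edot_lag_y_vel // /lag_x /lag_y edotBl !edotZl Vp r2 /proj_factor /randers_lag.
  move: r0 s0; set s := sn x; set r := nv x y; set c := cf x; set d := edot a (vel x y).
  by move=> r0 s0; field; rewrite !gt_eqF.
(* The terms with [lag_xy] and [lag_x] cancel because the 1-form is closed, and against a tangent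
   vector [norm_hess] does not see the multiples of [phi x] and [vel x y] by which [W] differs from
   [acc x y]. *)
have E2 : norm_hess x y (dpd l phi x) (acc x y) + edot (lag_xy l x) (vel x y) -
    edot (lag_x x y) (dpd l phi x) = norm_hess x y (dpd l phi x) W.
  rewrite /W /spray_vec /norm_hess !edotDr !edotZr /lag_x /lag_xy !edotZl Vp lp r2.
  rewrite (edotC (dpd l phi x) (vel x y)).
  move: r0 s0; set s := sn x; set r := nv x y; set c := cf x; set d := edot a (vel x y).
  set e := edot a (dpd l phi x); set b := edot (vel x y) (dpd l phi x).
  set q := edot (dpd l phi x) (acc x y); set w := edot (vel x y) (acc x y).
  by move=> r0 s0; field; rewrite !gt_eqF.
rewrite -E1 -E2.
set A1 := edot (lag_y x y) (acc x y); set A2 := edot (lag_x x y) (vel x y).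
set A3 := norm_hess _ _ _ _; set A4 := edot (lag_y x y) (dvel l x y).
set A5 := edot (lag_xy l x) _; set A6 := edot (lag_y x y) _; set A7 := lag x y.
set A8 := edot (lag_x x y) _; ring.
Qed.

(** [spray_rhs] exhibits the fundamental tensor times [spray2], and positive definiteness allows the
    tensor to be inverted. *)
Lemma spray_lag i x y : U x -> y != 0 -> spray Lf i x y = 2^-1 * spray2 i x y.
Proof.
move=> Ux y0; rewrite /spray (eq_bigr _ (fun l _ => congr1 _ (spray_rhs l Ux y0))).
have E l : edot (lag_y x y) (dpd l phi x) * edot (lag_y x y) (spray_vec x y) +
    lag x y * norm_hess x y (dpd l phi x) (spray_vec x y) =
    \sum_j fund_tensor Lf x y l j * spray2 j x y.
  rewrite -(sum_spray2 y Ux) norm_hessC norm_hess_suml edot_sumr !mulr_sumr -big_split /=.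
  apply: eq_bigr => j _; rewrite fund_tensor_lag // edotZr (norm_hessC _ _ (dpd l phi x)).
  move: (edot _ _) (edot _ _) (lag x y) (norm_hess _ _ _ _) (spray2 j x y) => *; ring.
under eq_bigr do rewrite E mulrCA.
rewrite -mulr_sumr mulrA (_ : 4^-1 * 2 = 2^-1); last by field.
congr (_ * _); transitivity ((invmx (fund_tensor Lf x y) *m (fund_tensor Lf x y *m
   \col_j spray2 j x y)) i 0); last first.
  by rewrite mulKmx ?fund_tensor_unit // mxE.
rewrite [RHS]mxE; apply: eq_bigr => l _; congr (_ * _).
rewrite [RHS]mxE; apply: eq_bigr => j _; congr (_ * _).
by rewrite mxE.
Qed.

End RandersSpray.

(** * Flag curvature *)

Section DerivableDeterminant.
Context {R : realType} {V : normedModType R}.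
Implicit Types x v : V.

Lemma derivable_bigsum (I : Type) (r : seq I) (F : I -> V -> R) x v :
  (forall i, derivable (F i) x v) -> derivable (fun z => \sum_(i <- r) F i z) x v.
Proof.
move=> Fd; have [] // := @is_derive_bigsum R V _ _ r predT F x v _
  (fun i _ => derivableP (Fd i)).
Qed.

Lemma derivable_mul (f g : V -> R) x v :
  derivable f x v -> derivable g x v -> derivable (fun z => f z * g z) x v.
Proof. by move=> /derivableP df /derivableP dg; have [] := is_derive_mul df dg. Qed.

Lemma derivable_bigprod (I : Type) (r : seq I) (F : I -> V -> R) x v :
  (forall i, derivable (F i) x v) -> derivable (fun z => \prod_(i <- r) F i z) x v.
Proof.
move=> Fd; elim: r => [|i r IHr].
  by under eq_fun do rewrite big_nil; have [] := is_derive_const (1 : R) x v.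
under eq_fun do rewrite big_cons.
exact: (derivable_mul (Fd i) IHr).
Qed.

Lemma derivable_det m (M : V -> 'M[R]_m) x v :
  (forall i j, derivable (fun z => M z i j) x v) -> derivable (fun z => \det (M z)) x v.
Proof.
move=> Md; rewrite /determinant; apply: derivable_bigsum => s.
have [dc _] := is_derive_const ((-1) ^+ (perm.odd_perm s) : R) x v.
refine (derivable_mul dc (derivable_bigprod _)) => i; exact: Md.
Qed.

Lemma derivable_invmx m (M : V -> 'M[R]_m) (U : set V) x v i j : open U -> U x ->
  (forall z, U z -> M z \in unitmx) ->
  (forall i j, derivable (fun z => M z i j) x v) ->
  derivable (fun z => invmx (M z) i j) x v.
Proof.
move=> oU Ux Mu Md.
have E z : U z -> (\det (M z))^-1 * cofactor (M z) j i = invmx (M z) i j.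
  by move=> Uz; rewrite /invmx Mu // !mxE.
have dd := derivable_det Md.
have d0 : \det (M x) != 0 by rewrite -unitfE -unitmxE Mu.
have di := @derivableV _ _ (fun z => \det (M z)) x v d0 dd.
have dc : derivable (fun z => cofactor (M z) j i) x v.
  have [dj _] := is_derive_const ((-1) ^+ (j + i) : R) x v.
  have dk : derivable (fun z => \det (row' j (col' i (M z)))) x v.
    by apply: derivable_det => k l; under eq_fun do rewrite !mxE; exact: Md.
  exact: (derivable_mul dj dk).
have [] // := is_derive_near oU Ux E (derivableP (derivable_mul di dc)).
Qed.

End DerivableDeterminant.

Section LinearCombinations.
Context {R : realType} {n m : nat}.
Implicit Types (y : 'I_n -> R) (w : 'rV[R]_m) (v : 'I_n -> 'rV[R]_m).

Lemma sum_scale_const y c v :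
  \sum_j y j *: (c *: v j) = c *: \sum_j y j *: v j.
Proof. by rewrite scaler_sumr; apply: eq_bigr => j _; rewrite !scalerA mulrC. Qed.

Lemma sum_scale_vec y (s : 'I_n -> R) w :
  \sum_j y j *: (s j *: w) = (\sum_j y j * s j) *: w.
Proof. by rewrite scaler_suml; apply: eq_bigr => j _; rewrite scalerA. Qed.

Lemma sum_edot y w v : \sum_j y j * edot w (v j) = edot w (\sum_j y j *: v j).
Proof. by rewrite edot_sumr; apply: eq_bigr => j _; rewrite edotZr. Qed.

Lemma sum_edotl y w v : \sum_j y j * edot (v j) w = edot (\sum_j y j *: v j) w.
Proof. by rewrite edot_suml; apply: eq_bigr => j _; rewrite edotZl. Qed.

End LinearCombinations.

(** * Derivatives of the projective factor *)

Section RandersCurvature.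
Context {R : realType} {n : nat}.
Variable a : 'rV[R]_n.+1.
Hypothesis a1 : edot a a < 1.
Variables (phi : 'rV[R]_n -> 'rV[R]_n.+1) (U : set 'rV[R]_n).
Hypothesis phiU : local_coord U phi.
Variable Lf : 'rV[R]_n -> 'rV[R]_n -> R.
Hypothesis LfE : forall x y, U x -> Lf x y = randers_lag a phi x y.
Implicit Types x y : 'rV[R]_n.

Local Notation vel := (vel phi).
Local Notation dvel := (dvel phi).
Local Notation cf x := (edot a (phi x)).
Local Notation sn x := (cosine_sin a (phi x)).
Local Notation nv x y := (enorm (vel x y)).
Local Notation P := (proj_factor a phi).

(* P is differentiated as <proj_y, d phi> along y; proj_dx j is the derivative
   of proj_y along the j-th coordinate of x. *)
Definition proj_y x y := (cf x / (2 * sn x) / nv x y) *: vel x y +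
  (cf x / (2 * sn x ^+ 2)) *: a.
Definition proj_xc x y := nv x y * (sn x ^+ 2 + cf x ^+ 2) / (2 * sn x ^+ 3) +
  edot a (vel x y) * (sn x ^+ 2 + 2 * cf x ^+ 2) / (2 * sn x ^+ 4).
Definition proj_dx j x y :=
  (edot a (dpd j phi x) * ((sn x ^+ 2 + cf x ^+ 2) / (2 * sn x ^+ 3) / nv x y)) *: vel x y +
  (cf x / (2 * sn x)) *: ((nv x y)^-1 *: dvel j x y -
     (edot (vel x y) (dvel j x y) / nv x y ^+ 3) *: vel x y) +
  (edot a (dpd j phi x) * ((sn x ^+ 2 + 2 * cf x ^+ 2) / (2 * sn x ^+ 4))) *: a.

Let sn0 x : U x -> sn x != 0.
Proof. by move=> Ux; rewrite gt_eqF // (sn_gt0 a1 phiU). Qed.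

Let nv0 x y : U x -> y != 0 -> nv x y != 0.
Proof. by move=> Ux y0; rewrite gt_eqF // (nv_gt0 phiU). Qed.

Lemma is_derive_projA k x : U x -> is_derive x (delta_mx 0 k) (fun z => cf z / (2 * sn z))
  (edot a (dpd k phi x) * (sn x ^+ 2 + cf x ^+ 2) / (2 * sn x ^+ 3)).
Proof.
move=> Ux; have s0 := sn0 Ux; have s20 : 2 * sn x != 0 by rewrite mulf_neq0 ?pnatr_eq0.
have d2 := is_derive_mul (is_derive_const (2 : R) x (delta_mx 0 k)) (is_derive_sn a1 phiU k Ux).
have d := is_derive_mul (is_derive_cf a phiU k Ux) (@is_derive_invr R _ (fun z => 2 * sn z) x _ _ s20 d2).
apply: is_derive_eq d _; move: s0; move: (sn x) (cf x) (edot a _) => s c b s0.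
by field.
Qed.

Lemma is_derive_projC k x : U x -> is_derive x (delta_mx 0 k) (fun z => cf z / (2 * sn z ^+ 2))
  (edot a (dpd k phi x) * (sn x ^+ 2 + 2 * cf x ^+ 2) / (2 * sn x ^+ 4)).
Proof.
move=> Ux; have s0 := sn0 Ux.
have s20 : 2 * (sn x * sn x) != 0 by rewrite !mulf_neq0 ?pnatr_eq0.
have ds := is_derive_sn a1 phiU k Ux.
have d2 := is_derive_mul (is_derive_const (2 : R) x (delta_mx 0 k)) (is_derive_mul ds ds).
have d := is_derive_mul (is_derive_cf a phiU k Ux)
  (@is_derive_invr R _ (fun z => 2 * (sn z * sn z)) x _ _ s20 d2).
apply: is_derive_eq d _; move: s0; move: (sn x) (cf x) (edot a _) => s c b s0.
by field.
Qed.

Lemma is_derive_proj_y k x y : U x -> y != 0 ->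
  is_derive y (delta_mx 0 k) (P x) (edot (proj_y x y) (dpd k phi x)).
Proof.
move=> Ux y0; have d := is_derive_add
  (is_derive_mul (is_derive_const (cf x / (2 * sn x)) y (delta_mx 0 k)) (is_derive_nv_y phiU k Ux y0))
  (is_derive_mul (is_derive_const (cf x / (2 * sn x ^+ 2)) y (delta_mx 0 k))
     (is_derive_edota_y a phi k x y)).
apply: is_derive_eq d _; rewrite /proj_y edotDl !edotZl !mul0r !add0r; congr (_ + _).
by rewrite -!mulrA; congr (_ * (_ * _)); rewrite mulrC.
Qed.

Lemma is_derive_proj_x k x y : U x -> y != 0 ->
  is_derive x (delta_mx 0 k) (fun z => P z y)
    (edot (proj_y x y) (dvel k x y) + proj_xc x y * edot a (dpd k phi x)).
Proof.
move=> Ux y0; have d := is_derive_add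
  (is_derive_mul (is_derive_projA k Ux) (is_derive_nv_x phiU k Ux y0))
  (is_derive_mul (is_derive_projC k Ux) (is_derive_edota_x a phiU k y Ux)).
apply: is_derive_eq d _; rewrite /proj_y /proj_xc edotDl !edotZl.
move: (sn0 Ux) (nv0 Ux y0).
move: (sn x) (cf x) (edot a (dpd k phi x)) (nv x y) (edot a (vel x y)) (edot a (dvel k x y)).
by move: (edot (vel x y) _) => *; field; rewrite ?H ?H0; apply/andP.
Qed.

End RandersCurvature.

(** * Derivatives of the spray and their push-forwards *)

Section SprayDerivatives.
Context {R : realType} {n : nat}.
Variable a : 'rV[R]_n.+1.
Hypothesis a1 : edot a a < 1.
Variables (phi : 'rV[R]_n -> 'rV[R]_n.+1) (U : set 'rV[R]_n).
Hypothesis phiU : local_coord U phi.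
Implicit Types x y : 'rV[R]_n.

Local Notation vel := (vel phi).
Local Notation dvel := (dvel phi).
Local Notation ddvel := (ddvel phi).
Local Notation acc := (acc phi).
Local Notation jerk := (jerk phi).
Local Notation cf x := (edot a (phi x)).
Local Notation sn x := (cosine_sin a (phi x)).
Local Notation nv x y := (enorm (vel x y)).
Local Notation oU := (local_coord_open phiU).
Local Notation P := (proj_factor a phi).
Local Notation S := (spray2 a phi).
Local Notation W := (spray_vec a phi).
Local Notation proj_y := (proj_y a phi).
Local Notation proj_xc := (proj_xc a phi).
Local Notation proj_dx := (proj_dx a phi).
Local Notation lag_yy := (lag_yy phi).

Lemma is_derive_scalev (V : normedModType R) m (c : R) (g : V -> 'rV[R]_m) (x v : V) d :
  is_derive x v g d -> is_derive x v (fun z => c *: g z) (c *: d).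
Proof.
move=> gd; apply: is_derive_eq (is_derive_scale (is_derive_const c x v) gd) _.
by rewrite scale0r add0r.
Qed.

Lemma is_derive_mulc (V : normedModType R) (c : R) (g : V -> R) (x v : V) d :
  is_derive x v g d -> is_derive x v (fun z => c * g z) (c * d).
Proof.
move=> gd; apply: is_derive_eq (is_derive_mul (is_derive_const c x v) gd) _.
by rewrite mul0r add0r.
Qed.

Lemma is_derive_proj_yy j x y : U x -> y != 0 ->
  is_derive y (delta_mx 0 j) (proj_y x) ((cf x / (2 * sn x)) *: lag_yy j x y).
Proof.
move=> Ux y0; have d := is_derive_add
  (is_derive_scale (is_derive_mulc (cf x / (2 * sn x)) (is_derive_nv_inv_y phiU j Ux y0))
     (is_derive_vel_y phi j x y))
  (is_derive_const ((cf x / (2 * sn x ^+ 2)) *: a) y (delta_mx 0 j)).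
apply: is_derive_eq d _; rewrite addr0 /lag_yy scalerBr !scalerA mulrN scaleNr.
by rewrite addrC.
Qed.

Lemma is_derive_nv_inv_x j x y : U x -> y != 0 ->
  is_derive x (delta_mx 0 j) (fun z => (nv z y)^-1)
    (- (edot (vel x y) (dvel j x y) / nv x y ^+ 3)).
Proof.
move=> Ux y0; have r0 : nv x y != 0 by rewrite gt_eqF // (nv_gt0 phiU).
apply: is_derive_eq (@is_derive_invr R _ (fun z => nv z y) x _ _ r0 (is_derive_nv_x phiU j Ux y0)) _.
by move: r0; move: (nv x y) (edot _ _) => r b r0; field.
Qed.

Lemma is_derive_proj_yx j x y : U x -> y != 0 ->
  is_derive x (delta_mx 0 j) (fun z => proj_y z y) (proj_dx j x y).
Proof.
move=> Ux y0; have d := is_derive_add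
  (is_derive_scale (is_derive_mul (is_derive_projA a1 phiU j Ux) (is_derive_nv_inv_x j Ux y0))
     (is_derive_vel_x phiU j y Ux))
  (is_derive_scale (is_derive_projC a1 phiU j Ux) (is_derive_const a x (delta_mx 0 j))).
apply: is_derive_eq d _; rewrite scaler0 addr0 /proj_dx.
apply/rowP => k; rewrite !mxE.
have s0 : sn x != 0 by rewrite gt_eqF // (sn_gt0 a1 phiU).
have r0 : nv x y != 0 by rewrite gt_eqF // (nv_gt0 phiU).
move: s0 r0; move: (sn x) (cf x) (edot a _) (nv x y) (edot _ _) (vel x y 0 k) (dvel j x y 0 k).
by move=> s c b r w v u s0 r0; field; apply/andP.
Qed.

Definition dspray2 i k x y :=
  \sum_l invmx (round_metric phi x) i l * (2 * edot (dvel k x y) (dpd l phi x)) +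
  2 * (edot (proj_y x y) (dpd k phi x) * y 0 i + P x y * (k == i)%:R).

Lemma is_derive_spray2_y i k x y : U x -> y != 0 ->
  is_derive y (delta_mx 0 k) (S i x) (dspray2 i k x y).
Proof.
move=> Ux y0.
have dl l : is_derive y (delta_mx 0 k)
    (fun z => invmx (round_metric phi x) i l * edot (acc x z) (dpd l phi x))
    (invmx (round_metric phi x) i l * (2 * edot (dvel k x y) (dpd l phi x))).
  apply: is_derive_mulc.
  apply: is_derive_eq (is_derive_edot (is_derive_acc_y phiU k y Ux)
    (is_derive_const (dpd l phi x) y (delta_mx 0 k))) _.
  by rewrite edot0r addr0 edotZl.
have d1 := @is_derive_bigsum R _ _ _ (index_enum _) predT
  (fun l z => invmx (round_metric phi x) i l * edot (acc x z) (dpd l phi x))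
  y (delta_mx 0 k) _ (fun l _ => dl l).
have d2 := is_derive_mul (is_derive_mulc 2 (is_derive_proj_y a phiU k Ux y0))
  (is_derive_coord i (is_derive_id y (delta_mx 0 k))).
apply: is_derive_eq (is_derive_add d1 d2) _.
rewrite mxE eqxx /= -!mulrA -mulrDr; congr (_ + _ * (_ + _ * _)).
by rewrite eq_sym.
Qed.

Lemma derivable_gram_inv i l k x : U x ->
  derivable (fun z => invmx (round_metric phi z) i l) x (delta_mx 0 k).
Proof.
move=> Ux; apply: (@derivable_invmx R _ _ (round_metric phi) U) => //.
- exact: local_coord_open phiU.
- by move=> z Uz; exact: round_metric_unit phiU z Uz.
- move=> i' j'; have [+ _] := is_derive_edot (is_derive_pd phiU i' k Ux) (is_derive_pd phiU j' k Ux).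
  have -> // : (fun z => edot (dpd i' phi z) (dpd j' phi z)) =
    (fun z => round_metric phi z i' j').
  by apply/funext => z; rewrite mxE dpdE.
Qed.

Lemma derivable_spray2_x i k x y : U x -> y != 0 ->
  derivable (fun z => S i z y) x (delta_mx 0 k).
Proof.
move=> Ux y0.
have d1 : derivable (fun z => \sum_l invmx (round_metric phi z) i l *
    edot (acc z y) (dpd l phi z)) x (delta_mx 0 k).
  apply: derivable_bigsum => l; apply: derivable_mul; first exact: derivable_gram_inv.
  by have [] := is_derive_edot (is_derive_acc_x phiU k y Ux) (is_derive_pd phiU l k Ux).
have d2 := is_derive_mul (is_derive_mulc 2 (is_derive_proj_x a1 phiU k Ux y0))
  (is_derive_const (y 0 i) x (delta_mx 0 k)).
by have [] := is_derive_add (derivableP d1) d2.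
Qed.

Lemma derivable_dspray2_x i k j x y : U x -> y != 0 ->
  derivable (fun z => dspray2 i k z y) x (delta_mx 0 j).
Proof.
move=> Ux y0.
have d1 : derivable (fun z => \sum_l invmx (round_metric phi z) i l *
    (2 * edot (dvel k z y) (dpd l phi z))) x (delta_mx 0 j).
  apply: derivable_bigsum => l; apply: derivable_mul; first exact: derivable_gram_inv.
  by have [] := is_derive_mulc 2 (is_derive_edot (is_derive_dvel_x phiU j k y Ux)
    (is_derive_pd phiU l j Ux)).
have d2 := is_derive_mulc 2 (is_derive_add (is_derive_mul (is_derive_edot (is_derive_proj_yx j Ux y0)
  (is_derive_pd phiU k j Ux)) (is_derive_const (y 0 i) x (delta_mx 0 j)))
  (is_derive_mul (is_derive_proj_x a1 phiU j Ux y0)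
     (is_derive_const ((k == i)%:R : R) x (delta_mx 0 j)))).
by have [] := is_derive_add (derivableP d1) d2.
Qed.

Lemma derivable_dspray2_y i k j x y : U x -> y != 0 ->
  derivable (dspray2 i k x) y (delta_mx 0 j).
Proof.
move=> Ux y0.
have d1 : derivable (fun z => \sum_l invmx (round_metric phi x) i l *
    (2 * edot (dvel k x z) (dpd l phi x))) y (delta_mx 0 j).
  apply: derivable_bigsum => l.
  have [] // := is_derive_mulc (invmx (round_metric phi x) i l) (is_derive_mulc 2
    (is_derive_edot (is_derive_dvel_y phi j k x y)
    (is_derive_const (dpd l phi x) y (delta_mx 0 j)))).
have d2 := is_derive_mulc 2 (is_derive_add (is_derive_mul (is_derive_edot (is_derive_proj_yy j Ux y0)
  (is_derive_const (dpd k phi x) y (delta_mx 0 j)))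
  (is_derive_coord i (is_derive_id y (delta_mx 0 j))))
  (is_derive_mul (is_derive_proj_y a phiU j Ux y0)
     (is_derive_const ((k == i)%:R : R) y (delta_mx 0 j)))).
by have [] := is_derive_add (derivableP d1) d2.
Qed.

Definition spray_vec_x k x y := jerk k x y +
  (2 * edot (vel x y) (dvel k x y)) *: phi x +
  edot (vel x y) (vel x y) *: dpd k phi x +
  (2 * (edot (proj_y x y) (dvel k x y) + proj_xc x y * edot a (dpd k phi x))) *: vel x y +
  (2 * P x y) *: dvel k x y.

Definition spray_vec_y k x y := 2 *: dvel k x y +
  (2 * edot (vel x y) (dpd k phi x)) *: phi x +
  (2 * edot (proj_y x y) (dpd k phi x)) *: vel x y +
  (2 * P x y) *: dpd k phi x.

Definition spray_vec_yx j k x y := 2 *: ddvel j k x y +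
  ((2 * (edot (dvel j x y) (dpd k phi x) + edot (vel x y) (dpd j (dpd k phi) x))) *: phi x +
   (2 * edot (vel x y) (dpd k phi x)) *: dpd j phi x) +
  ((2 * (edot (proj_dx j x y) (dpd k phi x) + edot (proj_y x y) (dpd j (dpd k phi) x))) *: vel x y +
   (2 * edot (proj_y x y) (dpd k phi x)) *: dvel j x y) +
  ((2 * (edot (proj_y x y) (dvel j x y) + proj_xc x y * edot a (dpd j phi x))) *: dpd k phi x +
   (2 * P x y) *: dpd j (dpd k phi) x).

Definition spray_vec_yy j k x y := 2 *: dpd k (dpd j phi) x +
  (2 * edot (dpd j phi x) (dpd k phi x)) *: phi x +
  ((2 * (cf x / (2 * sn x) * edot (lag_yy j x y) (dpd k phi x))) *: vel x y +
   (2 * edot (proj_y x y) (dpd k phi x)) *: dpd j phi x) +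
  (2 * edot (proj_y x y) (dpd j phi x)) *: dpd k phi x.

Lemma is_derive_spray_vec_x k x y : U x -> y != 0 ->
  is_derive x (delta_mx 0 k) (fun z => W z y) (spray_vec_x k x y).
Proof.
move=> Ux y0; have dv := is_derive_vel_x phiU k y Ux.
have d := is_derive_add (is_derive_add (is_derive_acc_x phiU k y Ux)
  (is_derive_scale (is_derive_edot dv dv) (is_derive_phi phiU k Ux)))
  (is_derive_scale (is_derive_mulc 2 (is_derive_proj_x a1 phiU k Ux y0)) dv).
apply: is_derive_eq d _.
rewrite (edotC (dvel k x y)) /spray_vec_x; apply/rowP => i; rewrite !mxE.
ring.
Qed.

Lemma is_derive_spray_vec_y k x y : U x -> y != 0 ->
  is_derive y (delta_mx 0 k) (W x) (spray_vec_y k x y).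
Proof.
move=> Ux y0; have dv := is_derive_vel_y phi k x y.
have d := is_derive_add (is_derive_add (is_derive_acc_y phiU k y Ux)
  (is_derive_scale (is_derive_edot dv dv) (is_derive_const (phi x) y (delta_mx 0 k))))
  (is_derive_scale (is_derive_mulc 2 (is_derive_proj_y a phiU k Ux y0)) dv).
apply: is_derive_eq d _.
rewrite (edotC (dpd k phi x)) /spray_vec_y; apply/rowP => i; rewrite !mxE.
ring.
Qed.

Lemma is_derive_spray_vec_yx j k x y : U x -> y != 0 ->
  is_derive x (delta_mx 0 j) (fun z => spray_vec_y k z y) (spray_vec_yx j k x y).
Proof.
move=> Ux y0; have dv := is_derive_vel_x phiU j y Ux.
have dk := is_derive_pd phiU k j Ux.
have d := is_derive_add (is_derive_add (is_derive_add
  (is_derive_scalev 2 (is_derive_dvel_x phiU j k y Ux))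
  (is_derive_scale (is_derive_mulc 2 (is_derive_edot dv dk)) (is_derive_phi phiU j Ux)))
  (is_derive_scale (is_derive_mulc 2 (is_derive_edot (is_derive_proj_yx j Ux y0) dk)) dv))
  (is_derive_scale (is_derive_mulc 2 (is_derive_proj_x a1 phiU j Ux y0)) dk).
exact: is_derive_eq d _.
Qed.

Lemma is_derive_spray_vec_yy j k x y : U x -> y != 0 ->
  is_derive y (delta_mx 0 j) (spray_vec_y k x) (spray_vec_yy j k x y).
Proof.
move=> Ux y0; have dv := is_derive_vel_y phi j x y.
have dk := is_derive_const (dpd k phi x) y (delta_mx 0 j).
have d := is_derive_add (is_derive_add (is_derive_add
  (is_derive_scalev 2 (is_derive_dvel_y phi j k x y))
  (is_derive_scale (is_derive_mulc 2 (is_derive_edot dv dk)) (is_derive_const (phi x) y (delta_mx 0 j))))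
  (is_derive_scale (is_derive_mulc 2 (is_derive_edot (is_derive_proj_yy j Ux y0) dk)) dv))
  (is_derive_scale (is_derive_mulc 2 (is_derive_proj_y a phiU j Ux y0)) dk).
apply: is_derive_eq d _.
by rewrite !edot0r !scaler0 !addr0 edotZl.
Qed.

Lemma is_derive_lincomb (V : normedModType R) (N : nat) m (c : 'I_N -> V -> R)
    (g : 'I_N -> V -> 'rV[R]_m) (x v : V) (dc : 'I_N -> R) dg :
  (forall i, is_derive x v (c i) (dc i)) -> (forall i, is_derive x v (g i) (dg i)) ->
  is_derive x v (fun z => \sum_i c i z *: g i z)
    (\sum_i (dc i *: g i x + c i x *: dg i)).
Proof.
move=> cd gd; exact: (@is_derive_bigsum R V _ _ (index_enum _) predT
  (fun i z => c i z *: g i z) x v _ (fun i _ => is_derive_scale (cd i) (gd i))).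
Qed.

Lemma is_derive_uniq (V X : normedModType R) (g : V -> X) (x v : V) d d' :
  is_derive x v g d -> is_derive x v g d' -> d = d'.
Proof. by move=> /is_derive_val <- /is_derive_val. Qed.

(** The identity [sum_spray2] is differentiated as a whole, and the terms in which the derivative
    falls on [dpd i phi] are moved to the right: the inverse metric is never differentiated
    explicitly. The next three lemmas proceed likewise. *)
Lemma sum_spray2_x k x y : U x -> y != 0 ->
  \sum_i 'D_(delta_mx 0 k) (fun z => S i z y) x *: dpd i phi x =
  spray_vec_x k x y - \sum_i S i x y *: dpd k (dpd i phi) x.
Proof.
move=> Ux y0; have d := is_derive_lincomb
  (fun i => derivableP (@derivable_spray2_x i k x y Ux y0)) (fun i => is_derive_pd phiU i k Ux).
have {}d := is_derive_near oU Ux (fun z Uz => sum_spray2 a phiU y Uz) d.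
have := is_derive_uniq d (is_derive_spray_vec_x k Ux y0).
by rewrite big_split /= => <-; rewrite addrK.
Qed.

Lemma sum_dspray2 k x y : U x -> y != 0 ->
  \sum_i dspray2 i k x y *: dpd i phi x = spray_vec_y k x y.
Proof.
move=> Ux y0; have d := is_derive_lincomb
  (fun i => is_derive_spray2_y i k Ux y0)
  (fun i => is_derive_const (dpd i phi x) y (delta_mx 0 k)).
have E : (fun z => \sum_i S i x z *: dpd i phi x) = W x.
  by apply/funext => z; rewrite (sum_spray2 a phiU z Ux).
rewrite E in d.
rewrite -(is_derive_uniq d (is_derive_spray_vec_y k Ux y0)).
by apply: eq_bigr => i _; rewrite scaler0 addr0.
Qed.

Lemma sum_dspray2_x j k x y : U x -> y != 0 ->
  \sum_i 'D_(delta_mx 0 j) (fun z => dspray2 i k z y) x *: dpd i phi x =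
  spray_vec_yx j k x y - \sum_i dspray2 i k x y *: dpd j (dpd i phi) x.
Proof.
move=> Ux y0; have d := is_derive_lincomb
  (fun i => derivableP (@derivable_dspray2_x i k j x y Ux y0)) (fun i => is_derive_pd phiU i j Ux).
have {}d := is_derive_near oU Ux (fun z Uz => sum_dspray2 k Uz y0) d.
have := is_derive_uniq d (is_derive_spray_vec_yx j k Ux y0).
by rewrite big_split /= => <-; rewrite addrK.
Qed.

Lemma sum_dspray2_y j k x y : U x -> y != 0 ->
  \sum_i 'D_(delta_mx 0 j) (dspray2 i k x) y *: dpd i phi x = spray_vec_yy j k x y.
Proof.
move=> Ux y0; have d := is_derive_lincomb
  (fun i => derivableP (@derivable_dspray2_y i k j x y Ux y0))
  (fun i => is_derive_const (dpd i phi x) y (delta_mx 0 j)).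
have {}d := is_derive_near (@open_neq0 _ n) y0 (fun z z0 => sum_dspray2 k Ux z0) d.
rewrite -(is_derive_uniq d (is_derive_spray_vec_yy j k Ux y0)).
by apply: eq_bigr => i _; rewrite scaler0 addr0.
Qed.

End SprayDerivatives.

(** * The Riemann curvature pushed forward *)

Section RandersRiemann.
Context {R : realType} {n : nat}.
Variable a : 'rV[R]_n.+1.
Hypothesis a1 : edot a a < 1.
Variables (phi : 'rV[R]_n -> 'rV[R]_n.+1) (U : set 'rV[R]_n).
Hypothesis phiU : local_coord U phi.
Variable Lf : 'rV[R]_n -> 'rV[R]_n -> R.
Hypothesis LfE : forall x y, U x -> Lf x y = randers_lag a phi x y.
Implicit Types x y : 'rV[R]_n.

Local Notation vel := (vel phi).
Local Notation dvel := (dvel phi).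
Local Notation acc := (acc phi).
Local Notation jerk := (jerk phi).
Local Notation cf x := (edot a (phi x)).
Local Notation sn x := (cosine_sin a (phi x)).
Local Notation nv x y := (enorm (vel x y)).
Local Notation oU := (local_coord_open phiU).
Local Notation lag := (randers_lag a phi).
Local Notation lag_y := (lag_y a phi).
Local Notation P := (proj_factor a phi).
Local Notation S := (spray2 a phi).
Local Notation W := (spray_vec a phi).
Local Notation proj_y := (proj_y a phi).
Local Notation proj_xc := (proj_xc a phi).
Local Notation proj_dx := (proj_dx a phi).
Local Notation dspray2 := (dspray2 a phi).
Local Notation spray_vec_x := (spray_vec_x a phi).
Local Notation spray_vec_y := (spray_vec_y a phi).
Local Notation spray_vec_yx := (spray_vec_yx a phi).
Local Notation spray_vec_yy := (spray_vec_yy a phi).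
Local Notation norm_hess := (norm_hess phi).

Let half (g : R) : 2 * (2^-1 * g) = g.
Proof. by rewrite mulrA mulfV ?mul1r ?pnatr_eq0. Qed.

Lemma pd_spray_y i k x y : U x -> y != 0 ->
  pd k (fun y' => spray Lf i x y') y = 2^-1 * dspray2 i k x y.
Proof.
move=> Ux y0; apply: is_derive_val.
apply: (is_derive_near (@open_neq0 _ n) y0 (f := fun z => 2^-1 * S i x z)).
  by move=> z z0; rewrite (spray_lag a1 phiU LfE i Ux z0).
exact: (is_derive_mulc 2^-1 (is_derive_spray2_y a phiU i k Ux y0)).
Qed.

(** The factors 1/2 and 1/4 arise because [spray] is half of [spray2]. *)
Lemma riem_coef_lag i k x y : U x -> y != 0 -> riem_coef Lf x y i k =
  'D_(delta_mx 0 k) (fun z => S i z y) x -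
  2^-1 * (\sum_j y 0 j * 'D_(delta_mx 0 j) (fun z => dspray2 i k z y) x) +
  2^-1 * (\sum_j S j x y * 'D_(delta_mx 0 j) (dspray2 i k x) y) -
  4^-1 * (\sum_j dspray2 i j x y * dspray2 j k x y).
Proof.
move=> Ux y0; rewrite /riem_coef; congr (_ - _ + _ - _).
- have -> : pd k (fun x' => spray Lf i x' y) x =
      2^-1 * 'D_(delta_mx 0 k) (fun z => S i z y) x.
    apply: is_derive_val.
    apply: (is_derive_near oU Ux (f := fun z => 2^-1 * S i z y)).
      by move=> z Uz; rewrite (spray_lag a1 phiU LfE i Uz y0).
    exact: (is_derive_mulc 2^-1 (derivableP (derivable_spray2_x a1 phiU (i:=i) (k:=k) Ux y0))).
  exact: half.
- rewrite mulr_sumr; apply: eq_bigr => j _.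
  rewrite [RHS]mulrCA; congr (_ * _); apply: is_derive_val.
  apply: (is_derive_near oU Ux (f := fun z => 2^-1 * dspray2 i k z y)).
    by move=> z Uz; rewrite (pd_spray_y i k Uz y0).
  exact: (is_derive_mulc 2^-1 (derivableP (derivable_dspray2_x a1 phiU (i:=i) (k:=k) (j:=j) Ux y0))).
- rewrite mulr_sumr mulr_sumr; apply: eq_bigr => j _.
  rewrite (spray_lag a1 phiU LfE j Ux y0).
  have -> : pd j (pd k (fun y' => spray Lf i x y')) y =
      2^-1 * 'D_(delta_mx 0 j) (dspray2 i k x) y.
    apply: is_derive_val.
    apply: (is_derive_near (@open_neq0 _ n) y0 (f := fun z => 2^-1 * dspray2 i k x z)).
      by move=> z z0; rewrite (pd_spray_y i k Ux z0).
    refine (is_derive_mulc 2^-1 (derivableP (derivable_dspray2_y (a:=a) phiU (i:=i) (k:=k) (j:=j) Ux y0))).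
  rewrite -mulrA half; exact: mulrCA.
- rewrite mulr_sumr; apply: eq_bigr => j _.
  rewrite !(pd_spray_y _ _ Ux y0) (_ : 4^-1 = 2^-1 * 2^-1 :> R); last by field.
  by move: (dspray2 i j x y) (dspray2 j k x y) => p q; ring.
Qed.

(** The coefficient of the identity in the Riemann curvature, [curv_flag] being that of the
    flagpole. The sum of the squares of [sn] and [cf] is 1 but is left as it stands: in this form
    the curvature formula is an identity of rational functions with [sn] and [cf] independent. *)
Definition curv_main x y := lag x y ^+ 2 / 4 +
  3 / 4 * (nv x y ^+ 2 - edot a (vel x y) ^+ 2 / sn x ^+ 2) *
  ((sn x ^+ 2 + cf x ^+ 2) / sn x ^+ 2).

Definition curv_flag k x y := - ((lag x y / 4 + 3 / 4 * (nv x y + edot a (vel x y) / sn x) *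
  ((sn x ^+ 2 + cf x ^+ 2) / sn x ^+ 2)) * edot (lag_y x y) (dpd k phi x)).

(** The four groups are those of [riem_coef], with the derivatives of [spray2] replaced by ambient
    vectors. The leftover sums over second derivatives of the chart come from differentiating
    [dpd i phi]. *)
Lemma sum_riem_coef_split x y k : U x -> y != 0 ->
  \sum_i riem_coef Lf x y i k *: dpd i phi x =
  (spray_vec_x k x y - \sum_i S i x y *: dpd k (dpd i phi) x) -
  2^-1 *: (\sum_j y 0 j *: spray_vec_yx j k x y - \sum_i dspray2 i k x y *: dvel i x y) +
  2^-1 *: (\sum_j S j x y *: spray_vec_yy j k x y) -
  4^-1 *: (\sum_j dspray2 j k x y *: spray_vec_y j x y).
Proof.
move=> Ux y0.
have E1 : \sum_j y 0 j *: spray_vec_yx j k x y - \sum_i dspray2 i k x y *: dvel i x y =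
    \sum_i (\sum_j y 0 j * 'D_(delta_mx 0 j) (fun z => dspray2 i k z y) x) *: dpd i phi x.
  transitivity (\sum_j y 0 j *: (\sum_i 'D_(delta_mx 0 j) (fun z => dspray2 i k z y) x *: dpd i phi x)).
    under [RHS]eq_bigr do rewrite (sum_dspray2_x a1 phiU _ k Ux y0) scalerBr.
    rewrite sumrB; congr (_ - _).
    under [RHS]eq_bigr do rewrite scaler_sumr.
    rewrite exchange_big /=; apply: eq_bigr => i _.
    rewrite sum_scale_const; congr (_ *: _).
    exact: esym (sum_pd2 phiU i y Ux).
  under eq_bigr do rewrite scaler_sumr.
  rewrite exchange_big /=; apply: eq_bigr => i _.
  by rewrite scaler_suml; apply: eq_bigr => j _; rewrite scalerA.
have E2 : \sum_j S j x y *: spray_vec_yy j k x y =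
    \sum_i (\sum_j S j x y * 'D_(delta_mx 0 j) (dspray2 i k x) y) *: dpd i phi x.
  under eq_bigr do rewrite -(sum_dspray2_y a phiU _ k Ux y0) scaler_sumr.
  rewrite exchange_big /=; apply: eq_bigr => i _.
  by rewrite scaler_suml; apply: eq_bigr => j _; rewrite scalerA.
have E3 : \sum_j dspray2 j k x y *: spray_vec_y j x y =
    \sum_i (\sum_j dspray2 i j x y * dspray2 j k x y) *: dpd i phi x.
  under eq_bigr do rewrite -(sum_dspray2 a phiU _ Ux y0) scaler_sumr.
  rewrite exchange_big /=; apply: eq_bigr => i _.
  by rewrite scaler_suml; apply: eq_bigr => j _; rewrite scalerA mulrC.
rewrite -(sum_spray2_x a1 phiU k Ux y0) E1 E2 E3 !scaler_sumr -sumrB -big_split -sumrB /=.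
apply: eq_bigr => i _; rewrite riem_coef_lag //.
by rewrite scalerBl scalerDl scalerBl !scalerA.
Qed.

Local Notation A x := (cf x / (2 * sn x)).

Lemma sum_spray_vec_yx x y k : U x -> y != 0 ->
  \sum_j y 0 j *: spray_vec_yx j k x y =
  2 *: jerk k x y +
  ((2 * (edot (acc x y) (dpd k phi x) + edot (vel x y) (dvel k x y))) *: phi x +
   (2 * edot (vel x y) (dpd k phi x)) *: vel x y) +
  ((2 * (edot (\sum_j y 0 j *: proj_dx j x y) (dpd k phi x) +
         edot (proj_y x y) (dvel k x y))) *: vel x y +
   (2 * edot (proj_y x y) (dpd k phi x)) *: acc x y) +
  ((2 * (edot (proj_y x y) (acc x y) + proj_xc x y * edot a (vel x y))) *: dpd k phi x +
   (2 * P x y) *: dvel k x y).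
Proof.
move=> Ux y0; rewrite /spray_vec_yx.
under eq_bigr do rewrite !scalerDr.
rewrite !big_split /= -(sum_ddvel phiU k y Ux).
have S1 (u : 'I_n -> R) : \sum_j y 0 j * (2 * u j) = 2 * \sum_j y 0 j * u j.
  by rewrite mulr_sumr; apply: eq_bigr => j _; exact: mulrCA.
have S2 (u v : 'I_n -> R) : \sum_j y 0 j * (u j + v j) =
    \sum_j y 0 j * u j + \sum_j y 0 j * v j.
  by rewrite -big_split; apply: eq_bigr => j _; exact: mulrDr.
rewrite !sum_scale_vec !sum_scale_const !S1 !S2 !sum_edotl !sum_edot.
rewrite -/(vel x y) -/(acc x y) (sum_pd2 phiU k y Ux).
have -> : \sum_j y 0 j * (proj_xc x y * edot a (dpd j phi x)) = proj_xc x y * edot a (vel x y).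
  by rewrite -sum_edot mulr_sumr; apply: eq_bigr => j _; exact: mulrCA.
by [].
Qed.

Lemma sum_spray_vec_yy x y k : U x -> y != 0 ->
  \sum_j S j x y *: spray_vec_yy j k x y =
  2 *: (\sum_j S j x y *: dpd k (dpd j phi) x) +
  (2 * edot (W x y) (dpd k phi x)) *: phi x +
  ((2 * (A x * norm_hess x y (W x y) (dpd k phi x))) *: vel x y +
   (2 * edot (proj_y x y) (dpd k phi x)) *: W x y) +
  (2 * edot (proj_y x y) (W x y)) *: dpd k phi x.
Proof.
move=> Ux y0; rewrite /spray_vec_yy.
under eq_bigr do rewrite !scalerDr.
rewrite !big_split /= -(sum_spray2 a phiU y Ux).
have S1 (c : R) (u : 'I_n -> R) : \sum_j S j x y * (c * u j) = c * \sum_j S j x y * u j.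
  by rewrite mulr_sumr; apply: eq_bigr => j _; exact: mulrCA.
rewrite !sum_scale_vec !sum_scale_const !S1 !sum_edotl !sum_edot norm_hess_suml.
congr (_ + _ + (_ *: _ + _) + _); congr (2 * (_ * _)); rewrite -sum_edotl.
by apply: eq_bigr => j _; rewrite edot_lag_yy.
Qed.

Lemma sum_spray_vec_y x y k : U x -> y != 0 ->
  \sum_j dspray2 j k x y *: spray_vec_y j x y =
  2 *: (\sum_j dspray2 j k x y *: dvel j x y) +
  (2 * edot (vel x y) (spray_vec_y k x y)) *: phi x +
  (2 * edot (proj_y x y) (spray_vec_y k x y)) *: vel x y +
  (2 * P x y) *: spray_vec_y k x y.
Proof.
move=> Ux y0; rewrite -(sum_dspray2 a phiU k Ux y0) {1}/spray_vec_y.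
under eq_bigr do rewrite !scalerDr.
rewrite !big_split /=.
have S1 (c : R) (u : 'I_n -> R) : \sum_j dspray2 j k x y * (c * u j) =
    c * \sum_j dspray2 j k x y * u j.
  by rewrite mulr_sumr; apply: eq_bigr => j _; exact: mulrCA.
by rewrite !sum_scale_vec !sum_scale_const !S1 !sum_edot.
Qed.

Lemma sum_proj_dx x y : \sum_j y 0 j *: proj_dx j x y =
  (edot a (vel x y) * ((sn x ^+ 2 + cf x ^+ 2) / (2 * sn x ^+ 3) / nv x y)) *: vel x y +
  A x *: ((nv x y)^-1 *: acc x y -
     (edot (vel x y) (acc x y) / nv x y ^+ 3) *: vel x y) +
  (edot a (vel x y) * ((sn x ^+ 2 + 2 * cf x ^+ 2) / (2 * sn x ^+ 4))) *: a.
Proof.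
rewrite /proj_dx; under eq_bigr do rewrite !scalerDr.
rewrite !big_split /= !sum_scale_vec sum_scale_const.
have S3 (c : R) (u : 'I_n -> R) : \sum_j y 0 j * (u j * c) = (\sum_j y 0 j * u j) * c.
  by rewrite mulr_suml; apply: eq_bigr => j _; exact: mulrA.
rewrite !S3 !sum_edot -/(vel x y); congr (_ + _ + _).
rewrite sum_scale_const -/(acc x y) scalerDr; congr (_ + _).
rewrite sum_scale_const; congr (_ *: _).
transitivity (- \sum_i y 0 i *: ((edot (vel x y) (dvel i x y) / nv x y ^+ 3) *: vel x y)).
  by rewrite -sumrN; apply: eq_bigr => i _; rewrite scalerN.
by rewrite sum_scale_vec S3 sum_edot.
Qed.

End RandersRiemann.

(** * Cancellation of the terms that depend on the chart *)

Section RandersFlag.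
Context {R : realType} {n : nat}.
Variable a : 'rV[R]_n.+1.
Hypothesis a1 : edot a a < 1.
Variables (phi : 'rV[R]_n -> 'rV[R]_n.+1) (U : set 'rV[R]_n).
Hypothesis phiU : local_coord U phi.
Variable Lf : 'rV[R]_n -> 'rV[R]_n -> R.
Hypothesis LfE : forall x y, U x -> Lf x y = randers_lag a phi x y.
Implicit Types x y : 'rV[R]_n.

Local Notation vel := (vel phi).
Local Notation dvel := (dvel phi).
Local Notation acc := (acc phi).
Local Notation jerk := (jerk phi).
Local Notation sn x := (cosine_sin a (phi x)).
Local Notation nv x y := (enorm (vel x y)).
Local Notation S := (spray2 a phi).
Local Notation dspray2 := (dspray2 a phi).

Local Notation curv_main := (curv_main a phi).
Local Notation curv_flag := (curv_flag a phi).

(** All quantities of second and third order in the chart, [acc], [dvel] and [jerk], cancel; the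
    identity is then checked coordinatewise as one between rational functions of scalar products. *)
Lemma sum_riem_coef k x y : U x -> y != 0 ->
  \sum_i riem_coef Lf x y i k *: dpd i phi x =
  curv_main x y *: dpd k phi x + curv_flag k x y *: vel x y.
Proof.
move=> Ux y0; rewrite (sum_riem_coef_split a1 phiU LfE k Ux y0).
rewrite (sum_spray_vec_yx a phiU k Ux) // (sum_spray_vec_yy a phiU k Ux) //.
rewrite (sum_spray_vec_y a phiU k Ux y0) (sum_proj_dx a phi x y).
set T := \sum_j dspray2 j k x y *: dvel j x y.
set Wk := \sum_i S i x y *: dpd k (dpd i phi) x.
have Vp := edot_vel_phi phiU y Ux; have kp := edot_pd_phi phiU k Ux.
have Vp' : edot (phi x) (vel x y) = 0 by rewrite edotC.
have kp' : edot (phi x) (dpd k phi x) = 0 by rewrite edotC.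
have r2 : edot (vel x y) (vel x y) = nv x y ^+ 2 by rewrite enorm_sqr.
have s0 : sn x != 0 by rewrite gt_eqF // (sn_gt0 a1 phiU).
have r0 : nv x y != 0 by rewrite gt_eqF // (nv_gt0 phiU).
(* The sums [T] and [Wk] also cancel between the groups, so they can be treated as unknown
   vectors. *)
move: T Wk => T Wk.
rewrite /curv_main /curv_flag /spray_vec_x /spray_vec_y /proj_y /proj_xc.
rewrite /norm_hess /lag_y /randers_lag /spray_vec /proj_factor.
move: (vel x y) (phi x) (dpd k phi x) (acc x y) (dvel k x y) (jerk k x y) (nv x y) (sn x) Vp Vp' kp kp' r2 s0 r0.
move=> v p q c w j r s vp pv qp pq vv s0 r0.
rewrite !(edotDl, edotDr, edotNl, edotNr, edotZl, edotZr) vv vp ?pv ?qp ?pq.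
apply/rowP => i; rewrite !mxE.
move: (edot a p) (edot a v) (edot a q) (edot a w) (edot a c) (edot v q) (edot v w) (edot v c) (edot c q).
move=> ap av aq aw ac vq vw vc cq.
move: (v 0 i) (p 0 i) (q 0 i) (c 0 i) (w 0 i) (j 0 i) (T 0 i) (Wk 0 i) (a 0 i).
move=> v0 p0 q0 c0 w0 j0 T0 Wk0 a0.

by field; apply/andP.
Qed.

End RandersFlag.

(** * The flag curvature and its bounds *)

Section RandersFlagBounds.
Context {R : realType} {n : nat}.
Variable a : 'rV[R]_n.+1.
Hypothesis a1 : edot a a < 1.
Variables (phi : 'rV[R]_n -> 'rV[R]_n.+1) (U : set 'rV[R]_n).
Hypothesis phiU : local_coord U phi.
Implicit Types x y u : 'rV[R]_n.

Local Notation vel := (vel phi).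
Local Notation cf x := (edot a (phi x)).
Local Notation sn x := (cosine_sin a (phi x)).
Local Notation nv x y := (enorm (vel x y)).
Local Notation lag := (randers_lag a phi).
Local Notation lag_y := (lag_y a phi).
Local Notation curv_main := (curv_main a phi).
Local Notation curv_flag := (curv_flag a phi).
Local Notation norm_hess := (norm_hess phi).


Lemma row_free_neq0 x u : row_free (col_mx x u) -> x != 0.
Proof.
move=> free; apply: contraTneq free => ->; apply/negP => /row_free_inj inj.
have := inj _ (row_mx 1%:M 0) 0; rewrite mul_row_col !mul0mx mulmx0 addr0.
move=> /(_ erefl) /rowP/(_ (lshift 1 0)); rewrite row_mxEl !mxE eqxx => /eqP.
by rewrite oner_eq0.
Qed.

Section Lagrangian.
Variable Lf : 'rV[R]_n -> 'rV[R]_n -> R.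
Hypothesis LfE : forall x y, U x -> Lf x y = lag x y.

Lemma riem_coef_randers i k x y : U x -> y != 0 ->
  riem_coef Lf x y i k = curv_main x y * (i == k)%:R + curv_flag k x y * y 0 i.
Proof.
move=> Ux y0.
have : vel x (\row_i riem_coef Lf x y i k) =
    vel x (curv_main x y *: delta_mx 0 k + curv_flag k x y *: y).
  rewrite velD !velZ.
  have -> : vel x (delta_mx 0 k) = dpd k phi x.
    by rewrite vel_jac -rowE row_jac.
  rewrite -(sum_riem_coef a1 phiU LfE k Ux y0).
  by apply: eq_bigr => i' _; rewrite mxE.
by move=> /(vel_inj phiU Ux)/rowP/(_ i); rewrite !mxE eqxx.
Qed.

(** The flag curvature times [lag]. It is a common factor: [curv_main] is [lag] times it, and
    [curv_flag k] is its opposite times [edot (lag_y x y) (dpd k phi x)]. This makes the flag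
    curvature depend on the flagpole only. *)
Definition curv_ratio x y := lag x y / 4 + 3 / 4 * (nv x y + edot a (vel x y) / sn x) *
  ((sn x ^+ 2 + cf x ^+ 2) / sn x ^+ 2).

Lemma riem_randers x y u : U x -> y != 0 -> riem Lf x y u =
  (lag x y * curv_ratio x y) *: u - (curv_ratio x y * edot (lag_y x y) (vel x u)) *: y.
Proof.
move=> Ux y0; apply/rowP => i; rewrite !mxE.
under eq_bigr do rewrite (riem_coef_randers _ _ Ux y0) mulrDl.
rewrite big_split /= (bigD1 i) //= eqxx mulr1 big1 ?addr0; last first.
  by move=> k ki; rewrite eq_sym (negbTE ki) mulr0 mul0r.
congr (_ + _).
  have s0 : sn x != 0 by rewrite gt_eqF // (sn_gt0 a1 phiU).
  congr (_ * _); rewrite /curv_main /curv_ratio /randers_lag; move: s0.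
  move: (sn x) (cf x) (edot a (vel x y)) (nv x y) => s c d r s0.
  by field.
have -> : edot (lag_y x y) (vel x u) = \sum_k u 0 k * edot (lag_y x y) (dpd k phi x).
  by rewrite edot_sumr; apply: eq_bigr => k _; rewrite edotZr.
rewrite mulr_sumr mulr_suml -sumrN; apply: eq_bigr => k _.
rewrite /curv_flag -/(curv_ratio x y).
by move: (curv_ratio x y) (edot _ _) => p q; ring.
Qed.

Lemma norm_hess_vel x y w : U x -> y != 0 -> norm_hess x y (vel x y) w = 0.
Proof.
move=> Ux y0; rewrite /norm_hess -enorm_sqr.
have r0 : nv x y != 0 by rewrite gt_eqF // (nv_gt0 phiU).
by move: r0; move: (nv x y) (edot _ _) => r b r0; field.
Qed.

Lemma norm_hessDZ x y (v w z : 'rV[R]_n.+1) c d :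
  norm_hess x y (c *: v + d *: w) z = c * norm_hess x y v z + d * norm_hess x y w z.
Proof. by rewrite /norm_hess edotDl edotDr !edotZl !edotZr; ring. Qed.

(** Numerator and denominator reduce to [lag ^+ 2 * curv_ratio] and [lag ^+ 3], each times
    [norm_hess] of [u], which is nonzero because [u] is not a multiple of [y]. *)
Lemma flag_curvature_randers x y u : U x -> row_free (col_mx y u) ->
  flag_curvature Lf x y u = curv_ratio x y / lag x y.
Proof.
move=> Ux free; have y0 := row_free_neq0 free.
have nh0 : norm_hess x y (vel x u) (vel x u) != 0.
  apply/eqP => /(norm_hess_eq0 phiU Ux y0) [c]; rewrite -velZ => /(vel_inj phiU Ux) uc.
  have /row_free_inj inj := free.
  have := inj _ (row_mx (c%:M) ((-1)%:M)) 0; rewrite mul_row_col mul0mx !mul_scalar_mx.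
  rewrite scaleN1r uc subrr => /(_ erefl) /rowP/(_ (rshift 1 0)).
  by rewrite row_mxEr !mxE eqxx => /eqP; rewrite oppr_eq0 oner_eq0.
have l0 : lag x y != 0 by rewrite gt_eqF // (lag_gt0 a1 phiU).
rewrite /flag_curvature riem_randers // !(fund_form_lag phiU LfE _ _ Ux y0).
rewrite velD -scaleNr !velZ (norm_hessC _ _ _ (vel x u) (_ + _)).
rewrite norm_hessDZ !norm_hess_vel // !mulr0 !addr0.
rewrite edotDr !edotZr (edot_lag_y_vel a phiU Ux y0).
move: nh0 l0; move: (norm_hess _ _ _ _) (lag x y) (edot _ _) (curv_ratio x y) => h l e k h0 l0.
rewrite (_ : l * l * _ - _ = l ^+ 3 * h); last by ring.
by field; apply/andP.
Qed.

End Lagrangian.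

(** The hypothesis and [s <= 1] give |e| <= d. The lower bound then uses [- d <= e] and [s <= 1],
    the upper one [e <= d] and the lower estimate of [s ^+ 2]. The constants are the values of 1/4 +
    3/4 t at t = (1 - d) / (1 + d) and at its inverse. *)
Lemma ratio_bounds (d e s : R) : 0 <= d -> d < 1 -> 0 < s -> s <= 1 ->
  (1 - d ^+ 2) <= s ^+ 2 * (1 - e ^+ 2) ->
  (2 - d) / (2 * (1 + d)) <= 1 / 4 + 3 / 4 * ((1 + e) / ((1 - e) * s ^+ 2)) <=
  (2 + d) / (2 * (1 - d)).
Proof.
move=> d0 d1 s0 s1 h; have s20 : 0 < s ^+ 2 by rewrite exprn_gt0.
have s21 : s ^+ 2 <= 1 by rewrite expr_le1 // ltW.
have d21 : 0 < 1 - d ^+ 2 by nra.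
have e21 : 0 < 1 - e ^+ 2 by rewrite -(pmulr_rgt0 _ s20) (lt_le_trans d21).
have e2 : e ^+ 2 <= d ^+ 2 by nra.
have [em ep] : - d <= e /\ e <= d.
  by apply/andP; rewrite -ler_norml -(@ler_pXn2r _ 2) ?nnegrE // real_normK ?num_real.
have e1 : 0 < 1 - e by lra.
have q0 : 0 < (1 - e) * s ^+ 2 by rewrite mulr_gt0.
have d1' : 0 < 1 - d by lra.
have d1'' : 0 < 1 + d by lra.
have L : (1 - d) / (1 + d) <= (1 + e) / ((1 - e) * s ^+ 2).
  rewrite ler_pdivrMr // mulrAC ler_pdivlMr //.
  have : (1 - d) * ((1 - e) * s ^+ 2) <= (1 - d) * (1 - e) by rewrite ler_pM2l // ler_piMr // ltW.
  nra.
have M : (1 + e) / ((1 - e) * s ^+ 2) <= (1 + d) / (1 - d).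
  rewrite ler_pdivrMr // mulrAC ler_pdivlMr //.
  have ep0 : 0 < 1 + e by lra.
  (* Multiplication by [1 + e] brings in [1 - e ^+ 2], to which the hypothesis applies. *)
  rewrite -(ler_pM2l ep0).
  apply: (@le_trans _ _ ((1 + d) * (1 - d ^+ 2))).
    rewrite (_ : 1 - d ^+ 2 = (1 + d) * (1 - d)); last by ring.
    by rewrite mulrA mulrA ler_pM2r // -!expr2 ler_pXn2r // ?nnegrE; lra.
  rewrite (_ : (1 + e) * _ = (1 + d) * (s ^+ 2 * (1 - e ^+ 2))); last by ring.
  by rewrite ler_pM2l.
apply/andP; split.
  rewrite [X in X <= _](_ : _ = 1 / 4 + 3 / 4 * ((1 - d) / (1 + d))); last first.
    by field; rewrite gt_eqF.
  by rewrite lerD2l ler_pM2l // divr_gt0.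
rewrite [X in _ <= X](_ : _ = 1 / 4 + 3 / 4 * ((1 + d) / (1 - d))); last first.
  by field; rewrite gt_eqF.
by rewrite lerD2l ler_pM2l // divr_gt0.
Qed.

(** After division by the squared norm of the velocity, and with [cf x ^+ 2] replaced by
    [1 - sn x ^+ 2], [bessel] turns into the hypothesis of [ratio_bounds] for d = |a|. *)
Lemma curv_ratio_bounds x y : U x -> y != 0 ->
  (2 - enorm a) / (2 * (1 + enorm a)) <= curv_ratio x y / lag x y <=
  (2 + enorm a) / (2 * (1 - enorm a)).
Proof.
move=> Ux y0; have s0 := sn_gt0 a1 phiU Ux; have r0 := nv_gt0 phiU Ux y0.
have l0 := lag_gt0 a1 phiU Ux y0; have s2 := sn_sqr a1 phiU Ux.
pose e := edot a (vel x y) / sn x / nv x y.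
have -> : curv_ratio x y / lag x y = 1 / 4 + 3 / 4 * ((1 + e) / ((1 - e) * sn x ^+ 2)).
  rewrite /curv_ratio (_ : sn x ^+ 2 + cf x ^+ 2 = 1); last by rewrite s2; ring.
  move: l0; rewrite /randers_lag /e; move: s0 r0.
  move: (sn x) (nv x y) (edot a (vel x y)) => s r d s0 r0 l0.
  have l1 : r * s - d != 0.
    by rewrite (_ : r * s - d = (r - d / s) * s) ?gt_eqF ?mulr_gt0 //; field; rewrite gt_eqF.
  by field; rewrite (mulrC s r) l1 !gt_eqF.
have h := @bessel R n a _ _ (local_coord_sphere phiU Ux) (edot_vel_phi phiU y Ux).
apply: ratio_bounds => //; first exact: enorm_ge0.
- by rewrite -(@ltr_pXn2r _ 2) ?nnegrE ?enorm_ge0 // enorm_sqr expr1n.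
- by rewrite -(@ler_pXn2r _ 2) ?nnegrE ?(ltW s0) // s2 expr1n lerBlDr lerDl sqr_ge0.
- rewrite enorm_sqr.
  have eE : edot a (vel x y) ^+ 2 = (e ^+ 2 * sn x ^+ 2) * nv x y ^+ 2.
    by rewrite -!exprMn /e; congr (_ ^+ 2); field; rewrite !gt_eqF.
  move: h; rewrite eE -(enorm_sqr (vel x y)) ler_pM2r ?exprn_gt0 // => h.
  have -> : sn x ^+ 2 * (1 - e ^+ 2) = sn x ^+ 2 - e ^+ 2 * sn x ^+ 2 by ring.
  by move: h s2; move: (e ^+ 2 * sn x ^+ 2) (sn x ^+ 2) (cf x ^+ 2) (edot a a) => b1 b2 b3 b4; lra.
Qed.

End RandersFlagBounds.

(** * The metric and the gradient attached to a linear form *)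

Section RandersOfLinear.
Context {R : realType} {n : nat}.
Variables (f : 'rV[R]_n.+1 -> R) (a : 'rV[R]_n.+1).
Hypothesis fa : forall p, sphere p -> f p = edot a p.
Implicit Types p v : 'rV[R]_n.+1.

(** Off the origin the radial extension of [f] is <a, z> / |z|, and |z| is stationary at [p] in
    tangential directions. *)
Lemma sdiff_linear p v : sphere p -> edot p v = 0 -> sdiff f p v = edot a v.
Proof.
move=> p1 pv; have pp : enorm p = 1 by [].
have p0 : p != 0 by rewrite -enorm_eq0 pp oner_eq0.
have en0 : enorm p != 0 by rewrite pp oner_eq0.
have d1 := @is_derive_invr R _ (fun z => enorm z) p v _ en0
  (is_derive_enorm p0 (is_derive_id p v)).
have d := is_derive_mul d1 (is_derive_edot (is_derive_const a p v) (is_derive_id p v)).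
rewrite /sdiff; apply: is_derive_val.
apply: is_derive_eq (is_derive_near (f := fun z => (enorm z)^-1 * edot a z)
  (@open_neq0 R n.+1) p0 _ d) _.
  move=> z z0; rewrite fa ?edotZr // /sphere /= enormZ gtr0_norm ?invr_gt0 ?enorm_gt0 //.
  by rewrite mulVf // enorm_eq0.
by rewrite pv pp mul0r oppr0 mul0r mul0r add0r edot0l add0r invr1 mul1r.
Qed.

Lemma randers_linear p v : sphere p -> edot p v = 0 ->
  randers (fun p v => - (sdiff f p v / Num.sqrt (1 - f p ^+ 2))) p v =
  enorm v - edot a v / cosine_sin a p.
Proof. by move=> p1 pv; rewrite /randers sdiff_linear // fa. Qed.

Variables (phi : 'rV[R]_n -> 'rV[R]_n.+1) (U : set 'rV[R]_n).
Hypothesis phiU : local_coord U phi.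

Lemma derive_phi x y : U x -> 'D_y phi x = vel phi x y.
Proof.
by move=> Ux; rewrite (smooth_on_derive (local_coord_open phiU) y (local_coord_smooth phiU) Ux) /vel dpdE.
Qed.

Lemma in_coord_randers_linear x y : U x ->
  in_coord (randers (fun p v => - (sdiff f p v / Num.sqrt (1 - f p ^+ 2)))) phi x y =
  randers_lag a phi x y.
Proof.
move=> Ux; rewrite /in_coord derive_phi // randers_linear //.
  exact/enorm1P/(local_coord_sphere phiU Ux).
by rewrite edotC (edot_vel_phi phiU).
Qed.

Lemma vec_norm_round x y : vec_norm (round_metric phi) x y = enorm (vel phi x y).
Proof.
rewrite /vec_norm /enorm /vel edot_suml; congr Num.sqrt.
apply: eq_bigr => i _; rewrite edotZl edot_sumr mulr_sumr; apply: eq_bigr => j _.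
by rewrite edotZr mxE -dpdE; ring.
Qed.

Lemma gradient_linear x : U x ->
  vel phi x (gradient (round_metric phi) (f \o phi) x) = a - edot a (phi x) *: phi x.
Proof.
move=> Ux; rewrite -(tangent_decomp phiU a Ux); apply: eq_bigr => i _; rewrite mxE.
congr (_ *: _); apply: eq_bigr => l _; congr (_ * _).
rewrite -(is_derive_val (is_derive_cf a phiU l Ux)).
apply: (derive_near _ (local_coord_open phiU) Ux) => z Uz /=.
exact/fa/enorm1P/(local_coord_sphere phiU Uz).
Qed.

(** Pythagoras for the splitting of [a] into its tangential part, the gradient, and its normal
    part. *)
Lemma gradient_norm_linear x : U x ->
  Num.sqrt (vec_norm (round_metric phi) x (gradient (round_metric phi) (f \o phi) x) ^+ 2
    + f (phi x) ^+ 2) = enorm a.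
Proof.
move=> Ux; have pp := local_coord_sphere phiU Ux.
rewrite vec_norm_round enorm_sqr gradient_linear // fa; last exact/enorm1P.
rewrite edotBl !edotBr !edotZl !edotZr (edotC (phi x) a) pp; congr Num.sqrt; ring.
Qed.

Lemma linear_lt1 : (forall p, sphere p -> `|f p| < 1) -> enorm a < 1.
Proof.
move=> f1; have [->|a0] := eqVneq a 0; first by rewrite /enorm edot0l sqrtr0.
have e0 : 0 < enorm a by rewrite enorm_gt0.
(* At this point [f] takes the value |a|. *)
have sp : sphere ((enorm a)^-1 *: a).
  by rewrite /sphere /= enormZ gtr0_norm ?invr_gt0 // mulVf ?gt_eqF.
have := f1 _ sp; rewrite fa // edotZr -enorm_sqr expr2 mulKf ?gt_eqF //.
by rewrite gtr0_norm.
Qed.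

End RandersOfLinear.

(** * Geodesics *)

Lemma is_derive_derive1 (R : realType) (W : normedModType R) (g : R -> W) t :
  derivable g t 1 -> is_derive t 1 g (derive1 g t).
Proof. by rewrite derive1E => /derivableP. Qed.

Lemma near_open_set (T : topologicalType) (t : T) (P : set T) :
  (\forall s \near t, P s) -> exists W, [/\ open W, W t & forall s, W s -> P s].
Proof. by move=> Pt; exists (interior P); split; [exact: open_interior|exact: Pt|exact: interior_subset]. Qed.

(** * Curves read in a chart *)

Section ChartCurves.
Context {R : realType} {n : nat}.
Variables (phi : 'rV[R]_n -> 'rV[R]_n.+1) (U : set 'rV[R]_n).
Hypothesis phiU : local_coord U phi.

Lemma chart_curve (c : R -> 'rV[R]_n) gamma t :
  (\forall s \near t, [/\ U (c s), phi (c s) = gamma s & derivable c s 1]) ->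
  derivable (derive1 c) t 1 ->
  derive1 gamma t = vel phi (c t) (derive1 c t) /\
  derive1 (derive1 gamma) t =
    acc phi (c t) (derive1 c t) + vel phi (c t) (derive1 (derive1 c) t).
Proof.
move=> /near_open_set[W [oW Wt WP]] ddc.
have D s : W s -> derive1 gamma s = vel phi (c s) (derive1 c s).
  move=> Ws; have [Us _ dc] := WP s Ws; rewrite derive1E; apply: is_derive_val.
  apply: (is_derive_near (f := fun z => phi (c z)) oW Ws) => [z /WP[]//|].
  rewrite /vel dpdE; apply: (is_derive_smooth_rV (local_coord_open phiU)) => //.
    exact: local_coord_smooth phiU.
  exact: is_derive_derive1.
split; first exact: D.
rewrite [LHS]derive1E; apply: is_derive_val.
apply: (is_derive_near (f := fun s => vel phi (c s) (derive1 c s)) oW Wt) => [z /D//|].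
have [Ut _ dc] := WP t Wt.
have dj j := is_derive_scale (is_derive_coord j (is_derive_derive1 ddc))
  (is_derive_smooth_rV (local_coord_open phiU) (smooth_on_pd j (local_coord_smooth phiU))
    Ut (is_derive_derive1 dc)).
have d := @is_derive_bigsum R _ _ _ (index_enum _) predT
  (fun j s => derive1 c s 0 j *: pd j phi (c s)) t 1 _ (fun j _ => dj j).
rewrite [X in is_derive _ _ X _](_ : _ = fun s => \sum_j derive1 c s 0 j *: pd j phi (c s)); last first.
  by rewrite /vel dpdE.
apply: is_derive_eq d _; rewrite big_split /= addrC /vel dpdE; congr (_ + _).
rewrite /acc; apply: eq_bigr => j _; congr (_ *: _).
by rewrite -(sum_pd2 phiU) // dpdE.
Qed.

End ChartCurves.

(** * The geodesic equation in the ambient space *)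

Section RandersGeodesicEquation.
Context {R : realType} {n : nat}.
Variable a : 'rV[R]_n.+1.
Hypothesis a1 : edot a a < 1.
Implicit Types (p v : 'rV[R]_n.+1) (gamma : R -> 'rV[R]_n.+1).

(* 2 P, where P is the projective factor of the spray. *)
Definition tangent_accel p v : R :=
  edot a p / cosine_sin a p * enorm v + edot a p / cosine_sin a p ^+ 2 * edot a v.

(** The normal term keeps the curve on the sphere; the other one is parallel to the velocity, so the
    plane spanned by position and velocity does not change. *)
Definition geodesic_ode gamma t := let v := derive1 gamma t in
  derive1 (derive1 gamma) t =
  - edot v v *: gamma t - tangent_accel (gamma t) v *: v.

(** The push-forward of the equation in coordinates is the defect of the ambient one, and the
    differential of a chart is injective. *)
Lemma chart_geodesic_ode U phi (Lf : 'rV[R]_n -> 'rV[R]_n -> R) c gamma t :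
  local_coord U phi -> (forall x y, U x -> Lf x y = randers_lag a phi x y) ->
  (\forall s \near t, [/\ U (c s), phi (c s) = gamma s & derivable c s 1]) ->
  derivable (derive1 c) t 1 -> derive1 gamma t != 0 ->
  (forall i, derive1 (derive1 c) t 0 i + 2 * spray Lf i (c t) (derive1 c t) = 0) <->
  geodesic_ode gamma t.
Proof.
move=> phiU LfE cU ddc g0; have [g1 g2] := chart_curve phiU cU ddc.
have /near_open_set[W [_ Wt /(_ t Wt)[Ut ct _]]] := cU.
set x := c t in Ut ct g1 g2 *; set y := derive1 c t in g1 g2 *.
set z := derive1 (derive1 c) t in g2 *.
have y0 : y != 0 by apply: contra g0; rewrite g1 (vel_eq0 phiU).
have S i : 2 * spray Lf i x y = spray2 a phi i x y.
  by rewrite (spray_lag a1 phiU LfE i Ut y0) mulrA divff ?mul1r // pnatr_eq0.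
have E : vel phi x (z + \row_i spray2 a phi i x y) =
    derive1 (derive1 gamma) t -
    (- edot (derive1 gamma t) (derive1 gamma t) *: gamma t -
     tangent_accel (gamma t) (derive1 gamma t) *: derive1 gamma t).
  rewrite velD [X in _ + X](_ : _ = spray_vec a phi x y); last first.
    rewrite -(sum_spray2 a phiU y Ut); apply: eq_bigr => i _.
    by rewrite mxE.
  rewrite g2 g1 -ct /spray_vec /tangent_accel opprB scaleNr opprK.
  have -> : 2 * proj_factor a phi x y = edot a (phi x) / cosine_sin a (phi x) * enorm (vel phi x y)
    + edot a (phi x) / cosine_sin a (phi x) ^+ 2 * edot a (vel phi x y).
    rewrite /proj_factor; have : cosine_sin a (phi x) != 0.
      by rewrite gt_eqF // (sn_gt0 a1 phiU).
    move: (cosine_sin a (phi x)) (edot a (phi x)) (enorm _) (edot a _) => s c0 r b s0.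
    by field.
  rewrite [acc phi x y + vel phi x z]addrC -!addrA; congr (_ + (_ + _)).
  exact: addrC.
rewrite /geodesic_ode; split => [H|/eqP].
  apply/eqP; rewrite -subr_eq0 -E (vel_eq0 phiU) //; apply/eqP/rowP => i.
  by rewrite !mxE -S H.
rewrite -subr_eq0 -E (vel_eq0 phiU) // => /eqP/rowP H i.
by have := H i; rewrite !mxE S.
Qed.

(** The equation in [geodesic] concerns coordinate curves that are given with two derivatives, so
    one has to be provided at each time. Gnomonic coordinates around [gamma t] are quotients of
    linear functions of [gamma s], hence as differentiable as [gamma]. *)
Lemma gnomonic_curve gamma t (W : set R) : open W -> W t ->
  (forall s, W s -> [/\ sphere (gamma s), derivable gamma s 1 & derivable (derive1 gamma) s 1]) ->
  exists phi (c : R -> 'rV[R]_n), [/\ local_coord [set: 'rV[R]_n] phi,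
    (\forall s \near t, [/\ [set: 'rV[R]_n] (c s), phi (c s) = gamma s & derivable c s 1]) &
    derivable (derive1 c) t 1].
Proof.
move=> oW Wt gW; have [st dt _] := gW t Wt; have p1 : edot (gamma t) (gamma t) = 1 by exact/enorm1P.
set p := gamma t in p1 *; have [E EE Ep] := orthonormal_frame p1.
pose w s := edot (gamma s) p; pose c s : 'rV[R]_n := \row_i (edot (gamma s) (row i E) / w s).
have dw u s : W s -> is_derive s 1 (fun s => edot (gamma s) u) (edot (derive1 gamma s) u).
  move=> /gW[_ d _]; apply: is_derive_eq (is_derive_edot (is_derive_derive1 d) (is_derive_const u s (1 : R))) _.
  by rewrite edot0r addr0.
have ddw u s : W s -> is_derive s 1 (fun s => edot (derive1 gamma s) u) (edot (derive1 (derive1 gamma) s) u).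
  move=> /gW[_ _ d]; apply: is_derive_eq (is_derive_edot (is_derive_derive1 d) (is_derive_const u s (1 : R))) _.
  by rewrite edot0r addr0.
have /near_open_set[W' [oW' W't W'P]] : \forall s \near t, 0 < w s.
  have /differentiable_continuous ct : differentiable w t.
    by apply/derivable1_diffP; have [] := dw p t Wt.
  have w1 : 0 < w t by rewrite /w p1.
  exact: (@cvgr_gt _ _ (nbhs t) _ w (w t) ct 0 w1).
pose V := W `&` W'; have oV : open V by exact: openI.
have Vt : V t by [].
have dc i s : V s -> is_derive s 1 (fun s => edot (gamma s) (row i E) / w s)
    (edot (derive1 gamma s) (row i E) / w s +
     edot (gamma s) (row i E) * (- edot (derive1 gamma s) p / w s ^+ 2)).
  move=> [Ws /W'P w0]; apply: is_derive_mul; first exact: dw.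
  by apply: is_derive_invr; rewrite ?gt_eqF //; exact: dw.
have dcV s : V s -> is_derive s 1 c (\row_i (edot (derive1 gamma s) (row i E) / w s +
     edot (gamma s) (row i E) * (- edot (derive1 gamma s) p / w s ^+ 2))).
  move=> Vs; apply: is_derive_rV => i; rewrite mxE; under eq_fun do rewrite mxE.
  exact: dc.
exists (gnomonic p E), c; split.
- exact: (local_coord_gnomonic p1 EE Ep).
- apply: filterS (open_nbhs_nbhs (conj oV Vt)) => s Vs; have [Ws /W'P w0] := Vs.
  split => //; last by have [] := dcV s Vs.
  have /enorm1P g1 : sphere (gamma s) by have [] := gW s Ws.
  have cE : p + c s *m E = (w s)^-1 *: gamma s.
    rewrite [in RHS](frame_decomp p1 EE Ep (gamma s)) scalerDr scalerA mulVf ?gt_eqF // scale1r.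
    rewrite scalemxAl; congr (_ + _ *m _); apply/rowP => i; rewrite !mxE; exact: mulrC.
  rewrite /gnomonic cE scalerA [X in X *: _](_ : _ = 1) ?scale1r //.
  have : 1 + edot (c s) (c s) = (w s)^-1 ^+ 2.
    have <- : edot (p + c s *m E) (p + c s *m E) = 1 + edot (c s) (c s).
      rewrite edotDl !edotDr p1 (edotC p) (frame_edot_p Ep) (frame_edot EE).
      by rewrite addr0 add0r.
    by rewrite cE edotZl edotZr g1 mulr1.
  move=> e; rewrite /gnomonic_weight e sqrtr_sqr gtr0_norm ?invr_gt0 // invrK.
  by rewrite divff ?gt_eqF.
- have dd : is_derive t 1 (fun s => \row_i (edot (derive1 gamma s) (row i E) * (w s)^-1 +
     edot (gamma s) (row i E) * (- edot (derive1 gamma s) p * (w s ^+ 2)^-1))) 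
     (\row_i 'D_1 (fun s => edot (derive1 gamma s) (row i E) * (w s)^-1 +
     edot (gamma s) (row i E) * (- edot (derive1 gamma s) p * (w s ^+ 2)^-1)) t).
    apply: is_derive_rV => i; rewrite mxE; under eq_fun do rewrite mxE.
    have w0 : w t != 0 by rewrite gt_eqF // W'P.
    have d1 := is_derive_mul (ddw (row i E) t Wt) (@is_derive_invr _ _ (fun s => w s) t _ _ w0 (dw p t Wt)).
    have w20 : w t * w t != 0 by rewrite mulf_neq0.
    have dww := @is_derive_invr _ _ (fun s => w s * w s) t _ _ w20 (is_derive_mul (dw p t Wt) (dw p t Wt)).
    have d2 := is_derive_mul (dw (row i E) t Wt) (is_derive_mul (is_derive_opp (ddw p t Wt)) dww).
    by have [/derivableP] := is_derive_add d1 d2.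
  have E1 s : V s -> (\row_i (edot (derive1 gamma s) (row i E) * (w s)^-1 +
     edot (gamma s) (row i E) * (- edot (derive1 gamma s) p * (w s ^+ 2)^-1))) = derive1 c s.
    by move=> Vs; rewrite [RHS]derive1E (is_derive_val (dcV s Vs)).
  by have [] := is_derive_near oV Vt E1 dd.
Qed.

Variable F : 'rV[R]_n.+1 -> 'rV[R]_n.+1 -> R.
Hypothesis FE : forall U phi, local_coord U phi -> forall x y, U x ->
  in_coord F phi x y = randers_lag a phi x y.

(** One chart around each point yields the ambient equation, which in turn gives the equation in
    every chart. *)
Lemma geodesicP (J : set R) gamma : geodesic F J gamma <->
  [/\ [/\ open J, is_interval J & J !=set0],
      (forall t, J t -> sphere (gamma t)),
      (forall t, J t -> derivable gamma t 1 /\ derivable (derive1 gamma) t 1),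
      (forall t, J t -> derive1 gamma t != 0) &
      forall t, J t -> geodesic_ode gamma t].
Proof.
split=> -[J1 J2 J3 J4 J5]; split => //.
  move=> t Jt; have [oJ _ _] := J1.
  have [s Js|phi [c [phiT cT ddc]]] := gnomonic_curve (gamma := gamma) oJ Jt.
    by have [? ?] := J3 s Js; split => //; exact: J2.
  apply/(chart_geodesic_ode phiT (FE phiT) cT ddc (J4 t Jt)); exact: J5 cT ddc.
move=> U phi phiU c t Jt cU ddc.
exact/(chart_geodesic_ode phiU (FE phiU) cU ddc (J4 t Jt))/J5.
Qed.

End RandersGeodesicEquation.

Lemma derive0_interval (R : realType) (J : set R) (g : R -> R) : is_interval J ->
  (forall t, J t -> is_derive t 1 g 0) -> forall s t, J s -> J t -> g s = g t.
Proof.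
move=> iJ dg; suff H s t : s <= t -> J s -> J t -> g s = g t.
  move=> s t Js Jt; have [st|/ltW ts] := leP s t; first exact: H.
  exact/esym/H.
move=> st Js Jt; have Jst x : x \in `[s, t]%R -> J x.
  by rewrite in_itv /= => /andP[sx xt]; apply: (iJ s t) => //; exact/andP.
have [x xst||x _] := @MVT_segment R g (fun=> 0) s t st.
- by apply: dg; apply: Jst; exact: subset_itv_oo_cc xst.
- by apply: derivable_within_continuous => x /Jst/dg[].
- by rewrite mul0r => /eqP; rewrite subr_eq0 => /eqP.
Qed.

Lemma derive0_interval_rV (R : realType) m (J : set R) (g : R -> 'rV[R]_m) : is_interval J ->
  (forall t, J t -> is_derive t 1 g 0) -> forall s t, J s -> J t -> g s = g t.
Proof.
move=> iJ dg s t Js Jt; apply/rowP => j.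
apply: (derive0_interval (g := fun s => g s 0 j) iJ _ Js Jt) => x /dg d.
by apply: is_derive_eq (is_derive_coord j d) _; rewrite mxE.
Qed.

(** The positive derivative makes [g] injective; its bounded distance to the identity makes it
    surjective, by intermediate values on [x - C, x + C]. *)
Lemma diffeomorphism_line (R : realType) (g dg : R -> R) (C : R) :
  (forall t : R, is_derive t 1 g (dg t)) -> (forall t, 0 < dg t) ->
  (forall t, `|g t - t| <= C) ->
  exists h : R -> R, [/\ cancel g h, cancel h g &
    forall t : R, is_derive t 1 h (dg (h t))^-1].
Proof.
move=> gd dg0 gC.
have cg : continuous g.
  by move=> t; apply/differentiable_continuous/derivable1_diffP; have [] := gd t.
have incr s t : s < t -> g s < g t.
  move=> st; have [|c _ e] := @MVT R g dg s t st (fun x _ => gd x).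
    exact: continuous_subspaceT.
  by rewrite -subr_gt0 e mulr_gt0 ?dg0 ?subr_gt0.
have inj s t : g s = g t -> s = t.
  move=> e; have [/incr|/incr|//] := ltgtP s t; by rewrite e ltxx.
have C0 : 0 <= C by apply: le_trans (gC 0).
have surj x : exists t, g t = x.
  have [|||t _ <-] := @IVT R g (x - C) (x + C) x; last by exists t.
  - by rewrite lerD2l; lra.
  - exact: continuous_subspaceT.
  have := gC (x - C); have := gC (x + C); rewrite !ler_norml => /andP[h1 h2] /andP[h3 h4].
  by rewrite ge_min le_max; apply/andP; split; apply/orP; [left|right]; lra.
have [h hP] : {h : R -> R & forall x, g (h x) = x}.
  by exists (fun x => projT1 (cid (surj x))) => x; exact: projT2 (cid (surj x)).
have gh : cancel g h by move=> x; apply: inj; rewrite hP.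
exists h; split => // t; rewrite -[t in is_derive t](hP t).
have nK : {near h t, cancel g h} by near=> x; exact: gh.
have nc : {near h t, continuous g} by near=> x; exact: cg.
by apply: (is_derive_inverse nK nc (gd (h t))); rewrite gt_eqF.
Unshelve. all: by end_near.
Qed.

(** * Great circles and their Randers arc length *)

Section GreatCircleTime.
Context {R : realType} {n : nat}.
Variable a : 'rV[R]_n.+1.
Hypothesis a1 : edot a a < 1.
Implicit Types (p q : 'rV[R]_n.+1).

Definition colatitude p : R := acos (edot a p).

Lemma edot_sphere_bound p : sphere p -> -1 < edot a p < 1.
Proof.
move=> /enorm1P p1; rewrite -ltr_norml -(@ltr_pXn2r _ 2) ?nnegrE ?normr_ge0 //.
by rewrite real_normK ?num_real // expr1n edot_sphere_lt1.
Qed.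

Lemma is_derive_colatitude (c : R -> 'rV[R]_n.+1) t v : sphere (c t) ->
  is_derive t 1 c v ->
  is_derive t 1 (fun s => colatitude (c s)) (- (edot a v / cosine_sin a (c t))).
Proof.
move=> ct dc; have df : is_derive t 1 (fun s => edot a (c s)) (edot a v).
  by apply: is_derive_eq (is_derive_edot (is_derive_const a t (1 : R)) dc) _; rewrite edot0l add0r.
apply: is_derive_eq (@is_derive_compR R _ (@acos R) (fun s => edot a (c s)) t 1 _ _
  (is_derive1_acos (edot_sphere_bound ct)) df) _.
by rewrite mulNr mulrC.
Qed.

Variables p q : 'rV[R]_n.+1.
Hypothesis pq : orthonormal2 p q.
Local Notation cpq := (circle_param p q).

Definition circle_vel t := - sin t *: p + cos t *: q.

Lemma circle_pp : edot p p = 1. Proof. by have [/enorm1P] := pq. Qed.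
Lemma circle_qq : edot q q = 1. Proof. by have [_ /enorm1P] := pq. Qed.
Lemma circle_pq : edot p q = 0. Proof. by have [_ _] := pq. Qed.

Lemma sphere_circle t : sphere (cpq t).
Proof.
apply/enorm1P; rewrite edotDl !edotDr !edotZl !edotZr (edotC q) circle_pp circle_pq circle_qq.
have := cos2Dsin2 t; lra.
Qed.

Lemma enorm_circle_vel t : enorm (circle_vel t) = 1.
Proof.
apply/enorm1P; rewrite edotDl !edotDr !edotZl !edotZr (edotC q) circle_pp circle_pq circle_qq.
have := cos2Dsin2 t; lra.
Qed.

Lemma edot_circle_vel t : edot (circle_vel t) (cpq t) = 0.
Proof.
rewrite edotDl !edotDr !edotZl !edotZr (edotC q) circle_pp circle_pq circle_qq; ring.
Qed.

Lemma is_derive_circle (t : R) : is_derive t 1 cpq (circle_vel t).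
Proof.
apply: is_derive_eq (is_derive_add (is_derive_scale (is_derive_cos t) (is_derive_const p t (1 : R)))
  (is_derive_scale (is_derive_sin t) (is_derive_const q t (1 : R)))) _.
by rewrite !scaler0 !addr0.
Qed.

Lemma is_derive_circle_vel (t : R) : is_derive t 1 circle_vel (- cpq t).
Proof.
apply: is_derive_eq (is_derive_add (is_derive_scale (is_derive_opp (is_derive_sin t)) (is_derive_const p t (1 : R)))
  (is_derive_scale (is_derive_cos t) (is_derive_const q t (1 : R)))) _.
by rewrite !scaler0 !addr0 !scaleNr opprD.
Qed.

(* The Randers length of the arc from 0 to t, up to a constant: the 1-form of
   the metric is the differential of the colatitude. *)
Definition circle_time t : R := t + colatitude (cpq t).

Definition circle_speed t : R := 1 - edot a (circle_vel t) / cosine_sin a (cpq t).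

Lemma is_derive_circle_time (t : R) : is_derive t 1 circle_time (circle_speed t).
Proof.
exact: is_derive_add (is_derive_id t 1) (is_derive_colatitude (sphere_circle t) (is_derive_circle t)).
Qed.

Lemma circle_speed_gt0 t : 0 < circle_speed t.
Proof.
rewrite subr_gt0 -(enorm_circle_vel t); apply: le_lt_trans (ler_norm _) _.
apply: randers_form_lt => //; first exact/enorm1P/sphere_circle.
  exact: edot_circle_vel.
by rewrite -enorm_eq0 enorm_circle_vel oner_eq0.
Qed.

Lemma circle_sin_gt0 t : 0 < cosine_sin a (cpq t).
Proof. by apply: cosine_sin_gt0 => //; exact/enorm1P/sphere_circle. Qed.

(** The bracket is [tangent_accel] at unit velocity. For a circle run at a speed inversely
    proportional to [circle_speed] it produces the tangential term of [geodesic_ode]. *)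
Lemma is_derive_circle_speed (t : R) : is_derive t 1 circle_speed
  (circle_speed t * (edot a (cpq t) / cosine_sin a (cpq t) +
     edot a (cpq t) / cosine_sin a (cpq t) ^+ 2 * edot a (circle_vel t))).
Proof.
have dg : is_derive t 1 (fun s => edot a (circle_vel s)) (- edot a (cpq t)).
  apply: is_derive_eq (is_derive_edot (is_derive_const a t (1 : R)) (is_derive_circle_vel t)) _.
  by rewrite edot0l add0r edotNr.
have df := is_derive_cosine_sin_inv a1 ((enorm1P _).1 (sphere_circle t)) (is_derive_circle t).
apply: is_derive_eq (is_derive_sub (is_derive_const (1 : R) t (1 : R)) (is_derive_mul dg df)) _.
rewrite /circle_speed; have : cosine_sin a (cpq t) != 0 by rewrite gt_eqF // circle_sin_gt0.
move: (cosine_sin a (cpq t)) (edot a (cpq t)) (edot a (circle_vel t)) => s f g s0.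
by field.
Qed.

(** The colatitude lies between 0 and pi, so [circle_time] stays within pi of the identity. *)
Lemma circle_time_inverse : exists h : R -> R, [/\ cancel circle_time h, cancel h circle_time &
    forall t : R, is_derive t 1 h (circle_speed (h t))^-1].
Proof.
apply: (diffeomorphism_line (C := pi) is_derive_circle_time circle_speed_gt0) => t.
have /andP[h1 h2] := edot_sphere_bound (sphere_circle t).
have h : -1 <= edot a (cpq t) <= 1 by rewrite !ltW.
rewrite /circle_time /colatitude addrAC subrr add0r ger0_norm ?acos_ge0 //.
exact: acos_lepi.
Qed.

End GreatCircleTime.

(** * Solutions of the geodesic equation are reparametrized great circles *)

Section RandersGeodesics.
Context {R : realType} {n : nat}.
Variable a : 'rV[R]_n.+1.
Hypothesis a1 : edot a a < 1.

Lemma is_derive_comp_rV m (g : R -> 'rV[R]_m) (c : R -> R) (t : R) u v :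
  is_derive t 1 c u -> is_derive (c t) 1 g v ->
  is_derive t 1 (fun s => g (c s)) (u *: v).
Proof.
move=> dc dg; apply: is_derive_rV => j; rewrite mxE mulrC.
exact: (@is_derive_compR R _ (fun z => g z 0 j) c t 1 _ _ (is_derive_coord j dg) dc).
Qed.

(** With [h] the inverse of [circle_time], the curve runs along the circle at constant Randers speed
    [k]. *)
Lemma circle_geodesic_ode p q (h : R -> R) k c0 t : orthonormal2 p q -> 0 < k ->
  (forall t : R, is_derive t 1 h (circle_speed a p q (h t))^-1) ->
  let gamma s := circle_param p q (h (k * s + c0)) in
  [/\ derivable gamma t 1, derivable (derive1 gamma) t 1, derive1 gamma t != 0 &
      geodesic_ode a gamma t].
Proof.
move=> pq k0 dh gamma; pose sg s := h (k * s + c0).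
pose u s := k * (circle_speed a p q (sg s))^-1.
have sp0 s : 0 < circle_speed a p q s by exact: circle_speed_gt0.
have u0 s : 0 < u s by rewrite mulr_gt0 ?invr_gt0.
have dsg (s : R) : is_derive s 1 sg (u s).
  have d1 := is_derive_add (is_derive_mul (is_derive_const k s (1 : R)) (is_derive_id s (1 : R)))
    (is_derive_const c0 s (1 : R)).
  apply: is_derive_eq (@is_derive_compR R _ h (fun s => k * s + c0) s 1 _ _ (dh _) d1) _.
  by rewrite mul0r add0r addr0 mulr1 mulrC.
have dg (s : R) : is_derive s 1 gamma (u s *: circle_vel p q (sg s)).
  exact: (is_derive_comp_rV (dsg s) (is_derive_circle p q (sg s))).
have g1 : derive1 gamma = fun s => u s *: circle_vel p q (sg s).
  by apply/funext => s; rewrite derive1E (is_derive_val (dg s)).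
have spt : circle_speed a p q (sg t) != 0 by rewrite gt_eqF.
have dsp := @is_derive_compR R _ (circle_speed a p q) sg t 1 _ _
  (is_derive_circle_speed a1 pq (sg t)) (dsg t).
have du := is_derive_mul (is_derive_const k t (1 : R))
  (@is_derive_invr R _ (fun s => circle_speed a p q (sg s)) t 1 _ spt dsp).
have ddg := is_derive_scale du (is_derive_comp_rV (dsg t) (is_derive_circle_vel p q (sg t))).
split; [by case: (dg t)|by rewrite g1; case: ddg| |].
  rewrite g1 scaler_eq0 gt_eqF //= -enorm_eq0 (enorm_circle_vel pq); exact: oner_neq0.
rewrite /geodesic_ode g1 [LHS]derive1E (is_derive_val ddg) /tangent_accel.
rewrite edotZl !edotZr -enorm_sqr enormZ (enorm_circle_vel pq) (gtr0_norm (u0 t)) expr1n.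
rewrite -[gamma t]/(circle_param p q (sg t)) -/(u t).
have ut : u t = k * (circle_speed a p q (sg t))^-1 by [].
move: spt; rewrite ut; clear.
move: (circle_speed _ _ _ _) (cosine_sin _ _) (edot a _) (edot a _) => w s f g.
move: (circle_vel _ _ _) (circle_param _ _ _) => v c w0.
apply/rowP => j; rewrite !mxE; move: (v 0 j) (c 0 j) => vj cj.
by move: (g / s) (g / s ^+ 2) => g1 g2; field.
Qed.

Section Solution.
Variables (J : set R) (gamma : R -> 'rV[R]_n.+1) (t0 : R).
Hypotheses (oJ : open J) (iJ : is_interval J) (Jt0 : J t0).
Hypothesis gS : forall t, J t -> sphere (gamma t).
Hypothesis gd : forall t, J t -> derivable gamma t 1 /\ derivable (derive1 gamma) t 1.
Hypothesis g0 : forall t, J t -> derive1 gamma t != 0.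
Hypothesis gode : forall t, J t -> geodesic_ode a gamma t.

Local Notation v := (derive1 gamma).
Local Notation sn t := (cosine_sin a (gamma t)).
Local Notation acc t := (tangent_accel a (gamma t) (v t)).
Local Notation r t := (enorm (v t)).

Lemma is_derive_curve t : J t -> is_derive t 1 gamma (v t).
Proof. by move=> /gd[d _]; exact: is_derive_derive1. Qed.

Lemma is_derive_curve_vel t : J t ->
  is_derive t 1 v (- (r t ^+ 2) *: gamma t - acc t *: v t).
Proof.
by move=> Jt; rewrite enorm_sqr -(gode Jt); apply: is_derive_derive1; case: (gd Jt).
Qed.

Lemma edot_curve_vel t : J t -> edot (v t) (gamma t) = 0.
Proof.
move=> Jt; have d := is_derive_edot (is_derive_curve Jt) (is_derive_curve Jt).
have := is_derive_near oJ Jt (fun s Js => (enorm1P _).1 (gS Js)) d.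
move/is_derive_val; rewrite (is_derive_val (is_derive_const (1 : R) t _)).
rewrite (edotC (gamma t)); lra.
Qed.

Lemma curve_speed_gt0 t : J t -> 0 < r t.
Proof. by move=> Jt; rewrite enorm_gt0 g0. Qed.

Lemma is_derive_curve_speed t : J t -> is_derive t 1 (fun s => r s) (- acc t * r t).
Proof.
move=> Jt; have r0 := curve_speed_gt0 Jt.
apply: is_derive_eq (is_derive_enorm (g0 Jt) (is_derive_curve_vel Jt)) _.
rewrite edotBr !edotZr (edot_curve_vel Jt) -enorm_sqr; move: r0.
by move: (r t) (acc t) => x y x0; field; rewrite gt_eqF.
Qed.

Lemma curve_sin_gt0 t : J t -> 0 < sn t.
Proof. by move=> /gS/enorm1P; exact: cosine_sin_gt0. Qed.

(** Conservation of the Randers speed along a solution. It integrates the equation once and makes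
    the angle travelled explicit. *)
Lemma is_derive_curve_randers t : J t ->
  is_derive t 1 (fun s => r s - edot a (v s) * (sn s)^-1) 0.
Proof.
move=> Jt; have r0 := curve_speed_gt0 Jt.
have dg : is_derive t 1 (fun s => edot a (v s))
    (- (r t ^+ 2) * edot a (gamma t) - acc t * edot a (v t)).
  apply: is_derive_eq (is_derive_edot (is_derive_const a t (1 : R)) (is_derive_curve_vel Jt)) _.
  by rewrite edot0l add0r edotBr !edotZr.
have d := is_derive_sub (is_derive_curve_speed Jt) (is_derive_mul dg
  (is_derive_cosine_sin_inv a1 ((enorm1P _).1 (gS Jt)) (is_derive_curve Jt))).
apply: is_derive_eq d _; rewrite /tangent_accel.
have : sn t != 0 by rewrite gt_eqF // curve_sin_gt0.
move: (r t) (sn t) (edot a (gamma t)) (edot a (v t)) => x s f g s0.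
by field.
Qed.

Let p := gamma t0.
Let q := (r t0)^-1 *: v t0.
Let k := r t0 - edot a (v t0) * (sn t0)^-1.

Lemma curve_orthonormal : orthonormal2 p q.
Proof.
have r0 := curve_speed_gt0 Jt0; split; first exact: gS.
  by rewrite enormZ gtr0_norm ?invr_gt0 // mulVf ?gt_eqF.
by rewrite edotZr edotC edot_curve_vel // mulr0.
Qed.

Lemma curve_energy_gt0 : 0 < k.
Proof.
rewrite subr_gt0; apply: le_lt_trans (ler_norm _) _.
by apply: randers_form_lt; [|exact/enorm1P/gS|exact: edot_curve_vel|exact: g0].
Qed.

(* The arc length of gamma, read off from its (constant) Randers speed. *)
Let T t := k * (t - t0) - colatitude a (gamma t) + colatitude a p.

(** The Randers speed is [k] at all times; taking away the part due to the colatitude leaves the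
    round speed. *)
Lemma is_derive_curve_angle t : J t -> is_derive t 1 T (r t).
Proof.
move=> Jt; have d1 := is_derive_mul (is_derive_const k t (1 : R))
  (is_derive_sub (is_derive_id t (1 : R)) (is_derive_const t0 t (1 : R))).
have d := is_derive_add (is_derive_sub d1 (is_derive_colatitude a1 (gS Jt) (is_derive_curve Jt)))
  (is_derive_const (colatitude a p) t (1 : R)).
apply: is_derive_eq d _; rewrite subr0 mul0r add0r addr0 mulr1 opprK.
rewrite [k](derive0_interval iJ is_derive_curve_randers Jt0 Jt); exact: subrK.
Qed.

(* The frame (gamma, v / |v|) rotates with speed |v|. *)
Lemma curve_circle t : J t -> gamma t = circle_param p q (T t).
Proof.
pose X t := cos (T t) *: gamma t - (sin (T t) * (r t)^-1) *: v t.
pose Y t := sin (T t) *: gamma t + (cos (T t) * (r t)^-1) *: v t.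
have dcos s : J s -> is_derive s 1 (fun s => cos (T s)) (- sin (T s) * r s).
  move=> Js; exact: (@is_derive_compR R _ (@cos R) T s 1 _ _ (is_derive_cos _) (is_derive_curve_angle Js)).
have dsin s : J s -> is_derive s 1 (fun s => sin (T s)) (cos (T s) * r s).
  move=> Js; exact: (@is_derive_compR R _ (@sin R) T s 1 _ _ (is_derive_sin _) (is_derive_curve_angle Js)).
have r0 s (Js : J s) : r s != 0 by rewrite gt_eqF // curve_speed_gt0.
have dr s (Js : J s) := @is_derive_invr R _ (fun s => r s) s 1 _ (r0 s Js) (is_derive_curve_speed Js).
have dX s : J s -> is_derive s 1 X 0.
  move=> Js; have d := is_derive_sub (is_derive_scale (dcos s Js) (is_derive_curve Js))
    (is_derive_scale (is_derive_mul (dsin s Js) (dr s Js)) (is_derive_curve_vel Js)).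
  apply: is_derive_eq d _; have := r0 s Js.
  move: (r s) (acc s) (cos _) (sin _) (v s) (gamma s) => x b c d w z x0.
  apply/rowP => j; rewrite !mxE; move: (w 0 j) (z 0 j) => wj zj.
  by field.
have dY s : J s -> is_derive s 1 Y 0.
  move=> Js; have d := is_derive_add (is_derive_scale (dsin s Js) (is_derive_curve Js))
    (is_derive_scale (is_derive_mul (dcos s Js) (dr s Js)) (is_derive_curve_vel Js)).
  apply: is_derive_eq d _; have := r0 s Js.
  move: (r s) (acc s) (cos _) (sin _) (v s) (gamma s) => x b c d w z x0.
  apply/rowP => j; rewrite !mxE; move: (w 0 j) (z 0 j) => wj zj.
  by field.
move=> Jt.
have T0 : T t0 = 0 by rewrite /T subrr mulr0 sub0r addNr.
have <- : X t = p.
  rewrite (derive0_interval_rV iJ dX Jt Jt0) /X T0 cos0 sin0 mul0r scale0r subr0.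
  exact: scale1r.
have <- : Y t = q.
  by rewrite (derive0_interval_rV iJ dY Jt Jt0) /Y T0 cos0 sin0 scale0r add0r mul1r.
rewrite /circle_param /X /Y; have := cos2Dsin2 (T t).
move: (cos _) (sin _) (r t)^-1 (v t) (gamma t) => c s x w z e.
apply/rowP => j; rewrite !mxE; move: (w 0 j) (z 0 j) => wj zj.
by rewrite -[LHS]mul1r -e; ring.
Qed.

(** Measured by [circle_time], every solution moves affinely in [t]. It is thus determined by its
    circle, [k] and [c0], which is what allows its extension to the whole line. *)
Lemma curve_circle_time : exists k c0 p q, [/\ orthonormal2 p q, 0 < k &
  forall t, J t -> exists2 s, gamma t = circle_param p q s & circle_time a p q s = k * t + c0].
Proof.
exists k, (colatitude a p - k * t0), p, q; split; [exact: curve_orthonormal|exact: curve_energy_gt0|].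
move=> t Jt; exists (T t); first exact: curve_circle.
by rewrite /circle_time -curve_circle // /T; ring.
Qed.

End Solution.

End RandersGeodesics.

(** * Maximal geodesics and lengths of great circles *)

Section RandersSphereTheorem.
Context {R : realType} {n : nat}.
Variable a : 'rV[R]_n.+1.
Hypothesis a1 : edot a a < 1.
Variable F : 'rV[R]_n.+1 -> 'rV[R]_n.+1 -> R.
Hypothesis FE : forall U phi, local_coord U phi -> forall x y, U x ->
  in_coord F phi x y = randers_lag a phi x y.

Lemma circle_geodesic p q (h : R -> R) k c0 : orthonormal2 p q -> 0 < k ->
  (forall t : R, is_derive t 1 h (circle_speed a p q (h t))^-1) ->
  geodesic F setT (fun t => circle_param p q (h (k * t + c0))).
Proof.
move=> pq k0 dh; apply/(geodesicP a1 FE).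
have H t := circle_geodesic_ode a1 c0 t pq k0 dh.
split=> [|t _|t _|t _|t _]; last 3 first.
- have [d1 d2 _ _] := H t; refine (conj d1 d2).
- have [_ _ d _] := H t; refine d.
- have [_ _ _ d] := H t; refine d.
- split; [exact: openT| |by exists 0].
  by move=> x y _ _ z _.
- exact: sphere_circle.
Qed.

Lemma circle_maximal_geodesic p q : orthonormal2 p q ->
  exists J gamma, maximal_geodesic F J gamma /\ gamma @` J = range (circle_param p q).
Proof.
move=> pq; have [h [hK Kh dh]] := circle_time_inverse a1 pq.
exists setT, (fun t => circle_param p q (h (1 * t + 0))); split.
  split; first exact: circle_geodesic.
  by move=> J' _ _ sub _; apply/seteqP; split.
apply/seteqP; split => [_ [t _ <-]|_ [s _ <-]]; first by exists (h (1 * t + 0)).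
by exists (circle_time a p q s) => //; rewrite mul1r addr0 hK.
Qed.

(** A geodesic is the restriction of one defined for all times. A maximal one is therefore defined
    on the whole line, where [circle_time] takes every value, so it meets every point of the
    circle. *)
Lemma geodesic_great_circle J gamma : geodesic F J gamma ->
  exists C, [/\ great_circle C, gamma @` J `<=` C &
    maximal_geodesic F J gamma -> gamma @` J = C].
Proof.
move=> /(geodesicP a1 FE)[[oJ iJ [t0 Jt0]] gS gd g0 gode].
have [k [c0 [p [q [pq k0 gP]]]]] := curve_circle_time a1 oJ iJ Jt0 gS gd g0 gode.
exists (range (circle_param p q)); split; first by exists p, q.
  by move=> _ [t Jt <-]; have [s -> _] := gP t Jt; exists s.
move=> [_ maxg]; have [h [hK Kh dh]] := circle_time_inverse a1 pq.
have gE t : J t -> circle_param p q (h (k * t + c0)) = gamma t.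
  by move=> /gP[s -> <-]; rewrite hK.
have JT := maxg _ _ (circle_geodesic c0 pq k0 dh) (fun _ _ => I) gE.
apply/seteqP; split => [_ [t Jt <-]|_ [s _ <-]].
  by have [s -> _] := gP t Jt; exists s.
have kn : k != 0 by rewrite gt_eqF.
exists ((circle_time a p q s - c0) / k); first by rewrite -JT.
by rewrite -gE -?JT // mulrC divfK // subrK hK.
Qed.

(** [circle_time] is a primitive of the integrand, and its colatitude term has equal values at both
    ends. *)
Lemma circle_length p q : orthonormal2 p q ->
  (forall x v, sphere x -> edot x v = 0 -> F x v = enorm v - edot a v / cosine_sin a x) ->
  curve_length F (circle_param p q) 0 (2 * pi) = 2 * pi.
Proof.
move=> pq FA; rewrite /curve_length.
have -> : (fun t => F (circle_param p q t) (derive1 (circle_param p q) t)) = circle_speed a p q.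
  apply/funext => t; rewrite derive1E (is_derive_val (is_derive_circle p q t)).
  rewrite FA; [|exact: sphere_circle|by rewrite edotC (edot_circle_vel pq)].
  by rewrite (enorm_circle_vel pq).
have cs : continuous (circle_speed a p q).
  move=> t; apply/differentiable_continuous/derivable1_diffP.
  by have [] := is_derive_circle_speed a1 pq t.
have dt (t : R) := is_derive_circle_time a1 pq t.
have ct : continuous (circle_time a p q).
  by move=> t; apply/differentiable_continuous/derivable1_diffP; have [] := dt t.
rewrite /Rintegral (@continuous_FTC2 _ _ (circle_time a p q)).
- have e : 2 * pi = pi + pi :> R by ring.
  rewrite -EFinB /= /circle_time /circle_param e cosDpi sinDpi cospi sinpi cos0 sin0.
  by rewrite opprK oppr0; ring.
- by rewrite mulr_gt0 // pi_gt0.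
- exact: continuous_subspaceT.
- split; first by move=> t _; have [] := dt t.
    exact/cvg_at_right_filter/ct.
  exact/cvg_at_left_filter/ct.
- by move=> t _; rewrite derive1E (is_derive_val (dt t)).
Qed.

End RandersSphereTheorem.

Theorem mainTheorem5 (R : realType) (n : nat) (hn : (2 <= n)%N)
    (f : 'rV[R]_n.+1 -> R)
    (hf : eigenfunction n%:R f)
    (hf1 : forall p, sphere p -> `|f p| < 1) :
  let beta := fun p v : 'rV[R]_n.+1 =>
    - (sdiff f p v / Num.sqrt (1 - f p ^+ 2)) in
  is_randers beta ->
  let F := randers beta in
  exists delta : R,
    [/\ (forall U phi, local_coord U phi -> forall x, U x ->
           Num.sqrt (vec_norm (round_metric phi) x
                       (gradient (round_metric phi) (f \o phi) x) ^+ 2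
                     + f (phi x) ^+ 2) = delta) /\ delta < 1,
        (forall U phi, local_coord U phi -> forall x, U x ->
         forall y u : 'rV[R]_n, row_free (col_mx y u) ->
           (2 - delta) / (2 * (1 + delta))
             <= flag_curvature (in_coord F phi) x y u
             <= (2 + delta) / (2 * (1 - delta))),
        (forall J gamma, geodesic F J gamma ->
           exists C, [/\ great_circle C, gamma @` J `<=` C &
             maximal_geodesic F J gamma -> gamma @` J = C]) /\
        (forall C, great_circle C ->
           exists J gamma, maximal_geodesic F J gamma /\ gamma @` J = C) &
        (forall p q, orthonormal2 p q ->
           curve_length F (circle_param p q) 0 (2 * pi) = 2 * pi)].
Proof.
move=> beta _ F; have [fS _ fE] := hf.
have [a fa] := eigenfunction_linear fS fE hf1 hn.
have a1 : enorm a < 1 := linear_lt1 fa hf1.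
have a1' : edot a a < 1.
  by rewrite -enorm_sqr expr_lt1 // enorm_ge0.
have FE U phi (phiU : local_coord U phi) x y : U x ->
    in_coord F phi x y = randers_lag a phi x y.
  exact: in_coord_randers_linear fa _ _ phiU x y.
exists (enorm a); split.
- by split => // U phi phiU x Ux; exact: gradient_norm_linear fa _ _ phiU x Ux.
- move=> U phi phiU x Ux y u free.
  rewrite (flag_curvature_randers a1' phiU (FE U phi phiU) Ux free).
  by apply: (curv_ratio_bounds a1' phiU Ux); exact: row_free_neq0 free.
- split=> [J gamma|_ [p [q [pq ->]]]]; first exact: (geodesic_great_circle a1' FE).
  exact: (circle_maximal_geodesic a1' FE pq).
- move=> p q pq; apply: (circle_length a1' pq) => x v; exact: (randers_linear fa).
Qed.
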